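(* Let $G$ be a connected semisimple Lie group, $\Gamma$ a cocompact lattice of $G$, and $g\in G$. Let $T_g: G/\Gamma\to G/\Gamma$, $T_g(x)=gx$, be the left translation by $g$. Then the topological entropy function $h_{\mathrm{top}}: C^1(G/\Gamma)\to \mathbb{R}^+\cup\{0\}$ is continuous at $T_g$.
   Context: $C^1(G/\Gamma)$ is the space of $C^1$ diffeomorphisms of the compact manifold $G/\Gamma$ with the $C^1$ topology. $h_{\mathrm{top}}$ is the usual topological entropy. *)

(* Defs.v *)
From HB Require Import structures.
From mathcomp Require Import all_boot all_order all_algebra.
From mathcomp Require Import generic_quotient.
From mathcomp Require Import all_classical all_reals all_analysis.

Set Implicit Arguments.
Unset Strict Implicit.
Unset Printing Implicit Defensive.

Import Order.TTheory GRing.Theory Num.Theory.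
Import numFieldNormedType.Exports.

Local Open Scope quotient_scope.
Local Open Scope classical_set_scope.
Local Open Scope ring_scope.

Section Manifolds.
Context {R : realType}.

(* Meaningful for open U: the values of f outside U are irrelevant. *)
Fixpoint Ck_on {V W : normedModType R} (k : nat) (U : set V) (f : V -> W) :
    Prop :=
  match k with
  | 0 => forall x, U x -> {for x, continuous f}
  | k'.+1 => (forall x, U x -> differentiable f x) /\
             (forall v, Ck_on k' U ('D_v f))
  end.

(* The coordinate map is total but only meaningful on the domain;           *)
(* likewise its inverse is only meaningful on the image of the domain.      *)
Record chart (M : Type) (n : nat) := Chart {
  chart_dom : set M;
  chart_map :> M -> 'rV[R]_n;
  chart_inv : 'rV[R]_n -> M }.

Definition chart_cod M n (c : chart M n) : set 'rV[R]_n := c @` chart_dom c.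

Definition is_chart (M : topologicalType) n (c : chart M n) : Prop :=
  [/\ open (chart_dom c), open (chart_cod c),
      forall x, chart_dom c x -> chart_inv c (c x) = x,
      forall x, chart_dom c x -> {for x, continuous c} &
      forall y, chart_cod c y -> {for y, continuous (chart_inv c)}].

Definition smooth_atlas (M : topologicalType) n (A : set (chart M n)) : Prop :=
  [/\ forall c, A c -> is_chart c,
      forall x, exists2 c, A c & chart_dom c x &
      forall c c', A c -> A c' -> forall k,
        Ck_on k (c @` (chart_dom c `&` chart_dom c')) (c' \o chart_inv c)].

Definition is_Ck k (M N : topologicalType) m n
    (A : set (chart M m)) (B : set (chart N n)) (f : M -> N) : Prop :=
  continuous f /\
  forall c c', A c -> B c' ->
    Ck_on k (c @` (chart_dom c `&` f @^-1` chart_dom c'))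
      (c' \o f \o chart_inv c).

Definition is_smooth (M N : topologicalType) m n
    (A : set (chart M m)) (B : set (chart N n)) (f : M -> N) : Prop :=
  forall k, is_Ck k A B f.

Definition prod_chart M N m n (c : chart M m) (c' : chart N n) :
    chart (M * N) (m + n) :=
  Chart (chart_dom c `*` chart_dom c')
    (fun p => row_mx (c p.1) (c' p.2))
    (fun v => (chart_inv c (lsubmx v), chart_inv c' (rsubmx v))).

Definition prod_atlas M N m n (A : set (chart M m)) (B : set (chart N n)) :
    set (chart (M * N) (m + n)) :=
  [set d | exists c c', [/\ A c, B c' & d = prod_chart c c']].

End Manifolds.
Arguments chart : clear implicits.

HB.structure Definition TopGroup := {G of Group G & Topological G}.

HB.mixin Record isLieGroup (R : realType) G of Group G & Topological G := {
  lie_dim : nat;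
  lie_atlas : set (chart R G lie_dim);
  lie_hausdorff : hausdorff_space G;
  lie_second_countable : @second_countable G;
  lie_atlas_smooth : smooth_atlas lie_atlas;
  lie_mul_smooth : is_smooth (prod_atlas lie_atlas lie_atlas) lie_atlas
    (fun p : G * G => (p.1 * p.2)%g);
  lie_inv_smooth : is_smooth lie_atlas lie_atlas (fun x : G => x^-1%g)
}.

#[short(type="lieGroupType")]
HB.structure Definition LieGroup (R : realType) :=
  {G of Group G & Topological G & isLieGroup R G}.

Section LieAlgebra.
Context {R : realType} {G : lieGroupType R}.
Local Notation n := (@lie_dim R G).
Variable c : chart R G n.

(* In these definitions c is a chart around 1, which identifies the tangent *)
(* space of G at 1 with 'rV[R]_n.                                            *)

(* Ad_a is the differential at 1 of conjugation by a. *)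
Definition lie_Ad (a : G) (v : 'rV[R]_n) : 'rV[R]_n :=
  'D_v (fun x => c (a * chart_inv c x * a^-1)%g) (c 1%g).

(* [u, v] = ad_u v, where ad is the differential at 1 of Ad. *)
Definition lie_bracket (u v : 'rV[R]_n) : 'rV[R]_n :=
  'D_u (fun y => lie_Ad (chart_inv c y) v) (c 1%g).

Definition lie_ideal (U : {vspace 'rV[R]_n}) : Prop :=
  forall u v, v \in U -> lie_bracket u v \in U.

(* By bilinearity the brackets of basis vectors span [U, U]. *)
Definition lie_derived (U : {vspace 'rV[R]_n}) : {vspace 'rV[R]_n} :=
  <<[seq lie_bracket u v | u <- vbasis U, v <- vbasis U]>>%VS.

Definition lie_solvable (U : {vspace 'rV[R]_n}) : Prop :=
  exists k, iter k lie_derived U = 0%VS.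

End LieAlgebra.

(* The Lie algebra has no nonzero solvable ideal. Different charts around 1 *)
(* give isomorphic Lie algebras.                                            *)
Definition semisimple (R : realType) (G : lieGroupType R) : Prop :=
  forall c : chart R G lie_dim, lie_atlas c -> chart_dom c 1%g ->
  forall U, lie_ideal c U -> lie_solvable c U -> U = 0%VS.

Section CosetSpace.
Context {G : TopGroup.type} (Gamma : groupClosed G).

Definition lcoset_eq : rel G := fun x y => (x^-1 * y)%g \in Gamma.

Lemma lcoset_eq_refl : reflexive lcoset_eq.
Proof. by move=> x; rewrite /lcoset_eq mulVg gpred1. Qed.

Lemma lcoset_eq_sym : symmetric lcoset_eq.
Proof. by move=> x y; rewrite /lcoset_eq -gpredV invgM invgK. Qed.

Lemma lcoset_eq_trans : transitive lcoset_eq.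
Proof.
move=> y x z; rewrite /lcoset_eq => xy yz.
by rewrite -[z](mulVKg y) mulgA gpredM.
Qed.

Canonical lcoset_equiv :=
  EquivRel lcoset_eq lcoset_eq_refl lcoset_eq_sym lcoset_eq_trans.

Definition coset_space : Type := quotient_topology {eq_quot lcoset_equiv}.

HB.instance Definition _ := Topological.on coset_space.
HB.instance Definition _ := Quotient.on coset_space.
HB.instance Definition _ := isPointed.Build coset_space (\pi 1%g).

Definition coset_pi (x : G) : coset_space := \pi x.

Definition translation (g : G) (x : coset_space) : coset_space :=
  coset_pi (g * repr x)%g.

Lemma translation_pi g x : translation g (coset_pi x) = coset_pi (g * x)%g.
Proof.
apply/eqmodP; rewrite /= /lcoset_eq invgM -mulgA mulKg.
by have /eqmodP := reprK (coset_pi x).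
Qed.

Definition discrete_subgroup : Prop :=
  [set` Gamma] `<=` isolated [set` Gamma].

Definition is_lattice (R : realType) : Prop :=
  discrete_subgroup /\
  exists mu : {measure set (g_sigma_algebraType (@open coset_space)) -> \bar R},
    [/\ (0 < mu setT)%E, (mu setT < +oo)%E &
        forall g (A : set coset_space), <<s @open coset_space >> A ->
          mu (translation g @^-1` A) = mu A].

End CosetSpace.

Section CosetAtlas.
Context {R : realType} {G : lieGroupType R} (Gamma : groupClosed G).

(* The chart of G/Gamma obtained by inverting the projection on U. *)
Definition coset_chart n (c : chart R G n) (U : set G) :
    chart R (coset_space Gamma) n :=
  Chart (coset_pi Gamma @` U)
    (fun y => c (xget 1%g [set x | U x /\ coset_pi Gamma x = y]))
    (coset_pi Gamma \o chart_inv c).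

Definition coset_atlas : set (chart R (coset_space Gamma) (@lie_dim R G)) :=
  [set d | exists c U, [/\ lie_atlas c, open U, U `<=` chart_dom c,
    {in U &, injective (coset_pi Gamma)} & d = coset_chart c U]].

End CosetAtlas.
Arguments coset_atlas {R G} Gamma _.

Section C1Diffeos.
Context {R : realType} {M : topologicalType} {n : nat}.
Variable A : set (chart R M n).

Definition is_C1_diffeo (f : M -> M) : Prop :=
  exists f', [/\ cancel f f', cancel f' f, is_Ck 1 A A f & is_Ck 1 A A f'].

Record C1_diffeo := C1Diffeo {
  C1_fun :> M -> M;
  C1_funP : is_C1_diffeo C1_fun }.

HB.instance Definition _ := gen_eqMixin C1_diffeo.
HB.instance Definition _ := gen_choiceMixin C1_diffeo.

(* The bound over the unit ball controls the operator norm of the           *)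
(* difference of the differentials.                                         *)
Definition C1_subbasic (f : M -> M) (c c' : chart R M n) (K : set M) (e : R) :
    set C1_diffeo :=
  [set h : C1_diffeo | forall x, K x ->
    [/\ chart_dom c' (h x), `|c' (h x) - c' (f x)| < e &
        forall v, `|v| <= 1 ->
          `|'D_v (c' \o h \o chart_inv c) (c x)
            - 'D_v (c' \o f \o chart_inv c) (c x)| < e]].

(* The weak (compact-open) C^1 topology. *)
Definition C1_subbase : set (set C1_diffeo) :=
  [set N | exists (f : C1_diffeo) c c' K e,
    [/\ A c /\ A c', compact K, K `<=` chart_dom c,
        f @` K `<=` chart_dom c' & 0 < e /\ N = C1_subbasic f c c' K e]].

HB.instance Definition _ :=
  @isSubBaseTopological.Build C1_diffeo (set C1_diffeo) C1_subbase id.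

End C1Diffeos.

Section Entropy.
Context {R : realType} {M : topologicalType}.

Definition open_cover (C : set (set M)) : Prop :=
  C `<=` open /\ \bigcup_(B in C) B = setT.

(* Cardinality of a smallest finite subcover. *)
Definition cover_number (C : set (set M)) : R :=
  inf [set (size s)%:R | s in [set s : seq (set M) |
    [set` s] `<=` C /\ \bigcup_(B in [set` s]) B = setT]].

(* The join of the covers f^-i C for i < k. *)
Definition iterated_join (f : M -> M) (C : set (set M)) (k : nat) :
    set (set M) :=
  [set B | exists2 D : nat -> set M, (forall i, C (D i)) &
    B = \bigcap_(i in `I_k) (iter i f @^-1` D i)].

Definition cover_entropy (f : M -> M) (C : set (set M)) : R :=
  limn (fun k => ln (cover_number (iterated_join f C k)) / k%:R).

(* The definition by open covers (Adler, Konheim and McAndrew), for compact *)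
(* M.                                                                       *)
Definition htop (f : M -> M) : \bar R :=
  ereal_sup [set (cover_entropy f C)%:E | C in open_cover].

End Entropy.

(* Main.v *)
From HB Require Import structures.
Require Import Defs.
From mathcomp Require Import all_boot all_order all_algebra.
From mathcomp Require Import generic_quotient.
From mathcomp Require Import all_classical all_reals all_analysis.
From mathcomp Require Import complex.
From mathcomp Require Import zify ring lra.

Set Implicit Arguments.
Unset Strict Implicit.
Unset Printing Implicit Defensive.

Import Order.TTheory GRing.Theory Num.Theory.
Import numFieldNormedType.Exports.

Local Open Scope classical_set_scope.
Local Open Scope ring_scope.

(** In coordinates obtained from a chart at the identity by right translations
    ([coset_exp]), the translation [T] by [g] has the same derivative at every
    point of the coset space, the adjoint matrix [A] of [g]
    ([translation_tangent]). A diffeomorphism [f] which is C^1-close to [T] has,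
    in these coordinates, a derivative close to [A] at every point
    ([perturb_tangent]). It is therefore enough to compute the entropy of [f]
    from [A] up to [eps], and this is [htop_pinched].

    Split the vector space into the part where [A] has subexponential growth and
    the part where it is expanding ([hyperbolic_split]), and put [B = A ^ N]
    with [N] large. Let [K] be the maximal number of points of the unit ball of
    the expanding part whose images under [B] are [20]-separated
    ([separated_net]).

    Upper bound. A ball of a small radius is mapped by the [N]-th iterate of [f]
    into a neighbourhood of its image under [B]. This is covered by [K] balls in
    the expanding directions, up to a constant, and in the other directions by a
    number of balls which is subexponential in [N] ([image_cover]). Counting
    itineraries bounds the entropy by [ln K / N + eps] ([htop_le_count]).

    Lower bound. A small disc tangent to the expanding directions is mapped over
    [K] discs of the same size around points which are far apart ([disc_image]).
    After [m] steps this gives [K ^ m] orbits which are separated at a fixed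
    scale ([disc_tree]), so that the entropy is at least [ln K / N]
    ([htop_ge_count]).

    Both bounds involve the same [K], so that no formula for the entropy of [T]
    is needed: the entropies of [f] and [T] lie in the same interval of length
    [eps]. Finiteness of the entropy of an arbitrary diffeomorphism follows from
    the same count for Lipschitz maps ([diffeo_htop_fin]).

    Derivatives are handled through strict differentiability ([sdiff]), which is
    equivalent to being of class C^1 on open sets and is a two-point estimate,
    the form in which the counting arguments use it. *)

(** * Subadditive sequences and entropy of covers *)

Lemma lt_archi_bound (R : archiRealDomainType) (x : R) :
  x < (Num.bound `|x|)%:R.
Proof. exact: le_lt_trans (ler_norm x) (archi_boundP (normr_ge0 x)). Qed.

Lemma subadditive_muln (R : realType) (a : nat -> R) :
  a 0%N = 0 -> (forall k l, a (k + l)%N <= a k + a l) ->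
  forall q k, a (q * k)%N <= q%:R * a k.
Proof.
move=> a0 asub; elim=> [|q IH] k; first by rewrite mul0n mul0r a0.
by rewrite mulSn (le_trans (asub _ _))// -natr1 mulrDl mul1r addrC lerD2r.
Qed.

(** Fekete's lemma: writing [k = q * k0 + r], subadditivity bounds [a k / k] by
    [a k0 / k0] up to an error [O (1 / k)]. *)
Lemma fekete (R : realType) (a : nat -> R) :
  a 0%N = 0 -> (forall k, 0 <= a k) ->
  (forall k l, a (k + l)%N <= a k + a l) ->
  exists2 L, (fun k => a k / k%:R) @ \oo --> L &
    forall k, (0 < k)%N -> L <= a k / k%:R.
Proof.
move=> a0 a_ge0 asub.
pose S := [set a k.+1 / k.+1%:R | k in [set: nat]].
have S0 : S !=set0 by exists (a 1%N / 1%:R), 0%N.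
have lbS : has_lbound S.
  by exists 0 => _ [k _ <-]; rewrite divr_ge0.
have Lle k : (0 < k)%N -> inf S <= a k / k%:R.
  by case: k => // k _; apply: ge_inf => //; exists k.
exists (inf S) => //; apply/cvgrPdist_lt => e e0.
have [_ [k0 _ <-] k0P] : exists2 x, S x & x < inf S + e / 2.
  by apply: inf_adherent; [exact: divr_gt0|split].
pose M := \sum_(r < k0.+1) a r.
near=> k.
have k_gt0 : (0 < k)%N by near: k; exists 1%N.
have kR : 0 < k%:R :> R by rewrite ltr0n.
rewrite ltr_norml; apply/andP; split; last first.
  by rewrite (le_lt_trans _ e0)// subr_le0 Lle.
suff : a k / k%:R < inf S + e by lra.
have ak : a k <= k%:R * (a k0.+1 / k0.+1%:R) + M.
  rewrite {1}(divn_eq k k0.+1) (le_trans (asub _ _))// lerD//.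
    rewrite (le_trans (subadditive_muln a0 asub _ _))//.
    rewrite (_ : k%:R * _ = k%:R / k0.+1%:R * a k0.+1); last by ring.
    rewrite ler_wpM2r//.
    by rewrite ler_pdivlMr ?ltr0n// -natrM ler_nat leq_trunc_div.
  rewrite /M (bigD1 (Ordinal (ltn_pmod k (ltn0Sn k0))))//=.
  by rewrite lerDl sumr_ge0.
rewrite ltr_pdivrMr// (le_lt_trans ak)//.
have Mk : M < k%:R * (e / 2).
  rewrite -ltr_pdivrMr ?divr_gt0//.
  near: k; exists (Num.bound `|M / (e / 2)|) => //= k /=.
  rewrite -(ler_nat R) => /(lt_le_trans _); apply.
  exact: lt_archi_bound.
have : k%:R * (a k0.+1 / k0.+1%:R) < k%:R * (inf S + e / 2) by rewrite ltr_pM2l.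
move: Mk; set x := a _ / _; nra.
Unshelve. all: by end_near. Qed.

Section CoverEntropy.
Context {R : realType} {M : ptopologicalType}.
Implicit Types (C : set (set M)) (f : M -> M).

Definition subcover C (s : seq (set M)) :=
  [set` s] `<=` C /\ \bigcup_(B in [set` s]) B = setT.

Lemma subcover_ex C s x : subcover C s -> exists2 B, B \in s & B x.
Proof.
move=> [_ sT]; have : [set: M] x by [].
by rewrite -sT => -[B /= Bs Bx]; exists B.
Qed.

Lemma cover_number_le C s :
  subcover C s -> cover_number C <= (size s)%:R :> R.
Proof.
move=> Cs; apply: ge_inf; last by exists s.
by exists 0 => _ [t _ <-].
Qed.

Lemma cover_number_attained C s0 : subcover C s0 ->
  exists2 s, subcover C s & cover_number C = (size s)%:R :> R.
Proof.
move=> Cs0; pose P n := `[< exists2 s, subcover C s & size s = n >].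
have exP : exists n, P n by exists (size s0); apply/asboolP; exists s0.
case: (ex_minnP exP) => m /asboolP[s Cs sn] mP.
exists s => //; apply/eqP; rewrite eq_le cover_number_le//=.
apply: lb_le_inf; first by exists (size s0)%:R, s0.
by move=> _ [t Ct <-]; rewrite ler_nat sn mP//; apply/asboolP; exists t.
Qed.

Lemma compact_subcover C : compact [set: M] -> open_cover C ->
  exists s, subcover C s.
Proof.
rewrite compact_cover => cM [Co CT].
have [|D' DC DT] := cM _ C id Co; first by rewrite /cover CT.
exists (finmap.enum_fset D'); split.
  by move=> B /= /DC; rewrite inE.
by rewrite -subTset.
Qed.

Lemma cover_number_ge1 C s0 : subcover C s0 -> 1 <= cover_number C :> R.
Proof.
move=> /cover_number_attained[s Cs ->]; rewrite ler1n lt0n size_eq0.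
by have [B + _] := subcover_ex point Cs; case: s {Cs}.
Qed.

Lemma iterated_join_add f C k l B B' :
  iterated_join f C k B -> iterated_join f C l B' ->
  iterated_join f C (k + l) (B `&` (iter k f @^-1` B')).
Proof.
move=> [D CD ->] [D' CD' ->].
exists (fun i => if (i < k)%N then D i else D' (i - k)%N).
  by move=> i; case: ifP.
apply/seteqP; split=> x /=.
  move=> [Dx D'x] i /= ikl; case: ltnP => ik; first exact: Dx.
  have := D'x (i - k)%N; rewrite /= -iterD subnK//; apply; lia.
move=> H; split=> i /= ik; first by have := H i; rewrite /= ik; apply; lia.
have ikl : `I_(k + l) (i + k)%N by rewrite /=; lia.
by have := H _ ikl; rewrite addnK ltnNge leq_addl/= iterD.
Qed.

Lemma iterated_join0 f C B0 : C B0 -> iterated_join f C 0 setT.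
Proof. by move=> CB0; exists (fun=> B0) => //; rewrite II0 bigcap_set0. Qed.

Lemma iter_continuous f k : continuous f -> continuous (iter k f).
Proof.
move=> cf; elim: k => [|k IH] x; first exact: cvg_id.
by apply: continuous_comp; [exact: IH|exact: cf].
Qed.

Lemma open_cover_join f C k : continuous f -> open_cover C ->
  open_cover (iterated_join f C k).
Proof.
move=> cf [Co CT]; split.
  move=> _ [D CD ->].
  elim: k => [|k IH]; first by rewrite II0 bigcap_set0; exact: openT.
  rewrite IIS bigcap_setU bigcap_set1; apply: openI => //.
  by apply: open_comp; [move=> x _; exact: iter_continuous|exact: Co].
rewrite -subTset => x _.
have /choice[D DP] : forall i, exists B, C B /\ B (iter i f x).
  move=> i; have : [set: M] (iter i f x) by [].
  by rewrite -CT => -[B CB Bx]; exists B.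
exists (\bigcap_(i in `I_k) (iter i f @^-1` D i)).
  by exists D => // i; have [] := DP i.
by move=> i _; have [] := DP i.
Qed.

Lemma subcover_join_add f C k l s t :
  subcover (iterated_join f C k) s -> subcover (iterated_join f C l) t ->
  subcover (iterated_join f C (k + l))
    [seq B `&` (iter k f @^-1` B') | B <- s, B' <- t].
Proof.
move=> sC tC; split.
  move=> _ /allpairsP[[B B'] [/= Bs Bt ->]]; apply: iterated_join_add.
    by have [+ _] := sC; apply.
  by have [+ _] := tC; apply.
rewrite -subTset => x _.
have [B Bs Bx] := subcover_ex x sC.
have [B' Bt Bx'] := subcover_ex (iter k f x) tC.
exists (B `&` (iter k f @^-1` B')) => //=.
by apply/allpairsP; exists (B, B').
Qed.

Hypothesis cM : compact [set: M].

(** The logarithms of the cover numbers of the joins are subadditive, so that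
    the limit which defines the entropy exists and is an infimum. *)
Lemma cover_entropy_cvg f C : continuous f -> open_cover C ->
  (fun k => ln (cover_number (iterated_join f C k)) / k%:R : R) @ \oo -->
    (cover_entropy f C : R) /\
  forall k, (0 < k)%N ->
    (cover_entropy f C : R) <= ln (cover_number (iterated_join f C k)) / k%:R.
Proof.
move=> cf oC.
have sub k : exists s, subcover (iterated_join f C k) s.
  by apply: compact_subcover => //; exact: open_cover_join.
have ge1 k : 1 <= cover_number (iterated_join f C k) :> R.
  by have [s /cover_number_ge1] := sub k.
have [||k l|L aL LP] := @fekete R
  (fun k => ln (cover_number (iterated_join f C k))).
- have [B0 CB0] : exists B, C B.
    by have : [set: M] point by []; rewrite -oC.2 => -[B CB _]; exists B.
  suff -> : cover_number (iterated_join f C 0) = 1 :> R by rewrite ln1.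
  apply/eqP; rewrite eq_le ge1 andbT.
  rewrite (le_trans (@cover_number_le _ [:: setT] _))//; split.
    by move=> B /=; rewrite inE => /eqP ->; exact: iterated_join0 CB0.
  by rewrite -subTset => x _; exists setT => //=; rewrite inE.
- by move=> k; rewrite ln_ge0.
- have [s /[dup] sk /(cover_number_attained)[s' sk' ->]] := sub k.
  have [t /[dup] tl /(cover_number_attained)[t' tl' ->]] := sub l.
  have sz u v : subcover (iterated_join f C v) u -> 0 < (size u)%:R :> R.
    move=> uv; rewrite ltr0n lt0n size_eq0.
    by have [B + _] := subcover_ex point uv; case: u {uv}.
  have [s0 t0] := (sz _ _ sk', sz _ _ tl').
  rewrite -lnM ?posrE// ler_ln ?posrE ?mulr_gt0//; last first.
    exact: lt_le_trans ltr01 (ge1 _).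
  rewrite (le_trans (cover_number_le (subcover_join_add sk' tl')))//.
  by rewrite size_allpairs natrM.
- by have -> : cover_entropy f C = L :> R by exact: cvg_lim.
Qed.

Lemma htop_ge0 f : continuous f -> (0 <= htop (R := R) f)%E.
Proof.
move=> cf; have oT : open_cover ([set setT] : set (set M)).
  by split=> [_ ->|]; [exact: openT|rewrite bigcup_set1].
apply: le_trans (_ : (cover_entropy f [set setT] : R)%:E <= _)%E; last first.
  by apply: ereal_sup_ubound; exists [set setT].
have [cvgE _] := cover_entropy_cvg cf oT.
rewrite lee_fin; apply: limr_ge; first by apply/cvg_ex; eexists; exact: cvgE.
apply: nearW => k.
have [s /cover_number_ge1 H] := compact_subcover cM (open_cover_join k cf oT).
by rewrite divr_ge0// ln_ge0.
Qed.

(** The Fekete limit is an infimum, so a bound along the multiples of [N]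
    controls it, and the factor [L] disappears in the limit. *)
Lemma cover_entropy_le f C (N K L : nat) : continuous f -> open_cover C ->
  (0 < N)%N -> (0 < K)%N -> (0 < L)%N ->
  (forall m, cover_number (iterated_join f C (N * m)) <=
     (L * K ^ m)%:R :> R) ->
  cover_entropy f C <= ln K%:R / N%:R :> R.
Proof.
move=> cf oC N0 K0 L0 H; rewrite leNgt; apply/negP => lt.
have [_ le] := cover_entropy_cvg cf oC.
set c := cover_entropy f C in lt le.
have NR : 0 < N%:R :> R by rewrite ltr0n.
have {}lt : 0 < c * N%:R - ln K%:R by rewrite subr_gt0 -ltr_pdivrMr.
have {}le m : (0 < m)%N -> m%:R * (c * N%:R - ln K%:R) <= ln L%:R.
  move=> m0; have mN0 : (0 < N * m)%N by rewrite muln_gt0 N0.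
  have := le _ mN0; rewrite ler_pdivlMr ?ltr0n// => {}le.
  have : ln (cover_number (iterated_join f C (N * m))) <=
      ln L%:R + m%:R * ln K%:R :> R.
    rewrite mulr_natl -lnXn ?ltr0n// -lnM ?posrE ?exprn_gt0 ?ltr0n//.
    rewrite -natrX -natrM ler_ln ?posrE ?H ?ltr0n ?muln_gt0 ?L0 ?expn_gt0 ?K0//.
    have [s /cover_number_ge1 H1] :=
      compact_subcover cM (open_cover_join (N * m) cf oC).
    exact: lt_le_trans ltr01 H1.
  move: le; rewrite natrM; lra.
have := le (Num.bound `|ln L%:R / (c * N%:R - ln K%:R)|).+1 isT.
apply/negP; rewrite -ltNge -ltr_pdivrMr//.
by rewrite (lt_le_trans (lt_archi_bound _))// ler_nat.
Qed.

Lemma cover_entropy_ge f C (N K : nat) : continuous f -> open_cover C ->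
  (0 < N)%N -> (0 < K)%N ->
  (forall m, (K ^ m)%:R <= cover_number (iterated_join f C (m * N).+1) :> R) ->
  ln K%:R / N%:R <= cover_entropy f C :> R.
Proof.
move=> cf oC N0 K0 H; rewrite leNgt; apply/negP => lt.
have [cvgE _] := cover_entropy_cvg cf oC.
set c := cover_entropy f C in lt cvgE.
have NR : 0 < N%:R :> R by rewrite ltr0n.
have [c' cc' c'lt] : exists2 c', c < c' & c' < ln K%:R / N%:R.
  by exists ((c + ln K%:R / N%:R) / 2); lra.
have {}c'lt : 0 < ln K%:R - c' * N%:R by rewrite subr_gt0 -ltr_pdivlMr.
have : \forall k \near \oo,
    ln (cover_number (iterated_join f C k)) / k%:R < c' :> R.
  by apply: (cvgr_lt _ cvgE).
move=> [n0 _ n0P].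
pose m := maxn n0 (Num.bound `|c' / (ln K%:R - c' * N%:R)|).
have nm : (n0 <= (m * N).+1)%N.
  apply: leqW; apply: leq_trans (leq_pmulr m N0); exact: leq_maxl.
have := n0P _ nm; rewrite /= ltr_pdivrMr ?ltr0n//; apply/negP; rewrite -leNgt.
have mc : c' < m%:R * (ln K%:R - c' * N%:R).
  rewrite -ltr_pdivrMr//.
  by rewrite (lt_le_trans (lt_archi_bound _))// ler_nat leq_maxr.
apply: le_trans (_ : m%:R * ln K%:R <= _).
  by rewrite -natr1 natrM; lra.
rewrite mulr_natl -lnXn ?ltr0n// -natrX ler_ln ?posrE ?H//.
  by rewrite ltr0n expn_gt0 K0.
by rewrite (lt_le_trans _ (H m))// ltr0n expn_gt0 K0.
Qed.

End CoverEntropy.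

(** * Row vectors with the supremum norm *)

Section RowVectors.
Context {R : realType}.

Lemma ler_coord_norm n (X : 'rV[R]_n) i : `|X 0 i| <= `|X|.
Proof.
rewrite [leRHS]/Num.norm/= mx_normrE; apply/bigmax_geP; right => /=.
by exists (0, i).
Qed.

Lemma norm_rV_le n (X : 'rV[R]_n) c :
  0 <= c -> (forall i, `|X 0 i| <= c) -> `|X| <= c.
Proof.
move=> c0 Xc; rewrite [leLHS]/Num.norm/= mx_normrE; apply/bigmax_leP; split=> //.
by move=> -[i j] _ /=; rewrite ord1.
Qed.

Lemma norm_lsubmx m n (X : 'rV[R]_(m + n)) : `|lsubmx X| <= `|X|.
Proof. by apply: norm_rV_le => // i; rewrite mxE ler_coord_norm. Qed.

Lemma norm_rsubmx m n (X : 'rV[R]_(m + n)) : `|rsubmx X| <= `|X|.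
Proof. by apply: norm_rV_le => // i; rewrite mxE ler_coord_norm. Qed.

Lemma norm_row_mx_le m n (X : 'rV[R]_m) (Y : 'rV[R]_n) c :
  `|X| <= c -> `|Y| <= c -> `|row_mx X Y| <= c.
Proof.
move=> Xc Yc; apply: norm_rV_le => [|i]; first exact: le_trans Xc.
rewrite mxE; case: fintype.split => j.
  exact: le_trans (ler_coord_norm _ _) Xc.
exact: le_trans (ler_coord_norm _ _) Yc.
Qed.

Lemma norm_rV_sub m n (X : 'rV[R]_(m + n)) c :
  `|lsubmx X| <= c -> `|rsubmx X| <= c -> `|X| <= c.
Proof. by move=> Xl Xr; rewrite -[X]hsubmxK; exact: norm_row_mx_le. Qed.

Lemma mulmx_bound m n (A : 'M[R]_(m, n)) :
  exists2 D, 0 < D & forall X : 'rV[R]_m, `|X *m A| <= D * `|X|.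
Proof.
exists (1 + \sum_i \sum_j `|A i j|) => [|X].
  by rewrite ltr_wpDr// sumr_ge0// => i _; rewrite sumr_ge0.
apply: norm_rV_le => [|j].
  rewrite mulr_ge0// addr_ge0// sumr_ge0// => i _; rewrite sumr_ge0//.
rewrite mxE (le_trans (ler_norm_sum _ _ _))// mulrDl mul1r.
rewrite ler_wpDl// mulr_suml ler_sum// => i _.
rewrite normrM mulrC ler_pM// ?ler_coord_norm// (bigD1 j)//=.
by rewrite lerDl sumr_ge0.
Qed.

Lemma ler_norm_dist (V : normedZmodType R) (x y : V) : `|x| <= `|x - y| + `|y|.
Proof. by rewrite -{1}(subrK y x) ler_normD. Qed.

(** The centres form the grid of mesh [1 / 8] in the box. *)
Lemma box_cover n (L : nat) :
  exists2 s : seq 'rV[R]_n, size s = ((16 * L).+1 ^ n)%N &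
    forall X : 'rV[R]_n, `|X| <= L%:R ->
      exists2 c, c \in s & `|X - c| <= 1 / 8.
Proof.
pose c (f : {ffun 'I_n -> 'I_(16 * L).+1}) : 'rV[R]_n :=
  \row_i ((f i)%:R / 8 - L%:R).
exists [seq c f | f <- enum {ffun 'I_n -> 'I_(16 * L).+1}].
  by rewrite size_map -cardE card_ffun !card_ord.
move=> X XL.
have XiL i : `|X 0 i| <= L%:R by rewrite (le_trans (ler_coord_norm _ _)).
have ge0 i : 0 <= 8 * (X 0 i + L%:R).
  by move: (XiL i); rewrite ler_norml => /andP[]; lra.
pose t i := Num.trunc (8 * (X 0 i + L%:R)).
have lt i : (t i < (16 * L).+1)%N.
  have tX := trunc_itv (ge0 i); rewrite ltnS -(ler_nat R) natrM.
  by move: (XiL i) tX; rewrite ler_norml -/(t i) => /andP[] + + /andP[]; lra.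
exists (c [ffun i => Ordinal (lt i)]); first by rewrite map_f// mem_enum.
apply: norm_rV_le => [|i]; first by lra.
rewrite !mxE ffunE /=; have := trunc_itv (ge0 i) => /andP[].
rewrite -/(t i) => h1.
by rewrite -[(t i).+1%:R]natr1 ler_norml => h2; apply/andP; split; lra.
Qed.

End RowVectors.

(** * Local exponential coordinates *)

Section Frame.
Context {R : realType} {M : ptopologicalType}.

(** The point [e X x] is the one whose coordinates centred at [x] are [X]. The
    coordinates are additive to first order, which [frame_add] and [frame_sub]
    express uniformly in the centre, and small balls in these coordinates are
    comparable to open covers. *)
Record exp_frame n (e : 'rV[R]_n -> M -> M) : Prop := ExpFrame {
  frame0 : forall x, e 0 x = x;
  frame_inj : exists2 r : R, 0 < r & forall x (X Y : 'rV[R]_n), `|X| <= r -> `|Y| <= r ->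
    e X x = e Y x -> X = Y;
  frame_add : forall eta : R, 0 < eta -> exists2 r : R, 0 < r &
    forall x (X Y : 'rV[R]_n), `|X| <= r -> `|Y| <= r ->
    exists2 Z : 'rV[R]_n, e X (e Y x) = e Z x & `|Z - (X + Y)| <= eta * `|X|;
  frame_sub : forall eta : R, 0 < eta -> exists2 r : R, 0 < r &
    forall x (Y Z : 'rV[R]_n), `|Y| <= r -> `|Z| <= r ->
    exists2 W : 'rV[R]_n, e W (e Y x) = e Z x & `|W - (Z - Y)| <= eta * `|Z - Y|;
  frame_lebesgue : forall C, open_cover C -> exists2 r : R, 0 < r &
    forall x, exists2 B, C B & forall X : 'rV[R]_n, `|X| <= r -> B (e X x);
  frame_fine : forall r : R, 0 < r -> exists2 C, open_cover C &
    forall B x y, C B -> B x -> B y -> exists2 X : 'rV[R]_n, `|X| <= r & y = e X x }.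

(** In the coordinates of the frame the differential of [f] is everywhere
    within [eta] of the same matrix [A]. *)
Definition tangent n (e : 'rV[R]_n -> M -> M) (f : M -> M) (A : 'M[R]_n)
    (eta : R) :=
  exists2 r : R, 0 < r & forall x (X : 'rV[R]_n), `|X| <= r ->
    exists2 Y : 'rV[R]_n, f (e X x) = e Y (f x) & `|Y - X *m A| <= eta * `|X|.

Lemma exp_frame_linear m n (P : 'M[R]_(m, n)) (Q : 'M[R]_(n, m))
    (e : 'rV[R]_n -> M -> M) :
  P *m Q = 1%:M -> Q *m P = 1%:M ->
  exp_frame e -> exp_frame (fun X => e (X *m P)).
Proof.
move=> PQ QP [e0 einj eadd esub eleb efine].
have [p p0 pP] := mulmx_bound P; have [q q0 qP] := mulmx_bound Q.
have small (r : R) (X : 'rV[R]_m) : `|X| <= r / p -> `|X *m P| <= r.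
  by move=> Xr; rewrite (le_trans (pP _))// mulrC -ler_pdivlMr.
split=> [x||eta eta0|eta eta0|C oC|r r0].
- by rewrite mul0mx e0.
- have [r r0 rP] := einj; exists (r / p) => [|x X Y /small Xr /small Yr].
    exact: divr_gt0.
  by move/(rP _ _ _ Xr Yr) => XY; rewrite -[X]mulmx1 -PQ mulmxA XY -mulmxA PQ mulmx1.
- have [|r r0 rP] := eadd (eta / (p * q)); first by rewrite divr_gt0// mulr_gt0.
  exists (r / p) => [|x X Y /small Xr /small Yr]; first exact: divr_gt0.
  have [Z eZ ZP] := rP x _ _ Xr Yr; exists (Z *m Q).
    by rewrite -mulmxA QP mulmx1.
  have -> : Z *m Q - (X + Y) = (Z - (X *m P + Y *m P)) *m Q.
    by rewrite mulmxBl mulmxDl -!mulmxA PQ !mulmx1.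
  rewrite (le_trans (qP _))// mulrC -ler_pdivlMr// (le_trans ZP)//.
  apply: le_trans (ler_wpM2l _ (pP _)) _.
    by rewrite divr_ge0 ?mulr_ge0// ltW.
  suff -> : eta / (p * q) * (p * `|X|) = eta * `|X| / q by rewrite lexx.
  by field; rewrite !gt_eqF.
- have [|r r0 rP] := esub (eta / (p * q)); first by rewrite divr_gt0// mulr_gt0.
  exists (r / p) => [|x Y Z /small Yr /small Zr]; first exact: divr_gt0.
  have [W eW WP] := rP x _ _ Yr Zr; exists (W *m Q).
    by rewrite -mulmxA QP mulmx1.
  have -> : W *m Q - (Z - Y) = (W - (Z *m P - Y *m P)) *m Q.
    by rewrite !mulmxBl -!mulmxA PQ !mulmx1.
  rewrite (le_trans (qP _))// mulrC -ler_pdivlMr// (le_trans WP)// -mulmxBl.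
  apply: le_trans (ler_wpM2l _ (pP _)) _.
    by rewrite divr_ge0 ?mulr_ge0// ltW.
  suff -> : eta / (p * q) * (p * `|Z - Y|) = eta * `|Z - Y| / q.
    by rewrite lexx.
  by field; rewrite !gt_eqF.
- have [r r0 rP] := eleb C oC; exists (r / p); first exact: divr_gt0.
  by move=> x; have [B CB BP] := rP x; exists B => // X /small; exact: BP.
- have [|C oC CP] := efine (r / q); first exact: divr_gt0.
  exists C => // B x y CB Bx By; have [X Xr ->] := CP B x y CB Bx By.
  exists (X *m Q); last by rewrite -mulmxA QP mulmx1.
  by rewrite (le_trans (qP _))// mulrC -ler_pdivlMr.
Qed.

Lemma tangent_linear m n (P : 'M[R]_(m, n)) (Q : 'M[R]_(n, m))
    (A : 'M[R]_n) (B : 'M[R]_m) (e : 'rV[R]_n -> M -> M) :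
  Q *m P = 1%:M -> P *m A *m Q = B -> 
  exists2 k, 0 < k & forall f eta, 0 <= eta -> tangent e f A eta ->
    tangent (fun X => e (X *m P)) f B (k * eta).
Proof.
move=> QP PAQ.
have [p p0 pP] := mulmx_bound P; have [q q0 qP] := mulmx_bound Q.
exists (q * p) => [|f eta eta0 [r r0 rP]]; first exact: mulr_gt0.
exists (r / p) => [|x X Xr]; first exact: divr_gt0.
have {}Xr : `|X *m P| <= r.
  by rewrite (le_trans (pP _))// mulrC -ler_pdivlMr.
have [Y fY YP] := rP x _ Xr; exists (Y *m Q).
  by rewrite -mulmxA QP mulmx1.
have -> : Y *m Q - X *m B = (Y - X *m P *m A) *m Q.
  by rewrite -PAQ mulmxBl !mulmxA.
rewrite (le_trans (qP _))// -!mulrA ler_pM2l// (le_trans YP)//.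
by rewrite mulrCA ler_wpM2l.
Qed.

Lemma tangentS n (e : 'rV[R]_n -> M -> M) f A eta eta' :
  eta <= eta' -> tangent e f A eta -> tangent e f A eta'.
Proof.
move=> le [r r0 rP]; exists r => // x X Xr; have [Y fY YP] := rP x X Xr.
by exists Y => //; rewrite (le_trans YP)// ler_wpM2r.
Qed.

(** The errors of successive iterates add up, multiplied by norms of powers of
    [A]; for a fixed [N] they are small with [eta0]. *)
Lemma tangent_iter n (e : 'rV[R]_n -> M -> M) (A : 'M[R]_n) N eta :
  0 < eta -> exists2 eta0, 0 < eta0 &
    forall f, tangent e f A eta0 -> tangent e (iter N f) (A ^+ N) eta.
Proof.
elim: N eta => [|N IH] eta eta0.
  exists 1 => // f _; exists 1 => // x X _; exists X => //.
  by rewrite expr0 mulmx1 subrr normr0 mulr_ge0// ltW.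
have [D D0 DP] := mulmx_bound A; have [D' D'0 D'P] := mulmx_bound (A ^+ N).
have [|b b0 bP] := IH (Num.min 1 (eta / (2 * D))).
  by rewrite lt_min ltr01 divr_gt0// mulr_gt0.
exists (Num.min b (eta / (2 * (D' + 1)))).
  by rewrite lt_min b0 divr_gt0// mulr_gt0// addr_gt0.
move=> f tf; have [r r0 rP] : tangent e f A (eta / (2 * (D' + 1))).
  by apply: tangentS tf; rewrite ge_min lexx orbT.
have [|r' r'0 r'P] := bP f; first by apply: tangentS tf; rewrite ge_min lexx.
exists (Num.min r' (r / (D' + 1))).
  by rewrite lt_min r'0 divr_gt0// addr_gt0.
move=> x X; rewrite le_min => /andP[Xr' Xr].
have [Y fY YP] := r'P x X Xr'.
have YX : `|Y| <= (D' + 1) * `|X|.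
  have := ler_norm_dist Y (X *m A ^+ N).
  have := D'P X; have : Num.min 1 (eta / (2 * D)) * `|X| <= 1 * `|X|.
    by rewrite ler_wpM2r// ge_min lexx.
  lra.
have Yr : `|Y| <= r.
  by rewrite (le_trans YX)// mulrC -ler_pdivlMr// addr_gt0.
have [Z fZ ZP] := rP (iter N f x) Y Yr; exists Z; first by rewrite /= fY.
have -> : Z - X *m A ^+ N.+1 = (Z - Y *m A) + (Y - X *m A ^+ N) *m A.
  by rewrite mulmxBl -mulmxA exprSr addrA subrK.
rewrite (le_trans (ler_normD _ _))// [eta]splitr mulrDl lerD//.
  rewrite (le_trans ZP)//.
  apply: le_trans (ler_wpM2l _ YX) _.
    by rewrite divr_ge0 ?mulr_ge0 ?addr_ge0// ltW.
  rewrite mulrA ler_wpM2r// invfM mulrA mulfVK// gt_eqF// addr_gt0//.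
rewrite (le_trans (DP _))// mulrC -ler_pdivlMr// (le_trans YP)//.
apply: le_trans (_ : eta / (2 * D) * `|X| <= _).
  by rewrite ler_wpM2r// ge_min lexx orbT.
by rewrite invfM mulrA mulrAC.
Qed.

Hypothesis cM : compact [set: M].

(** A small ball stays inside elements of the cover for [N] iterates, hence lies
    in one element of the join, and its image under the [N]-th iterate is
    covered by [size s] balls of the same radius: every block of [N] iterates
    multiplies the number of elements needed by at most [size s]. With [B = 0]
    the condition on [f] says no more than that its [N]-th iterate is
    [eta]-Lipschitz. *)
Lemma htop_le_count n (e : 'rV[R]_n -> M -> M) f N (B : 'M[R]_n) eta
    (s : seq 'rV[R]_n) :
  exp_frame e -> continuous f -> (0 < N)%N -> 0 <= eta ->
  tangent e (iter N f) B eta ->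
  (forall X Y, `|X| <= 1 -> `|Y - X *m B| <= eta ->
     exists2 c, c \in s & `|Y - c| <= 1 / 2) ->
  (htop f <= (ln (size s)%:R / N%:R : R)%:E)%E.
Proof.
move=> [_ _ _ esub eleb efine] cf N0 eta0 [r1 r10 r1P] sP.
have [D D0 DP] := mulmx_bound B.
have [r2 r20 r2P] : exists2 r, 0 < r & forall x Y Z, `|Y| <= r -> `|Z| <= r ->
    exists2 W, e W (e Y x) = e Z x & `|W - (Z - Y)| <= 1 * `|Z - Y|.
  exact: esub.
apply: ge_ereal_sup => _ [C oC <-]; rewrite lee_fin.
have [r3 r30 r3P] := eleb _ (open_cover_join N cf oC).
pose r := Num.min (Num.min r1 r3) (r2 / (D + eta + 1)).
have d0 : 0 < D + eta + 1 by lra.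
have r0 : 0 < r by rewrite !lt_min r10 r30 divr_gt0.
have rr1 : r <= r1 by rewrite !ge_min lexx.
have rr3 : r <= r3 by rewrite !ge_min lexx orbT.
have rr2 : (D + eta + 1) * r <= r2.
  by rewrite mulrC -ler_pdivlMr// ge_min lexx orbT.
have cell x X : `|X| <= r -> exists2 c, c \in s &
    exists2 W, `|W| <= r & iter N f (e X x) = e W (e (r *: c) (iter N f x)).
  move=> Xr; have [Y fY YP] := r1P x X (le_trans Xr rr1).
  have [||c cs cP] := sP (r^-1 *: X) (r^-1 *: Y).
  - by rewrite normrZ gtr0_norm ?invr_gt0// mulrC ler_pdivrMr// mul1r.
  - rewrite -scalemxAl -scalerBr normrZ gtr0_norm ?invr_gt0// mulrC.
    by rewrite ler_pdivrMr// (le_trans YP)// ler_wpM2l.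
  exists c => //.
  have YcE : Y - r *: c = r *: (r^-1 *: Y - c).
    by rewrite scalerBr scalerA mulfV ?gt_eqF// scale1r.
  have Yc : `|Y - r *: c| <= r / 2.
    by rewrite YcE normrZ gtr0_norm//; have := ler_wpM2l (ltW r0) cP; lra.
  have Yn : `|Y| <= (D + eta) * r.
    have := ler_norm_dist Y (X *m B); have := DP X.
    have : D * `|X| <= D * r by rewrite ler_wpM2l// ltW.
    have : eta * `|X| <= eta * r by rewrite ler_wpM2l.
    lra.
  have Yr2 : `|Y| <= r2 by lra.
  have cr2 : `|r *: c| <= r2.
    by have := ler_norm_dist (r *: c) Y; rewrite distrC; lra.
  have [W eW WP] := r2P (iter N f x) _ _ cr2 Yr2.
  exists W; last by rewrite fY eW.
  by have := ler_norm_dist W (Y - r *: c); lra.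
have K0 : (0 < size s)%N.
  have [|c cs _] := cell point 0; first by rewrite normr0 ltW.
  by case: s cs {sP cell}.
have step m : forall x, exists t : seq (set M),
    [/\ (size t <= size s ^ m)%N, [set` t] `<=` iterated_join f C (N * m) &
      forall X, `|X| <= r -> exists2 B, B \in t & B (e X x)].
  elim: m => [|m IH] x.
    have [B' CB' _] : exists2 B', C B' & B' point.
      by have : [set: M] point by []; rewrite -oC.2 => -[B0]; exists B0.
    exists [:: setT]; split => // [B0 /=|X _].
      by rewrite inE => /eqP ->; rewrite muln0; exact: iterated_join0 CB'.
    by exists setT; rewrite ?inE.
  have [t tP] := choice IH; have [J CJ JP] := r3P x.
  exists [seq J `&` (iter N f @^-1` B0) |
    B0 <- flatten [seq t (e (r *: c) (iter N f x)) | c <- s]]; split.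
  - rewrite size_map size_flatten /shape -map_comp expnS sumnE big_map.
    apply: leq_trans (_ : \sum_(c <- s) size s ^ m <= _)%N.
      by apply: leq_sum => c _; have [] := tP (e (r *: c) (iter N f x)).
    by rewrite big_const_seq count_predT iter_addn_0 mulnC.
  - move=> _ /= /mapP[B0 /flattenP[_ /mapP[c cs ->] B0t] ->].
    rewrite mulnS; apply: iterated_join_add => //.
    by have [_ + _] := tP (e (r *: c) (iter N f x)); apply.
  - move=> X Xr; have [c cs [W Wr WP]] := cell x X Xr.
    have [_ _ /(_ W Wr)[B0 B0t B0W]] := tP (e (r *: c) (iter N f x)).
    exists (J `&` (iter N f @^-1` B0)).
      by apply: map_f; apply/flattenP; exists (t (e (r *: c) (iter N f x))) => //;
        apply: map_f.
    by split; [apply: JP; exact: le_trans rr3|rewrite /= WP].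
have [C' oC' C'P] := efine r r0; have [P PP] := compact_subcover cM oC'.
have L0 : (0 < size P)%N.
  by have [B0 + _] := subcover_ex point PP; case: P {PP}.
apply: (@cover_entropy_le _ _ cM _ _ _ _ (size P)) => // m.
have [t tP] := choice (step m).
apply: le_trans (_ : (size (flatten [seq t (xget point Q) | Q <- P]))%:R <= _).
  apply: cover_number_le; split.
    move=> B0 /= /flattenP[_ /mapP[Q _ ->]].
    by have [_ + _] := tP (xget point Q); apply.
  rewrite -subTset => x _; have [Q QP Qx] := subcover_ex x PP.
  have Qp : Q (xget point Q) by apply: (xgetI _ Qx).
  have [X Xr xE] := C'P Q _ x (PP.1 _ QP) Qp Qx.
  have [_ _ /(_ X Xr)[B0 B0t B0x]] := tP (xget point Q).
  exists B0; last by rewrite xE.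
  by apply/flattenP; exists (t (xget point Q)) => //; apply/mapP; exists Q.
rewrite ler_nat size_flatten /shape -map_comp sumnE big_map.
apply: leq_trans (_ : \sum_(Q <- P) size s ^ m <= _)%N.
  by apply: leq_sum => Q _; have [] := tP (xget point Q).
by rewrite big_const_seq count_predT iter_addn_0 mulnC.
Qed.

End Frame.

(** * Expanding discs *)

HB.instance Definition _ (R : realType) (m n : nat) :=
  Complete.on 'M[R]_(m, n).

Lemma contraction_fixed (R : realType) (V : completeNormedModType R)
    (U : set V) (phi : V -> V) (k : R) :
  0 <= k -> k < 1 -> closed U -> U !=set0 ->
  (forall x, U x -> U (phi x)) ->
  (forall x y, U x -> U y -> `|phi x - phi y| <= k * `|x - y|) ->
  exists2 p, U p & phi p = p.
Proof.
move=> k0 k1 cU U0 UU phik.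
pose phiF : {fun U >-> U} := HB.pack phi (isFun.Build V V U U phi UU).
have [|p Up pE] := @banach_fixed_point R V U phiF _ cU U0.
  exists (NngNum k0); split=> //= -[x y] [Ux Uy]; exact: phik.
by exists p.
Qed.

Lemma closed_norm_le (R : realType) (V : normedModType R) (r : R) :
  closed [set x : V | `|x| <= r].
Proof.
rewrite (_ : [set x | _] = Num.norm @^-1` [set y | y <= r])//.
apply: closed_comp; last exact: closed_le.
by move=> x _; exact: norm_continuous.
Qed.

Section Discs.
Context {R : realType} {M : ptopologicalType} {u s : nat}.
Implicit Types (e : 'rV[R]_(u + s) -> M -> M) (sg : 'rV[R]_u -> M).

(** A disc is a parametrization which is nearly isometric in the unstable
    coordinates and satisfies a cone condition in the others. Only pairs of
    points are compared, without a base point, so that the image of a disc only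
    has to be reparametrized to become a disc again. *)
Definition disc e h r sg := forall a b, `|a| <= r -> `|b| <= r ->
  exists W, [/\ sg b = e W (sg a), `|lsubmx W - (b - a)| <= h * `|b - a| &
    `|rsubmx W| <= `|b - a|].

Lemma lsubmxB (X Y : 'rV[R]_(u + s)) : lsubmx (X - Y) = lsubmx X - lsubmx Y.
Proof. exact: linearB. Qed.

Lemma rsubmxB (X Y : 'rV[R]_(u + s)) : rsubmx (X - Y) = rsubmx X - rsubmx Y.
Proof. exact: linearB. Qed.

Lemma block_mul (Bu : 'M[R]_u) (Bs : 'M[R]_s) (W : 'rV[R]_(u + s)) :
  W *m block_mx Bu 0 0 Bs = row_mx (lsubmx W *m Bu) (rsubmx W *m Bs).
Proof.
by rewrite -{1}[W]hsubmxK mul_row_block !mulmx0 addr0 add0r.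
Qed.

Section OneStep.
Variables (e : 'rV[R]_(u + s) -> M -> M) (Bu : 'M[R]_u) (Bs : 'M[R]_s).
Variables (Lam kap D h eta rho r : R) (F : M -> M).
Local Notation B := (block_mx Bu 0 0 Bs).
Hypotheses (e0 : forall x, e 0 x = x)
  (einj : forall x (X Y : 'rV[R]_(u + s)), `|X| <= rho -> `|Y| <= rho ->
    e X x = e Y x -> X = Y)
  (eadd : forall x (X Y : 'rV[R]_(u + s)), `|X| <= rho -> `|Y| <= rho ->
    exists2 Z : 'rV[R]_(u + s), e X (e Y x) = e Z x &
      `|Z - (X + Y)| <= eta * `|X|)
  (tF : forall x (X : 'rV[R]_(u + s)), `|X| <= rho ->
    exists2 Y : 'rV[R]_(u + s), F (e X x) = e Y (F x) &
      `|Y - X *m B| <= eta * `|X|).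
Hypotheses (BuU : Bu \in unitmx) (Lam8 : 8 <= Lam) (kap0 : 0 <= kap)
  (Lkap : 2 * kap + 2 <= Lam) (D0 : 0 < D) (h0 : 0 < h) (h4 : h <= 1 / 4)
  (Dh : D * h <= 1 / 4) (eta0 : 0 < eta) (etah : 2 * eta * (D + 2) <= h)
  (r0 : 0 < r) (rrho : 16 * (D + 2) * r <= rho).
Hypotheses (BuL : forall a : 'rV[R]_u, Lam * `|a| <= `|a *m Bu|)
  (BsL : forall t : 'rV[R]_s, `|t *m Bs| <= kap * `|t|)
  (BuD : forall a : 'rV[R]_u, `|a *m Bu| <= D * `|a|)
  (BD : forall W : 'rV[R]_(u + s), `|W *m B| <= D * `|W|).

Local Ltac bounds := have := Lam8; have := kap0; have := Lkap; have := D0;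
  have := h0; have := h4; have := Dh; have := eta0; have := etah; have := r0;
  have := rrho; move=> Rr r0_ Eh E0_ Dh_ h4_ h0_ D0_ Lk_ k0_ L8_;
  have rD := mulr_gt0 D0_ r0_; have eD := mulr_gt0 E0_ D0_.

Let eta1 : eta <= 1 / 16.
Proof. by bounds; lra. Qed.

(** The matrix is block diagonal, so the cone part of a displacement does not
    contribute to the unstable part of its image. *)
Lemma disc_image_step sg a b : disc e h r sg -> `|a| <= r -> `|b| <= r ->
  exists V, [/\ F (sg b) = e V (F (sg a)),
    `|lsubmx V - (b - a) *m Bu| <= 1 / 2 * `|b - a|,
    `|rsubmx V| <= (kap + 1 / 2) * `|b - a| &
    `|V| <= 2 * (D + 1) * `|b - a|].
Proof.
bounds; have eta1_ := eta1; move=> dsg ar br; have [W [bW Wl Wr]] := dsg a b ar br.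
have bar : `|b - a| <= 2 * r by have := ler_normB b a; lra.
have ba0 : 0 <= `|b - a| by [].
have W2 : `|W| <= 2 * `|b - a|.
  apply: norm_rV_sub; last by lra.
  by have := ler_norm_dist (lsubmx W) (b - a); nra.
have Wrho : `|W| <= rho by lra.
have [V FV VP] := tF (sg a) Wrho; exists V.
have etaW : eta * `|W| <= h * `|b - a|.
  by have : 0 <= `|W| by []; nra.
have h4W : h * `|b - a| <= 1 / 4 * `|b - a| by rewrite ler_wpM2r.
rewrite bW; split => //.
- have := norm_lsubmx (V - W *m B); rewrite lsubmxB block_mul row_mxKl.
  have := BuD (lsubmx W - (b - a)); rewrite (mulmxBl (lsubmx W)).
  have := ler_distD (lsubmx W *m Bu) (lsubmx V) ((b - a) *m Bu).
  have : D * `|lsubmx W - (b - a)| <= D * h * `|b - a|.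
    by rewrite -mulrA ler_wpM2l// ltW.
  have : D * h * `|b - a| <= 1 / 4 * `|b - a| by rewrite ler_wpM2r.
  rewrite block_mul in VP.
  lra.
- have := norm_rsubmx (V - W *m B); rewrite rsubmxB block_mul row_mxKr.
  have := BsL (rsubmx W); have := ler_norm_dist (rsubmx V) (rsubmx W *m Bs).
  have : kap * `|rsubmx W| <= kap * `|b - a| by rewrite ler_wpM2l.
  rewrite block_mul in VP.
  lra.
- have := ler_norm_dist V (W *m B); have := BD W.
  have : D * `|W| <= D * (2 * `|b - a|) by rewrite ler_wpM2l// ltW.
  nra.
Qed.

(** The unstable coordinate [Yu] of the image, seen from the image of [sg a0],
    differs from an expanding linear map by a map of small Lipschitz constant,
    so [Yu a = b'] is solved by a contraction; this gives the new parameter. The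
    cone condition improves because the other coordinates expand less. *)
Lemma disc_image sg a0 : disc e h r sg -> `|a0| <= r / 2 ->
  exists2 tau : 'rV[R]_u -> 'rV[R]_u,
    (forall b, `|b| <= r -> `|tau b| <= r) &
    tau 0 = a0 /\ disc e h r (fun b => F (sg (tau b))).
Proof.
bounds; have eta1_ := eta1; move=> dsg a0r.
have a0r' : `|a0| <= r by lra.
have exY a : exists Y : 'rV[R]_(u + s), `|a| <= r ->
    F (sg a) = e Y (F (sg a0)) /\ `|Y| <= 4 * (D + 1) * r.
  case: (leP `|a| r) => ar; last by exists 0.
  have [V [FV _ _ VP]] := disc_image_step dsg a0r' ar.
  exists V => _; split=> //; rewrite (le_trans VP)//.
  have : `|a - a0| <= 2 * r by have := ler_normB a a0; lra.
  nra.
have [Y YP] := choice exY.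
have Ydist a b V : `|a| <= r -> `|b| <= r -> F (sg b) = e V (F (sg a)) ->
    `|V| <= 2 * (D + 1) * `|b - a| ->
    `|V - (Y b - Y a)| <= eta * `|V|.
  move=> ar br FV Vle; have [Ya Yar] := YP a ar; have [Yb Ybr] := YP b br.
  have bar : `|b - a| <= 2 * r by have := ler_normB b a; lra.
  have Vr : `|V| <= 4 * (D + 1) * r by nra.
  have [||Z eZ ZP] := eadd (F (sg a0)) (X := V) (Y := Y a); [nra|nra|].
  have V0 : 0 <= `|V| by [].
  have ZYb : Z = Y b.
    apply: (@einj (F (sg a0))); [|nra|by rewrite -Yb -eZ -Ya FV].
    have := ler_norm_dist Z (V + Y a); have := ler_normD V (Y a).
    nra.
  have -> : V - (Y b - Y a) = - (Z - (V + Y a)).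
    by rewrite ZYb; apply/rowP => i; rewrite !mxE; ring.
  by rewrite normrN.
pose Yu a := lsubmx (Y a); pose Ys a := rsubmx (Y a).
have Ysub a b : `|a| <= r -> `|b| <= r -> exists V,
    [/\ F (sg b) = e V (F (sg a)),
    `|lsubmx V - (b - a) *m Bu| <= 1 / 2 * `|b - a|,
    `|rsubmx V| <= (kap + 1 / 2) * `|b - a| &
    `|V - (Y b - Y a)| <= h * `|b - a|].
  move=> ar br; have [V [FV Vu Vs VP]] := disc_image_step dsg ar br.
  exists V; split=> //; rewrite (le_trans (Ydist _ _ _ ar br FV VP))//.
  have : 0 <= `|V| by []. have : 0 <= `|b - a| by [].
  nra.
have Yulip a b : `|a| <= r -> `|b| <= r ->
    `|Yu b - Yu a - (b - a) *m Bu| <= 3 / 4 * `|b - a|.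
  move=> ar br; have [V [_ Vu _ VY]] := Ysub a b ar br.
  have := norm_lsubmx (V - (Y b - Y a)); rewrite !lsubmxB -!/(Yu _).
  have := ler_distD (lsubmx V) (Yu b - Yu a) ((b - a) *m Bu).
  rewrite (distrC (Yu b - Yu a) (lsubmx V)) => h1' h2'.
  have : h * `|b - a| <= 1 / 4 * `|b - a| by rewrite ler_wpM2r.
  lra.
have Yuexp a b : `|a| <= r -> `|b| <= r ->
    (Lam - 3 / 4) * `|b - a| <= `|Yu b - Yu a|.
  move=> ar br; have := Yulip a b ar br.
  have := ler_norm_dist ((b - a) *m Bu) (Yu b - Yu a); rewrite distrC.
  have := BuL (b - a); lra.
have Y0 : Y a0 = 0.
  have [Ya Yar] := YP a0 a0r'; apply: (@einj (F (sg a0))).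
  - nra.
  - by rewrite normr0; nra.
  - by rewrite -Ya e0.
have invL (v : 'rV[R]_u) : `|v *m invmx Bu| <= `|v| / 8.
  have := BuL (v *m invmx Bu); rewrite mulmxKV//.
  have : 0 <= `|v *m invmx Bu| by [].
  nra.
have solve b' : `|b'| <= r -> exists2 a, `|a| <= r & Yu a = b'.
  move=> b'r.
  pose U := [set a : 'rV[R]_u | `|a| <= r].
  (* Newton iteration with the fixed derivative [Bu]. *)
  pose phi a := a - (Yu a - b') *m invmx Bu.
  have phi_dist a b : `|a| <= r -> `|b| <= r ->
      `|phi b - phi a| <= 1 / 8 * `|b - a|.
    move=> ar br.
    have -> : phi b - phi a = - ((Yu b - Yu a - (b - a) *m Bu) *m invmx Bu).
      rewrite mulmxBl mulmxK// opprB !mulmxBl /phi !mulmxBl.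
      by rewrite !opprB; apply/rowP => i; rewrite !mxE; ring.
    rewrite normrN (le_trans (invL _))//.
    by have := Yulip a b ar br; have : 0 <= `|b - a| by []; lra.
  have phiU a : U a -> U (phi a).
    rewrite /U /= => ar.
    have phi0 : phi a0 = a0 + b' *m invmx Bu.
      by rewrite /phi /Yu Y0 linear0 sub0r mulNmx opprK.
    have := phi_dist a0 a a0r' ar; have := ler_norm_dist (phi a) (phi a0).
    have := ler_normD a0 (b' *m invmx Bu); rewrite -phi0.
    have := invL b'; have := ler_normB a a0; lra.
  have [||||||p Up pE] := @contraction_fixed R 'rV[R]_u U phi (1 / 8).
  - by lra.
  - by lra.
  - exact: closed_norm_le.
  - by exists 0; rewrite /U /= normr0 ltW.
  - exact: phiU.
  - by move=> a b ar br; exact: (phi_dist b a).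
  - exists p => //; move/eqP: pE.
    rewrite /phi -subr_eq0 addrAC subrr add0r oppr_eq0 => /eqP pE.
    have := congr1 (fun v => v *m Bu) pE; rewrite mulmxKV// mul0mx => /eqP.
    by rewrite subr_eq0 => /eqP.
have solve' b' : exists a, `|b'| <= r -> `|a| <= r /\ Yu a = b'.
  case: (leP `|b'| r) => b'r; last by exists 0.
  by have [a ar aE] := solve b' b'r; exists a.
have [tau tauP] := choice solve'.
exists tau; first by move=> b /tauP[].
split.
  have [|t0r t0E] := tauP 0; rewrite ?normr0 ?ltW//.
  have := Yuexp a0 (tau 0) a0r' t0r; rewrite t0E /Yu Y0 linear0 subr0 normr0.
  move=> t0; apply/eqP; rewrite -subr_eq0 -normr_le0.
  have : 0 <= `|tau 0 - a0| by []; nra.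
move=> b' c' b'r c'r.
have [ar aE] := tauP b' b'r; have [br bE] := tauP c' c'r.
have := Yuexp _ _ ar br; rewrite aE bE => cb.
have [V [FV Vu Vs VY]] := Ysub _ _ ar br; exists V.
have t0 : 0 <= `|tau c' - tau b'| by [].
have tcb : `|tau c' - tau b'| <= `|c' - b'| by nra.
split=> //.
- have := norm_lsubmx (V - (Y (tau c') - Y (tau b'))).
  rewrite !lsubmxB -!/(Yu _) aE bE; nra.
- nra.
Qed.

(** The centres of two image discs are [10 * r] apart in the unstable
    coordinates, while two points at distance [r] of these discs would make the
    centres at most [8 * r] apart. *)
Lemma disc_images_far sg a1 a2 x1 x2 W1 W2 X : disc e h r sg ->
  `|a1| <= r / 2 -> `|a2| <= r / 2 -> 10 * r <= `|(a2 - a1) *m Bu| ->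
  x1 = e W1 (F (sg a1)) -> x2 = e W2 (F (sg a2)) ->
  `|W1| <= 2 * r -> `|W2| <= 2 * r -> `|X| <= r -> x2 <> e X x1.
Proof.
bounds; have eta1_ := eta1; move=> dsg a1r a2r far -> -> W1r W2r Xr.
have [||V [-> Vu _ VP]] := @disc_image_step sg a1 a2 dsg; [lra|lra|].
have a12 : `|a2 - a1| <= r by have := ler_normB a2 a1; lra.
have Da := ler_wpM2l (ltW D0_) a12.
have Vr : `|V| <= 2 * (D + 1) * r by lra.
have [||Z1 -> Z1P] := eadd (F (sg a1)) (X := W2) (Y := V); [lra|lra|].
have [||Z2 -> Z2P] := eadd (F (sg a1)) (X := X) (Y := W1); [lra|lra|].
have W20 : 0 <= `|W2| by []. have X0 : 0 <= `|X| by [].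
have eW : eta * `|W2| <= 1 / 16 * `|W2| by rewrite ler_wpM2r.
have eX : eta * `|X| <= 1 / 16 * `|X| by rewrite ler_wpM2r.
have Z2n := ler_norm_dist Z2 (X + W1); have XW := ler_normD X W1.
have Z1n := ler_norm_dist Z1 (W2 + V); have WV := ler_normD W2 V.
move=> /einj Z12; have {Z12}Z12 : Z1 = Z2 by apply: Z12; lra.
have := ler_norm_dist ((a2 - a1) *m Bu) (lsubmx V); rewrite distrC.
have := norm_lsubmx V.
have := ler_normB Z1 (Z1 - (W2 + V)); rewrite subKr.
have := ler_normB (W2 + V) W2; rewrite addrAC subrr add0r.
rewrite -Z12 in Z2n Z2P; lra.
Qed.

(** Cutting the image of a disc into [K] discs with far apart centres, and
    iterating, produces [K ^ m] orbits which separate within [m] steps. *)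
Lemma disc_tree (K : nat) (q : 'I_K -> 'rV[R]_u) :
  (forall i, `|q i| <= 1) ->
  (forall i j, i != j -> 20 <= `|(q i - q j) *m Bu|) ->
  forall m sg, disc e h r sg -> exists P : seq 'I_K -> M,
    (forall w, exists2 a, `|a| <= r & P w = sg a) /\
    forall w w', size w = m -> size w' = m -> w <> w' ->
      exists2 i, (i <= m)%N &
        forall X, `|X| <= r -> iter i F (P w') <> e X (iter i F (P w)).
Proof.
move=> q1 qfar; bounds.
have r2 : 0 < r / 2 by rewrite divr_gt0.
elim=> [|m IH] sg dsg.
  exists (fun=> sg 0); split; first by exists 0 => //; rewrite normr0 ltW.
  by move=> [|? ?] [|? ?].
have qr i : `|(r / 2) *: q i| <= r / 2.
  by rewrite normrZ gtr0_norm// ler_piMr ?(ltW r2).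
have /choice[T TP] i : exists Tt : ('rV[R]_u -> 'rV[R]_u) * (seq 'I_K -> 'rV[R]_u),
    [/\ forall b, `|b| <= r -> `|Tt.1 b| <= r, Tt.1 0 = (r / 2) *: q i,
      disc e h r (fun b => F (sg (Tt.1 b))), forall w, `|Tt.2 w| <= r &
    forall w w', size w = m -> size w' = m -> w <> w' ->
      exists2 k, (k <= m)%N & forall X, `|X| <= r ->
        iter k F (F (sg (Tt.1 (Tt.2 w')))) <>
        e X (iter k F (F (sg (Tt.1 (Tt.2 w)))))].
  have [tau taur [tau0 dtau]] := disc_image dsg (qr i).
  have [P [Pr Psep]] := IH _ dtau.
  have /choice[b bP] w : exists b, `|b| <= r /\ P w = F (sg (tau b)).
    by have [b br bE] := Pr w; exists b.
  exists (tau, b); split=> //= [w|w w' sw sw' ww']; first by have [] := bP w.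
  have [_ <-] := bP w; have [_ <-] := bP w'; exact: Psep.
exists (fun w => if w is i :: w1 then sg ((T i).1 ((T i).2 w1)) else sg 0).
split=> [[|i w]|].
- by exists 0 => //; rewrite normr0 ltW.
- have [Tr _ _ br _] := TP i; exists ((T i).1 ((T i).2 w)) => //; exact/Tr/br.
move=> [|i w] [|j w']//= [sw] [sw'] ww'.
have [[Tir Ti0 Tid bi Tisep] [Tjr Tj0 Tjd bj _]] := (TP i, TP j).
have [ij|ij] := eqVneq i j.
  have {}ww' : w <> w' by move=> wE; apply: ww'; rewrite ij wE.
  have [k km kP] := Tisep w w' sw sw' ww'.
  exists k.+1 => // X Xr; rewrite !iterSr -ij; exact: kP.
exists 1%N => //= X Xr.
have sub l b : disc e h r (fun b => F (sg ((T l).1 b))) -> `|b| <= r ->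
    (T l).1 0 = (r / 2) *: q l ->
    exists2 W, F (sg ((T l).1 b)) = e W (F (sg ((r / 2) *: q l))) &
      `|W| <= 2 * r.
  move=> dl br Tl0; have [|W [Wb Wu Ws]] := dl 0 b _ br.
    by rewrite normr0 ltW.
  rewrite Tl0 in Wb; exists W => //; rewrite subr0 in Wu Ws.
  have hb : h * `|b| <= 1 / 4 * `|b| by rewrite ler_wpM2r.
  apply: norm_rV_sub; last by lra.
  by have := ler_norm_dist (lsubmx W) b; lra.
have [Wi Fi Wir] := sub i _ Tid (bi w) Ti0.
have [Wj Fj Wjr] := sub j _ Tjd (bj w') Tj0.
apply: (disc_images_far dsg (qr i) (qr j) _ Fi Fj Wir Wjr Xr).
rewrite -scalerBr -scalemxAl normrZ gtr0_norm//.
have ji : j != i by rewrite eq_sym.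
by have := ler_wpM2l (ltW r2) (qfar _ _ ji); lra.
Qed.

End OneStep.

(** In a cover by sets of small diameter, an element of the join contains at
    most one point of the tree. The tolerance [eta] depends on the linear data
    only; the scale [r] at which the orbits separate may depend on the map. *)
Lemma htop_ge_count (e : 'rV[R]_(u + s) -> M -> M) (Bu : 'M[R]_u)
    (Bs : 'M[R]_s) (Lam kap : R) (K N : nat) (q : 'I_K -> 'rV[R]_u) :
  compact [set: M] -> exp_frame e -> Bu \in unitmx -> 8 <= Lam -> 0 <= kap ->
  2 * kap + 2 <= Lam ->
  (forall a : 'rV[R]_u, Lam * `|a| <= `|a *m Bu|) ->
  (forall t : 'rV[R]_s, `|t *m Bs| <= kap * `|t|) ->
  (0 < K)%N -> (0 < N)%N ->
  (forall i, `|q i| <= 1) ->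
  (forall i j, i != j -> 20 <= `|(q i - q j) *m Bu|) ->
  exists2 eta, 0 < eta & forall f, continuous f ->
    tangent e (iter N f) (block_mx Bu 0 0 Bs) eta ->
    ((ln K%:R / N%:R : R)%:E <= htop f)%E.
Proof.
move=> cM [e0 [r1 r10 einj] eadd esub _ efine] BuU Lam8 kap0 Lk BuL BsL K0 N0.
move=> q1 qfar.
have [D1 D10 BuD] := mulmx_bound Bu.
have [D2 D20 BD] := mulmx_bound (block_mx Bu 0 0 Bs).
pose D := D1 + D2; have D0 : 0 < D by rewrite addr_gt0.
have {}BuD (a : 'rV[R]_u) : `|a *m Bu| <= D * `|a|.
  by rewrite (le_trans (BuD a))// ler_wpM2r// lerDl ltW.
have {}BD (W : 'rV[R]_(u + s)) : `|W *m block_mx Bu 0 0 Bs| <= D * `|W|.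
  by rewrite (le_trans (BD W))// ler_wpM2r// lerDr ltW.
pose h := 1 / (4 * (D + 1)).
have h0 : 0 < h by rewrite divr_gt0// mulr_gt0// addr_gt0.
have hD : 4 * (D + 1) * h = 1.
  by rewrite /h mulrCA mulfV ?mulr1// gt_eqF// mulr_gt0// addr_gt0.
have Dh0 : 0 < D * h by rewrite mulr_gt0.
have h4 : h <= 1 / 4 by lra.
have Dh : D * h <= 1 / 4 by lra.
pose eta := h / (2 * (D + 2)).
have eta0 : 0 < eta by rewrite divr_gt0// mulr_gt0// addr_gt0.
have etah : 2 * eta * (D + 2) <= h.
  rewrite /eta (_ : 2 * (h / (2 * (D + 2))) * (D + 2) = h) ?lexx//.
  by field; lra.
exists eta => // f cf [r2 r20 tF].
have [r3 r30 {}eadd] := eadd eta eta0.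
have [r4 r40 {}esub] := esub h h0.
pose rho := Num.min (Num.min r1 r2) (Num.min r3 r4).
have rho0 : 0 < rho by rewrite !lt_min r10 r20 r30 r40.
have [rho1 rho2] : rho <= r1 /\ rho <= r2 by rewrite !ge_min !lexx orbT.
have [rho3 rho4] : rho <= r3 /\ rho <= r4 by rewrite !ge_min !lexx !orbT.
pose r := rho / (16 * (D + 2)).
have r0 : 0 < r by rewrite divr_gt0// mulr_gt0// addr_gt0.
have rrho : 16 * (D + 2) * r <= rho.
  rewrite /r (_ : 16 * (D + 2) * (rho / (16 * (D + 2))) = rho) ?lexx//.
  by field; lra.
have rD : 0 < D * r by rewrite mulr_gt0.
pose sg (a : 'rV[R]_u) : M := e (row_mx a 0) point.
have nrow (a : 'rV[R]_u) : `|a| <= r -> `|row_mx a (0 : 'rV[R]_s)| <= rho.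
  by move=> ar; apply: norm_row_mx_le; rewrite ?normr0; lra.
have dsg : disc e h r sg.
  move=> a b ar br.
  have [||W eW WP] := esub point (row_mx a 0) (row_mx b 0).
  - exact: le_trans (nrow _ ar) rho4.
  - exact: le_trans (nrow _ br) rho4.
  rewrite opp_row_mx add_row_mx oppr0 addr0 in WP.
  have bn : `|row_mx (b - a) (0 : 'rV[R]_s)| <= `|b - a|.
    by apply: norm_row_mx_le => //; rewrite normr0.
  have := ler_wpM2l (ltW h0) bn => hb.
  have hb4 : h * `|b - a| <= 1 / 4 * `|b - a| by rewrite ler_wpM2r.
  exists W; split=> //.
  - have := norm_lsubmx (W - row_mx (b - a) 0).
    by rewrite lsubmxB row_mxKl; lra.
  - have := norm_rsubmx (W - row_mx (b - a) 0).
    by rewrite rsubmxB row_mxKr subr0; have : 0 <= `|b - a| by []; lra.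
have tree := @disc_tree e Bu Bs Lam kap D h eta rho r (iter N f) e0
  (fun x X Y Xr Yr => einj x X Y (le_trans Xr rho1) (le_trans Yr rho1))
  (fun x X Y Xr Yr => eadd x X Y (le_trans Xr rho3) (le_trans Yr rho3))
  (fun x X Xr => tF x X (le_trans Xr rho2)) BuU Lam8 kap0 Lk D0 h0 h4 Dh
  eta0 etah r0 rrho BuL BsL BuD BD K q q1 qfar.
have [C oC CP] := efine r r0.
apply: le_trans (_ : (cover_entropy f C : R)%:E <= _)%E; last first.
  by apply: ereal_sup_ubound; exists C.
rewrite lee_fin; apply: cover_entropy_ge => // m.
have [P [_ Psep]] := tree m sg dsg.
have [t0 t0C] := compact_subcover cM (open_cover_join (m * N).+1 cf oC).
have [t tC ->] := cover_number_attained (R := R) t0C.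
rewrite ler_nat -[K in (K ^ _)%N]card_ord -card_tuple.
have /choice[B BP] (w : m.-tuple 'I_K) : exists B : set M, B \in t /\ B (P w).
  by have [B Bt Bw] := subcover_ex (P w) tC; exists B.
have injB : injective B.
  move=> w w' BE; apply: contrapT => ww'.
  have [|i im iP] := Psep w w' (size_tuple w) (size_tuple w').
    by move=> E; apply: ww'; exact: val_inj.
  have [Bt Bw] := BP w; have [_ Bw'] := BP w'; rewrite -BE in Bw'.
  have [Dd CD BD'] : iterated_join f C (m * N).+1 (B w) by exact: tC.1.
  rewrite BD' in Bw Bw'.
  have iN : `I_(m * N).+1 (i * N)%N by rewrite /= ltnS leq_mul2r im orbT.
  have [X Xr XE] := CP _ _ _ (CD (i * N)%N) (Bw _ iN) (Bw' _ iN).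
  apply: (iP X Xr); move: XE; rewrite /= mulnC.
  have itE x : iter i (iter N f) x = iter (N * i) f x.
    by rewrite mulnC; elim: i {im iP iN Xr} => //= i IH; rewrite mulSn iterD IH.
  by rewrite !itE.
rewrite cardE -(size_map B) uniq_leq_size//.
  by rewrite map_inj_uniq// enum_uniq.
by move=> _ /mapP[w _ ->]; have [] := BP w.
Qed.

End Discs.

(** * Splitting a linear map by growth rates *)

Section Growth.
Context {R : realType}.

(** Any [D] with [C <= D * (th - mu)] propagates along the recurrence. *)
Lemma geometric_rec (a : nat -> R) (mu th C : R) : 0 <= mu -> mu < th ->
  0 <= C -> (forall N, a N.+1 <= mu * a N + C * th ^+ N) ->
  exists2 D, 0 <= D & forall N, a N <= D * th ^+ N.
Proof.
move=> mu0 muth C0 arec.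
have d0 : 0 < th - mu by rewrite subr_gt0.
exists (`|a 0%N| + C / (th - mu)).
  by rewrite addr_ge0// divr_ge0// ltW.
set D := _ + _.
have DC : C <= D * (th - mu).
  by rewrite -ler_pdivrMr// lerDr.
elim=> [|N IH]; first by rewrite expr0 mulr1 (le_trans (ler_norm _))// lerDl divr_ge0// ltW.
have t0 : 0 <= th ^+ N by rewrite exprn_ge0//; lra.
have := arec N; have := ler_wpM2l mu0 IH; have := ler_wpM2r t0 DC.
rewrite exprS; lra.
Qed.

Lemma geometric_le0 (x C rho : R) : 0 <= rho -> rho < 1 -> 0 <= C ->
  (forall N, x <= C * rho ^+ N) -> x <= 0.
Proof.
move=> rho0 rho1 C0 xP.
have cvg0 : (fun N => C * rho ^+ N) @ \oo --> (0 : R).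
  by apply: (@cvg_geometric R C rho); rewrite ger0_norm.
rewrite -(cvg_lim _ cvg0)//; apply: limr_ge; last exact: nearW.
by apply/cvg_ex; exists 0.
Qed.

End Growth.

Section SlowFast.
Context {R : realType} {n : nat}.

(** [slow] and [fast] vectors replace the generalized eigenspaces for the
    eigenvalues of modulus at most one and greater than one: being defined by
    growth, they are linear, invariant and make sense over the reals. *)
Definition slow (A : 'M[R]_n) (v : 'rV[R]_n) := forall th, 1 < th ->
  exists2 C, 0 <= C & forall N, `|v *m A ^+ N| <= C * th ^+ N.

Definition fast (A : 'M[R]_n) (v : 'rV[R]_n) := exists th C,
  [/\ 0 < th, th < 1, 0 <= C & forall N, `|v *m invmx A ^+ N| <= C * th ^+ N].

Lemma slow_linear A a v w : slow A v -> slow A w -> slow A (a *: v + w).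
Proof.
move=> sv sw th th1; have [C C0 CP] := sv th th1; have [D D0 DP] := sw th th1.
exists (`|a| * C + D) => [|N]; first by rewrite addr_ge0// mulr_ge0.
rewrite mulmxDl -scalemxAl (le_trans (ler_normD _ _))// mulrDl lerD//.
by rewrite normrZ -mulrA ler_wpM2l.
Qed.

Lemma slow0 A : slow A 0.
Proof. by move=> th _; exists 0 => // N; rewrite mul0mx normr0 mul0r. Qed.

Lemma fast0 A : fast A 0.
Proof.
exists (1 / 2), 0; split=> [||//|N]; [lra|lra|].
by rewrite mul0mx normr0 mul0r.
Qed.

Lemma fast_linear A a v w : fast A v -> fast A w -> fast A (a *: v + w).
Proof.
move=> [t1 [C [t10 t11 C0 CP]]] [t2 [D [t20 t21 D0 DP]]].
exists (Num.max t1 t2), (`|a| * C + D); split.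
- by rewrite lt_max t10.
- by rewrite gt_max t11.
- by rewrite addr_ge0// mulr_ge0.
move=> N; have t0 : 0 <= Num.max t1 t2 by rewrite le_max ltW.
have m1 : t1 ^+ N <= Num.max t1 t2 ^+ N.
  by rewrite lerXn2r ?nnegrE ?(ltW t10) ?t0// le_max lexx.
have m2 : t2 ^+ N <= Num.max t1 t2 ^+ N.
  by rewrite lerXn2r ?nnegrE ?(ltW t20) ?t0// le_max lexx orbT.
rewrite mulmxDl -scalemxAl (le_trans (ler_normD _ _))// mulrDl lerD//.
  rewrite normrZ -mulrA ler_wpM2l// (le_trans (CP N))//.
  exact: ler_wpM2l.
by rewrite (le_trans (DP N))// ler_wpM2l.
Qed.

Lemma slow_mul A v : slow A v -> slow A (v *m A).
Proof.
move=> sv th th1; have [C C0 CP] := sv th th1; have th0 : 0 <= th by lra.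
exists (C * th) => [|N]; first exact: mulr_ge0.
by rewrite -mulmxA -mulrA -exprS -[A *m _]exprS.
Qed.

Lemma fast_mul A v : A \in unitmx -> fast A v -> fast A (v *m A).
Proof.
move=> AU [th [C [th0 th1 C0 CP]]].
exists th, (Num.max (C / th) `|v *m A|); split=> //.
  by rewrite le_max normr_ge0 orbT.
case=> [|N]; first by rewrite expr0 mulmx1 expr0 mulr1 le_max lexx orbT.
have -> : v *m A *m invmx A ^+ N.+1 = v *m invmx A ^+ N.
  have -> : invmx A ^+ N.+1 = invmx A *m invmx A ^+ N by rewrite exprS.
  by rewrite mulmxA mulmxK.
rewrite (le_trans (CP N))// exprS mulrA ler_wpM2r ?exprn_ge0 ?(ltW th0)//.
by rewrite -ler_pdivrMr// le_max lexx.
Qed.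

(** Take a matrix of maximal rank among those with rows in [S]. *)
Lemma linear_closed_basis (S : 'rV[R]_n -> Prop) :
  S 0 -> (forall a v w, S v -> S w -> S (a *: v + w)) ->
  exists k (P : 'M[R]_(k, n)), row_free P /\ forall v, S v <-> (v <= P)%MS.
Proof.
move=> S0 Slin.
have Ssum m (P : 'M[R]_(m, n)) : (forall i, S (row i P)) ->
    forall v, (v <= P)%MS -> S v.
  move=> SP v /submxP[D ->]; rewrite mulmx_sum_row.
  elim/big_rec: _ => // i x _ Sx; exact: Slin.
pose Q r := `[< exists P : 'M[R]_n, (forall i, S (row i P)) /\ \rank P = r >].
have Q0 : exists r, Q r.
  by exists 0%N; apply/asboolP; exists 0; rewrite mxrank0; split=> // i;
    rewrite row0.
have Qn r : Q r -> (r <= n)%N by move=> /asboolP[P [_ <-]]; exact: rank_leq_row.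
case: (ex_maxnP Q0 Qn) => r /asboolP[P [SP Pr]] rmax.
exists (\rank P), (row_base P); split; first exact: row_base_free.
move=> v; rewrite eq_row_base; split; last exact: Ssum.
move=> Sv; apply: contrapT => /negP vP.
have : (\rank P < \rank (P + v)%MS)%N.
  suff : (P < P + v)%MS by rewrite ltmxErank => /andP[].
  rewrite ltmxE addsmxSl/=; apply: contra vP; exact: submx_trans (addsmxSr _ _).
rewrite ltnNge Pr rmax//; apply/asboolP; exists (P + v)%MS; split=> // i.
have : (row i (P + v)%MS <= P + v)%MS by exact: row_sub.
rewrite addsmxE; apply: Ssum => j; rewrite -[j]splitK.
by case: (fintype.split j) => k /=; rewrite ?rowKu// rowKd row_id.
Qed.

(** The constants of the finitely many rows of [P] add up. *)
Lemma slow_uniform A k (P : 'M[R]_(k, n)) : (forall i, slow A (row i P)) ->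
  forall th, 1 < th -> exists2 C, 0 < C &
    forall N (a : 'rV[R]_k), `|a *m P *m A ^+ N| <= C * th ^+ N * `|a|.
Proof.
move=> sP th th1.
have /choice[C CP] i : exists C, 0 <= C /\
    forall N, `|row i P *m A ^+ N| <= C * th ^+ N.
  by have [C C0 CP] := sP i th th1; exists C.
have th0 N : 0 <= th ^+ N by rewrite exprn_ge0//; lra.
exists (1 + \sum_i C i).
  by rewrite ltr_wpDr// sumr_ge0// => i _; have [] := CP i.
move=> N a; rewrite (mulmx_sum_row a P) mulmx_suml (le_trans (ler_norm_sum _ _ _))//.
rewrite !mulrDl mul1r ler_wpDl// ?mulr_ge0// !mulr_suml ler_sum// => i _.
rewrite -scalemxAl normrZ mulrC ler_pM// ?ler_coord_norm//.
by have [] := CP i.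
Qed.

Lemma fast_uniform A k (P : 'M[R]_(k, n)) : (forall i, fast A (row i P)) ->
  exists th C, [/\ 0 < th, th < 1, 0 < C &
    forall N (a : 'rV[R]_k), `|a *m P *m invmx A ^+ N| <= C * th ^+ N * `|a|].
Proof.
move=> fP.
have /choice[T TP] i : exists tC : R * R, [/\ 0 < tC.1, tC.1 < 1, 0 <= tC.2 &
    forall N, `|row i P *m invmx A ^+ N| <= tC.2 * tC.1 ^+ N].
  by have [th [C CP]] := fP i; exists (th, C).
pose th := \big[Num.max/(1 / 2)]_i (T i).1.
have thi i : (T i).1 <= th by exact: le_bigmax.
have th0 : 0 < th.
  by rewrite (lt_le_trans _ (bigmax_ge_id _ _ _ _))//; lra.
exists th, (1 + \sum_i (T i).2); split=> //.
- by apply: bigmax_lt => [|i _]; [lra|have [] := TP i].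
- by rewrite ltr_wpDr// sumr_ge0// => i _; have [] := TP i.
move=> N a; rewrite (mulmx_sum_row a P) mulmx_suml (le_trans (ler_norm_sum _ _ _))//.
rewrite !mulrDl mul1r ler_wpDl ?mulr_ge0 ?exprn_ge0 ?(ltW th0)//.
rewrite !mulr_suml ler_sum// => i _; have [t0 t1 C0 CP] := TP i.
rewrite -scalemxAl normrZ mulrC ler_pM// ?ler_coord_norm//.
by rewrite (le_trans (CP N))// ler_wpM2l// lerXn2r ?nnegrE ?(ltW t0) ?(ltW th0).
Qed.

End SlowFast.

Section ComplexSplit.
Context {R : realType} {n : nat}.
Local Notation C := (R[i]).
Implicit Types (z : C) (v w : 'rV[C]_n.+1) (B : 'M[C]_n.+1).

(** The modulus with values in [R], since the norm of [R[i]] is complex. *)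
Definition cmod z : R := complex.Re `|z|.

Lemma cmodE z : `|z| = (cmod z)%:C%C.
Proof. by rewrite /cmod RRe_real// normr_real. Qed.

Lemma cmod_ge0 z : 0 <= cmod z.
Proof. by rewrite -lecR -cmodE normr_ge0. Qed.

Lemma cmodM z1 z2 : cmod (z1 * z2) = cmod z1 * cmod z2.
Proof.
by apply: (@complexI R); rewrite rmorphM/= -!cmodE normrM.
Qed.

Lemma cmodD z1 z2 : cmod (z1 + z2) <= cmod z1 + cmod z2.
Proof. by rewrite -lecR rmorphD/= -!cmodE ler_normD. Qed.

Lemma Re_cmod z : `|complex.Re z| <= cmod z.
Proof. by rewrite -lecR -cmodE normc_ge_Re. Qed.

Definition norm1 v : R := \sum_i cmod (v 0 i).

Lemma norm1_ge0 v : 0 <= norm1 v.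
Proof. by apply: sumr_ge0 => i _; exact: cmod_ge0. Qed.

Lemma norm1D v w : norm1 (v + w) <= norm1 v + norm1 w.
Proof.
by rewrite -big_split/=; apply: ler_sum => i _; rewrite mxE cmodD.
Qed.

Lemma norm1Z z v : norm1 (z *: v) = cmod z * norm1 v.
Proof. by rewrite mulr_sumr; apply: eq_bigr => i _; rewrite mxE cmodM. Qed.

Lemma norm1N v : norm1 (- v) = norm1 v.
Proof.
apply: eq_bigr => i _; rewrite mxE; apply: (@complexI R).
by rewrite -!cmodE normrN.
Qed.

Definition cslow B v := forall th : R, 1 < th ->
  exists2 D, 0 <= D & forall N, norm1 (v *m B ^+ N) <= D * th ^+ N.

Definition cfast B v := exists th D : R, [/\ 0 < th, th < 1, 0 <= D &
  forall N, norm1 (v *m invmx B ^+ N) <= D * th ^+ N].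

(** The norms of the iterates of [v] satisfy a recurrence of ratio [cmod z], up
    to those of [v (B - z)]; likewise backward for [cfast_eigen], with ratio the
    inverse of [cmod z]. *)
Lemma cslow_eigen B z v : cmod z <= 1 ->
  cslow B (v *m B - z *: v) -> cslow B v.
Proof.
move=> z1 sv th th1; have [D D0 DP] := sv th th1.
apply: (@geometric_rec _ _ 1 th D) => // N.
have -> : v *m B ^+ N.+1 = z *: (v *m B ^+ N) + (v *m B - z *: v) *m B ^+ N.
  by rewrite mulmxBl -scalemxAl addrC subrK -mulmxA exprS.
rewrite (le_trans (norm1D _ _))// norm1Z lerD//.
by rewrite ler_wpM2r// norm1_ge0.
Qed.

Lemma cfast_eigen B z v : B \in unitmx -> 1 < cmod z ->
  cfast B (v *m B - z *: v) -> cfast B v.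
Proof.
move=> BU z1 [th [D [th0 th1 D0 DP]]].
pose mu := (cmod z)^-1.
have mu0 : 0 < mu by rewrite invr_gt0; lra.
have mu1 : mu < 1 by rewrite invf_lt1//; lra.
have [t [tth tmu t1]] : exists t, [/\ th <= t, mu < t & t < 1].
  exists (Num.max th ((mu + 1) / 2)); rewrite le_max lexx lt_max gt_max th1.
  by split=> //; [apply/orP; right|]; lra.
have z0 : z != 0.
  apply/eqP => z0; move: z1; rewrite /cmod z0 normr0 /=; lra.
have t0 : 0 < t by lra.
exists t; suff [E E0 EP] : exists2 E, 0 <= E &
    forall N, norm1 (v *m invmx B ^+ N) <= E * t ^+ N by exists E.
apply: (@geometric_rec _ _ mu t (D * t)) => //; [lra|rewrite mulr_ge0//; lra|].
move=> N; set w := v *m B - z *: v in DP.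
have -> : v *m invmx B ^+ N.+1 =
    z^-1 *: (v *m invmx B ^+ N - w *m invmx B ^+ N.+1).
  have -> : invmx B ^+ N.+1 = invmx B *m invmx B ^+ N by rewrite exprS.
  rewrite /w mulmxBl -!scalemxAl (mulmxA (v *m B)) mulmxK//.
  by rewrite opprB addrC subrK scalerA mulVf// scale1r.
rewrite norm1Z; have -> : cmod z^-1 = mu.
  apply: (@complexI R); rewrite -cmodE normfV cmodE.
  by rewrite -fmorphV.
have wN : norm1 (w *m invmx B ^+ N.+1) <= D * t * t ^+ N.
  rewrite -mulrA -exprS (le_trans (DP _))// ler_wpM2l//.
  by rewrite lerXn2r ?nnegrE ?(ltW th0) ?(ltW t0).
have := norm1D (v *m invmx B ^+ N) (- (w *m invmx B ^+ N.+1)); rewrite norm1N.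
move=> /(ler_wpM2l (ltW mu0)) /le_trans; apply; rewrite mulrDr lerD2l.
by apply: le_trans wN; rewrite ler_piMl ?norm1_ge0 ?(ltW mu1).
Qed.

(** The factors are peeled off one root at a time. *)
Lemma kernel_prod B (S : 'rV[C]_n.+1 -> Prop) (l : seq C) v :
  S 0 -> (forall z w, z \in l -> S (w *m B - z *: w) -> S w) ->
  v *m horner_mx B (\prod_(z <- l) ('X - z%:P)) = 0 -> S v.
Proof.
elim: l v => [|z l IH] v S0 Sabs.
  by rewrite big_nil rmorph1 mulmx1 => ->.
rewrite big_cons rmorphM/= -mulmxE mulmxA.
rewrite rmorphB/= horner_mx_X horner_mx_C mulmxBr mul_mx_scalar => vB.
apply: (Sabs z); first exact: mem_head.
by apply: IH => // z' w z'l; apply: Sabs; rewrite in_cons z'l orbT.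
Qed.

End ComplexSplit.

Section RealSplit.
Context {R : realType} {n : nat}.
Implicit Types (A : 'M[R]_n.+1) (v : 'rV[R]_n.+1).

Local Notation toC := (map_mx (real_complex R)).
Local Notation reC := (map_mx (@complex.Re R)).

Lemma norm_reC (v : 'rV[R[i]]_n.+1) : `|reC v| <= norm1 v.
Proof.
apply: norm_rV_le => [|i]; first exact: norm1_ge0.
rewrite mxE (le_trans (Re_cmod _))// /norm1 (bigD1 i)//= lerDl.
by apply: sumr_ge0 => j _; exact: cmod_ge0.
Qed.

Lemma reC_mul (v : 'rV[R[i]]_n.+1) A : reC (v *m toC A) = reC v *m A.
Proof.
apply/rowP => i; rewrite !mxE raddf_sum; apply: eq_bigr => j _.
by rewrite !mxE; case: (v 0 j) => a b /=; rewrite mulr0 subr0.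
Qed.

(** Over the complex numbers the characteristic polynomial is the product of
    two coprime factors, which collect the eigenvalues of modulus at most one
    and greater than one. Bezout and Cayley-Hamilton split each vector in a
    vector killed by the first factor and one killed by the second. *)
Lemma slow_fast_decomp A v : A \in unitmx ->
  exists a b, [/\ slow A a, fast A b & v = a + b].
Proof.
move=> AU; pose B := toC A.
have BU : B \in unitmx by rewrite map_unitmx.
have [l lE] := closed_field_poly_normal (char_poly B).
rewrite (monicP (char_poly_monic B)) scale1r in lE.
pose big (z : R[i]) := 1 < cmod z.
pose pf := \prod_(z <- [seq x <- l | big x]) ('X - z%:P).
pose ps := \prod_(z <- [seq x <- l | ~~ big x]) ('X - z%:P).
have pE : char_poly B = pf * ps.
  by rewrite lE /pf /ps !big_filter (bigID big)/=.
have cop : coprimep pf ps.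
  apply/Pdiv.ClosedField.coprimepP => z.
  rewrite root_prod_XsubC mem_filter => /andP[bz _].
  by rewrite -[_ != 0]/(~~ root ps z) root_prod_XsubC mem_filter/= bz.
have /Bezout_eq1_coprimepP[[p q] /= pqE] := cop.
pose w := toC v.
pose ws := w *m horner_mx B (p * pf); pose wf := w *m horner_mx B (q * ps).
have CH0 : horner_mx B (pf * ps) = 0 by rewrite -pE Cayley_Hamilton.
have wE : w = ws + wf.
  by rewrite -mulmxDr -rmorphD/= pqE rmorph1 mulmx1.
have sws : cslow B ws.
  apply: (@kernel_prod _ _ B _ ([seq x <- l | ~~ big x])).
  - move=> th th1; exists 0 => // N; rewrite mul0mx mul0r /norm1 big1// => i _.
    by rewrite mxE /cmod normr0.
  - move=> z u; rewrite mem_filter /= /big -leNgt => /andP[z1 _].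
    exact: cslow_eigen.
  - rewrite /ws -mulmxA mulmxE -rmorphM/= -mulrA.
    by rewrite rmorphM/= CH0 mulr0 mulmx0.
have fwf : cfast B wf.
  apply: (@kernel_prod _ _ B _ ([seq x <- l | big x])).
  - exists (1 / 2), 0; split; [lra|lra|by []|] => N.
    rewrite mul0mx mul0r /norm1 big1// => i _.
    by rewrite mxE /cmod normr0.
  - move=> z u; rewrite mem_filter => /andP[z1 _].
    exact: cfast_eigen.
  - rewrite /wf -mulmxA mulmxE -rmorphM/= -mulrA (mulrC ps).
    by rewrite rmorphM/= CH0 mulr0 mulmx0.
have toCX A' N : toC (A' ^+ N) = toC A' ^+ N by exact: rmorphXn.
exists (reC ws), (reC wf); split.
- move=> th th1; have [D D0 DP] := sws th th1; exists D => // N.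
  by rewrite -reC_mul (le_trans (norm_reC _))// toCX DP.
- have [th [D [th0 th1 D0 DP]]] := fwf; exists th, D; split=> // N.
  by rewrite -reC_mul (le_trans (norm_reC _))// toCX map_invmx DP.
- rewrite -map_mxD -wE; apply/rowP => i; by rewrite !mxE.
Qed.

End RealSplit.

Section HyperbolicSplit.
Context {R : realType}.

(** The slow and the fast subspaces span by [slow_fast_decomp], and they meet
    in zero: the forward iterates of a fast vector grow exponentially. The first
    bound, a contraction of the backward iterates, is this expansion. *)
Lemma hyperbolic_split n (A : 'M[R]_n) : A \in unitmx ->
  exists u s (P : 'M[R]_(u + s, n)) (Q : 'M[R]_(n, u + s))
      (Au : 'M[R]_u) (As : 'M[R]_s),
    [/\ P *m Q = 1%:M, Q *m P = 1%:M, P *m A *m Q = block_mx Au 0 0 As,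
      exists th C, [/\ 0 < th, th < 1, 0 < C &
        forall N (a : 'rV[R]_u), `|a| <= C * th ^+ N * `|a *m Au ^+ N|] &
      forall th, 1 < th -> exists2 C, 0 < C &
        forall N (t : 'rV[R]_s), `|t *m As ^+ N| <= C * th ^+ N * `|t|].
Proof.
case: n A => [|n] A AU.
  exists 0%N, 0%N, 0, 0, 0, 0; split.
  - by apply/matrixP => -[].
  - by apply/matrixP => -[].
  - by apply/matrixP => -[].
  - exists (1 / 2), 1; split=> [|||N a]; [lra|lra|lra|].
    by rewrite [a]thinmx0 normr0 mul0mx normr0 mulr0.
  - move=> th th1; exists 1 => // N t.
    by rewrite [t]thinmx0 mul0mx normr0 mulr0.
have [u [Pu [Puf PuE]]] := linear_closed_basis (fast0 A) (@fast_linear _ _ A).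
have [s [Ps [Psf PsE]]] := linear_closed_basis (slow0 A) (@slow_linear _ _ A).
have [Au AuE] : exists D, Pu *m A = D *m Pu.
  apply/submxP/row_subP => i; rewrite row_mul; apply/PuE/fast_mul => //.
  exact/PuE/row_sub.
have [As AsE] : exists D, Ps *m A = D *m Ps.
  apply/submxP/row_subP => i; rewrite row_mul; apply/PsE/slow_mul => //.
  exact/PsE/row_sub.
have AuX N : Pu *m A ^+ N = Au ^+ N *m Pu.
  elim: N => [|N IH]; first by rewrite !expr0 mulmx1 mul1mx.
  have -> : A ^+ N.+1 = A *m A ^+ N by rewrite exprS.
  have -> : Au ^+ N.+1 = Au *m Au ^+ N by rewrite exprS.
  by rewrite mulmxA AuE -mulmxA IH mulmxA.
have AsX N : Ps *m A ^+ N = As ^+ N *m Ps.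
  elim: N => [|N IH]; first by rewrite !expr0 mulmx1 mul1mx.
  have -> : A ^+ N.+1 = A *m A ^+ N by rewrite exprS.
  have -> : As ^+ N.+1 = As *m As ^+ N by rewrite exprS.
  by rewrite mulmxA AsE -mulmxA IH mulmxA.
have /row_freeP[Ru RuE] := Puf; have /row_freeP[Rs RsE] := Psf.
have [ru ru0 ruP] := mulmx_bound Ru; have [rs rs0 rsP] := mulmx_bound Rs.
have [pu pu0 puP] := mulmx_bound Pu.
have rowu i : fast A (row i Pu) by exact/PuE/row_sub.
have rows i : slow A (row i Ps) by exact/PsE/row_sub.
have [th [C [th0 th1 C0 CP]]] := fast_uniform rowu.
have Aexp N (a : 'rV[R]_u) : `|a| <= (ru * C) * th ^+ N * `|a *m Au ^+ N|.
  have := CP N (a *m Au ^+ N); rewrite -(mulmxA a) -AuX !mulmxA.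
  have -> : a *m Pu *m A ^+ N *m invmx A ^+ N = a *m Pu.
    elim: N => [|N IH]; first by rewrite !expr0 !mulmx1.
    have -> : A ^+ N.+1 = A ^+ N *m A by rewrite exprSr.
    have -> : invmx A ^+ N.+1 = invmx A *m invmx A ^+ N by rewrite exprS.
    by rewrite !mulmxA mulmxK.
  move=> /(ler_wpM2l (ltW ru0)); rewrite !mulrA; apply: le_trans.
  by rewrite -{1}[a]mulmx1 -RuE mulmxA ruP.
have cap0 (w : 'rV[R]_n.+1) : fast A w -> slow A w -> w = 0.
  move=> /PuE/submxP[a ->] sw; suff -> : a = 0 by rewrite mul0mx.
  pose th' := (1 + th^-1) / 2.
  have thth' : th * th' = (th + 1) / 2.
    by rewrite /th' mulrA mulrDr mulr1 mulfV ?gt_eqF.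
  have [|D D0 DP] := sw th'.
    by have := invf_gt1 th0; rewrite th1 /th'; lra.
  apply/eqP; rewrite -normr_le0.
  apply: (@geometric_le0 _ _ (ru * C * (ru * D)) ((th + 1) / 2)); [lra|lra| |].
    by rewrite !mulr_ge0// ltW.
  move=> N; apply: le_trans (Aexp N a) _; rewrite -thth' exprMn.
  rewrite mulrACA ler_wpM2l//.
    by rewrite !mulr_ge0 ?exprn_ge0// ltW.
  rewrite -mulrA; have := ler_wpM2l (ltW ru0) (DP N); apply: le_trans.
  by rewrite -mulmxA AuX mulmxA -[X in `|X|]mulmx1 -RuE mulmxA ruP.
pose P := col_mx Pu Ps.
have PA : P *m A = block_mx Au 0 0 As *m P.
  by rewrite mul_col_mx AuE AsE mul_block_col !mul0mx addr0 add0r.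
have Pfree : row_free P.
  apply: inj_row_free => w; rewrite -[w]hsubmxK mul_row_col => /eqP.
  rewrite addr_eq0 => /eqP wE.
  have wl : lsubmx w *m Pu = 0.
    apply: cap0; first by apply/PuE/submxMl.
    by rewrite wE -mulNmx; apply/PsE/submxMl.
  have wr : rsubmx w *m Ps = 0 by apply/eqP; rewrite -oppr_eq0 -wE wl.
  have -> : lsubmx w = 0 by rewrite -[LHS]mulmx1 -RuE mulmxA wl mul0mx.
  have -> : rsubmx w = 0 by rewrite -[LHS]mulmx1 -RsE mulmxA wr mul0mx.
  by rewrite row_mx0.
have Pfull : row_full P.
  rewrite -sub1mx; apply/row_subP => i.
  have [a [b [sa fb ->]]] := slow_fast_decomp (row i 1%:M) AU.
  rewrite -addsmxE addrC addmx_sub_adds//; first exact/PuE.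
  exact/PsE.
have /row_freeP[Q PQ] := Pfree; have /row_fullP[Q' QP] := Pfull.
have QQ : Q' = Q by rewrite -[Q']mulmx1 -PQ mulmxA QP mul1mx.
rewrite QQ in QP.
exists u, s, P, Q, Au, As; split=> //.
- by rewrite PA -mulmxA PQ mulmx1.
- by exists th, (ru * C); split=> //; exact: mulr_gt0.
move=> t t1; have [D D0 DP] := slow_uniform rows t1.
exists (rs * D) => [|N a]; first exact: mulr_gt0.
have := ler_wpM2l (ltW rs0) (DP N a); rewrite !mulrA; apply: le_trans.
by rewrite -mulmxA AsX mulmxA -[X in `|X|]mulmx1 -RsE mulmxA rsP.
Qed.

(** A maximal [20]-separated family is a [20]-net; the box counting bounds the
    cardinality of separated families. *)
Lemma separated_net u (Bu : 'M[R]_u) :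
  exists K (q : 'I_K -> 'rV[R]_u),
    [/\ (0 < K)%N, forall i, `|q i| <= 1,
      forall i j, i != j -> 20 <= `|(q i - q j) *m Bu| &
      forall a, `|a| <= 1 -> exists i, `|(a - q i) *m Bu| <= 20].
Proof.
have [D D0 DP] := mulmx_bound Bu.
pose L := (Num.bound `|D|).+1.
have LD : D <= L%:R.
  by rewrite ltW// (lt_le_trans (lt_archi_bound _))// ler_nat.
have L0 : 0 < L%:R :> R by rewrite ltr0n.
have [s sn sP] := box_cover (R := R) u L.
pose sep : rel 'rV[R]_u := fun x y => 20 <= `|(x - y) *m Bu|.
pose good t := all (fun x : 'rV[R]_u => `|x| <= 1) t && pairwise sep t.
pose S k := `[< exists t, good t /\ size t = k >].
have S0 : exists k, S k by exists 0%N; apply/asboolP; exists [::].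
have Sle k : S k -> (k <= size s)%N.
  move=> /asboolP[t [/andP[t1 tsep] <-]].
  have /choice[c cP] (x : 'rV[R]_u) : exists c, `|x| <= 1 ->
      c \in s /\ `|L%:R *: x - c| <= 1 / 8.
    case: (leP `|x| 1) => x1; last by exists 0.
    have [|c cs cP] := sP (L%:R *: x); last by exists c.
    by rewrite normrZ ger0_norm// ler_piMr.
  rewrite -(size_map c) uniq_leq_size//; last first.
    by move=> _ /mapP[x xt ->]; have [] := cP x (allP t1 x xt).
  rewrite uniq_pairwise pairwise_map.
  apply: (sub_in_pairwise (P := fun x : 'rV[R]_u => `|x| <= 1) _ t1 tsep).
  move=> x y x1 y1; rewrite /sep; apply: contraTneq => cxy.
  have [_ cx] := cP x x1; have [_ cy] := cP y y1; rewrite -ltNge.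
  have xy : L%:R * `|x - y| <= 1 / 4.
    have := ler_distD (c y) (L%:R *: x) (L%:R *: y).
    rewrite (distrC (c y)) -scalerBr normrZ ger0_norm//; rewrite cxy in cx.
    lra.
  have := DP (x - y); have : D * `|x - y| <= L%:R * `|x - y|.
    by rewrite ler_wpM2r.
  lra.
case: (ex_maxnP S0 Sle) => K /asboolP[t [/andP[t1 tsep] tK]] Kmax.
have net (a : 'rV[R]_u) : `|a| <= 1 ->
    exists2 x, x \in t & `|(a - x) *m Bu| <= 20.
  move=> a1; apply: contrapT => far.
  have : S K.+1.
    apply/asboolP; exists (a :: t); split; last by rewrite /= tK.
    rewrite /good /= a1 t1 tsep /= andbT; apply/allP => x xt.
    rewrite /sep leNgt; apply/negP => /ltW ax; apply: far; by exists x.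
  by move=> /Kmax; rewrite ltnn.
have nthK (i : 'I_K) : nth 0 t i \in t by rewrite mem_nth// tK.
exists K, (fun i => nth 0 t i); split.
- rewrite lt0n -tK size_eq0; have [|x + _] := net 0; first by rewrite normr0.
  by case: (t).
- by move=> i; exact: (allP t1).
- have sep_lt (i j : 'I_K) : (i < j)%N ->
      20 <= `|(nth 0 t i - nth 0 t j) *m Bu|.
    by move=> ij; apply: (pairwiseP 0 tsep) => //; rewrite inE tK.
  move=> i j; rewrite neq_ltn => /orP[|]; first exact: sep_lt.
  by move=> /sep_lt; rewrite -normrN -mulNmx opprB.
- move=> a /net[x /(nthP 0)[i it <-] ax].
  have iK : (i < K)%N by rewrite -tK.
  by exists (Ordinal iK).
Qed.

(** The unstable directions contribute the net, up to a constant; in the other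
    directions the map expands by [kap] at most, so a box count is enough. *)
Lemma image_cover u s (Bu : 'M[R]_u) (Bs : 'M[R]_s) (K L : nat) kap
    (q : 'I_K -> 'rV[R]_u) :
  (forall a, `|a| <= 1 -> exists i, `|(a - q i) *m Bu| <= 20) ->
  (forall t : 'rV[R]_s, `|t *m Bs| <= kap * `|t|) -> 0 <= kap ->
  kap + 1 <= L%:R ->
  exists2 l : seq 'rV[R]_(u + s),
    size l = (K * (337 ^ u * (16 * L).+1 ^ s))%N &
    forall X Y : 'rV[R]_(u + s), `|X| <= 1 ->
      `|Y - X *m block_mx Bu 0 0 Bs| <= 1 ->
      exists2 c, c \in l & `|Y - c| <= 1 / 2.
Proof.
move=> net BsP kap0 kapL.
have [l1 l1n l1P] := box_cover (R := R) u 21.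
have [l2 l2n l2P] := box_cover (R := R) s L.
exists [seq row_mx (q ic.1 *m Bu + ic.2.1) ic.2.2 |
  ic <- [seq (i, c) | i <- enum 'I_K, c <- [seq (c1, c2) | c1 <- l1, c2 <- l2]]].
  by rewrite size_map !size_allpairs l1n l2n size_enum_ord.
move=> X Y X1; rewrite block_mul => YX.
have Yl : `|lsubmx Y - lsubmx X *m Bu| <= 1.
  by rewrite (le_trans _ YX)//; have := norm_lsubmx
    (Y - row_mx (lsubmx X *m Bu) (rsubmx X *m Bs)); rewrite lsubmxB row_mxKl.
have Yr : `|rsubmx Y - rsubmx X *m Bs| <= 1.
  by rewrite (le_trans _ YX)//; have := norm_rsubmx
    (Y - row_mx (lsubmx X *m Bu) (rsubmx X *m Bs)); rewrite rsubmxB row_mxKr.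
have [i iP] := net (lsubmx X) (le_trans (norm_lsubmx _) X1).
have [|c1 c1l c1P] := l1P (lsubmx Y - q i *m Bu).
  have := ler_distD (lsubmx X *m Bu) (lsubmx Y) (q i *m Bu).
  by rewrite -mulmxBl; lra.
have [|c2 c2l c2P] := l2P (rsubmx Y).
  have := ler_norm_dist (rsubmx Y) (rsubmx X *m Bs); have := BsP (rsubmx X).
  have := ler_wpM2l kap0 (le_trans (norm_rsubmx X) X1); lra.
exists (row_mx (q i *m Bu + c1) c2).
  apply/mapP; exists (i, (c1, c2)) => //.
  by apply: allpairs_f; [rewrite mem_enum|exact: allpairs_f].
apply: norm_rV_sub; rewrite ?lsubmxB ?rsubmxB ?row_mxKl ?row_mxKr.
  by rewrite opprD addrA; lra.
lra.
Qed.

End HyperbolicSplit.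

(** * Entropy is pinched by the differential *)

Section Pinching.
Context {R : realType} {M : ptopologicalType}.

Lemma block_conj_expr n u s (A : 'M[R]_n) (P : 'M[R]_(u + s, n))
    (Q : 'M[R]_(n, u + s)) (Au : 'M[R]_u) (As : 'M[R]_s) N :
  P *m Q = 1%:M -> Q *m P = 1%:M -> P *m A *m Q = block_mx Au 0 0 As ->
  P *m A ^+ N *m Q = block_mx (Au ^+ N) 0 0 (As ^+ N).
Proof.
move=> PQ QP PAQ; elim: N => [|N IH].
  by rewrite !expr0 mulmx1 PQ -scalar_mx_block.
have -> : A ^+ N.+1 = A *m A ^+ N by rewrite exprS.
have -> : Au ^+ N.+1 = Au *m Au ^+ N by rewrite exprS.
have -> : As ^+ N.+1 = As *m As ^+ N by rewrite exprS.
rewrite mulmxA -[P *m A]mulmx1 -QP !mulmxA PAQ -!mulmxA (mulmxA P) IH.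
by rewrite mulmx_block !mulmx0 !mul0mx !addr0 add0r.
Qed.

Lemma ln_natM (m n : nat) : (0 < m)%N -> (0 < n)%N ->
  ln (m * n)%:R = ln m%:R + ln n%:R :> R.
Proof. by move=> m0 n0; rewrite natrM lnM// posrE ltr0n. Qed.

Lemma ln_natX (m n : nat) : (0 < m)%N ->
  ln (m ^ n)%:R = n%:R * ln m%:R :> R.
Proof. by move=> m0; rewrite natrX lnXn ?ltr0n// mulr_natl. Qed.

(** Both the lower and the upper count are made with the same net, so that
    they differ by a factor which is subexponential in [N]. *)
Lemma htop_pinched n (e : 'rV[R]_n -> M -> M) (A : 'M[R]_n) (eps : R) :
  compact [set: M] -> exp_frame e -> A \in unitmx -> 0 < eps ->
  exists eta L : R, 0 < eta /\ forall f, continuous f -> tangent e f A eta ->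
    ((L%:E <= htop f) /\ (htop f <= (L + eps)%:E))%E.
Proof.
move=> cM eF AU eps0.
have [u [s [P [Q [Au [As [PQ QP PAQ [th [C [th0 th1 C0 uP]]] sP]]]]]]] :=
  hyperbolic_split AU.
have eF' := exp_frame_linear PQ QP eF.
pose t2 := Num.min ((1 + th^-1) / 2) (expR (eps / (3 * s.+1%:R))).
have thV : 1 < th^-1 by rewrite invf_gt1.
have s0 : 0 < s.+1%:R :> R by rewrite ltr0n.
have t21 : 1 < t2.
  rewrite lt_min; apply/andP; split; first lra.
  by rewrite expR_gt1 divr_gt0// mulr_gt0.
have lnt2 : s%:R * ln t2 <= eps / 3.
  apply: le_trans (_ : s.+1%:R * (eps / (3 * s.+1%:R)) <= _); last first.
    by rewrite (_ : s.+1%:R * _ = eps / 3) ?lexx//; field; rewrite gt_eqF.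
  apply: ler_pM => //; [exact/ln_ge0/ltW|by rewrite ler_nat|].
  rewrite -[leRHS]expRK ler_ln ?posrE ?expR_gt0 ?ge_min ?lexx ?orbT//; lra.
have [D' D'0 DP] := sP t2 t21; pose D := D' + 1.
pose rho := th * t2.
have rho0 : 0 < rho by rewrite mulr_gt0//; lra.
have rho1 : rho < 1.
  apply: le_lt_trans (_ : th * ((1 + th^-1) / 2) < _).
    by rewrite ler_pM2l// ge_min lexx.
  by rewrite mulrA mulrDr mulr1 mulfV ?gt_eqF//; lra.
pose c1 := u%:R * ln 337 + s%:R * ln (49 * D).
have [N [N0 Nrho Nc1]] : exists N : nat, [/\ (0 < N)%N,
    (2 * D + 8) * C * rho ^+ N <= 1 & c1 <= N%:R * (eps / 3)].
  have cvg0 : (fun N => (2 * D + 8) * C * rho ^+ N) @ \oo --> (0 : R).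
    by apply: cvg_geometric; rewrite ger0_norm// ltW.
  have [N1 _ N1P] : \forall N \near \oo, (2 * D + 8) * C * rho ^+ N < 1.
    exact: (cvgr_lt _ cvg0).
  exists (maxn N1 (Num.bound `|c1 / (eps / 3)|)).+1; split => //.
    by apply/ltW/N1P; rewrite /= leqW// leq_maxl.
  rewrite -ler_pdivrMr ?divr_gt0// ltW// (lt_le_trans (lt_archi_bound _))//.
  by rewrite ler_nat leqW// leq_maxr.
pose Bu := Au ^+ N; pose Bs := As ^+ N.
have t2N : 1 <= t2 ^+ N by rewrite exprn_ege1// ltW.
pose kap := D * t2 ^+ N; pose Lam := (2 * D + 8) * t2 ^+ N.
have kap1 : 1 <= kap by rewrite /kap mulr_ege1// /D lerDr ltW.
have BuL (a : 'rV[R]_u) : Lam * `|a| <= `|a *m Bu|.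
  have := uP N a; rewrite -/Bu => /(ler_wpM2l (_ : 0 <= Lam)) -/(_ _).
  have L0 : 0 <= Lam by rewrite mulr_ge0//; [rewrite /D; lra|lra].
  move=> /(_ L0) /le_trans; apply; rewrite !mulrA.
  rewrite -[leRHS]mul1r ler_wpM2r//; apply: le_trans Nrho.
  by rewrite /Lam /rho exprMn le_eqVlt; apply/orP; left; apply/eqP; ring.
have BsL (t : 'rV[R]_s) : `|t *m Bs| <= kap * `|t|.
  rewrite (le_trans (DP N t))// ler_wpM2r// ler_wpM2r ?(le_trans ler01)//.
  by rewrite lerDl.
have Lam8 : 8 <= Lam.
  have : 0 <= D * t2 ^+ N by rewrite -/kap; lra.
  by rewrite /Lam; lra.
have Lk : 2 * kap + 2 <= Lam by rewrite /Lam /kap; lra.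
have BuU : Bu \in unitmx.
  rewrite -row_free_unit; apply: inj_row_free => a aB.
  apply/eqP; rewrite -normr_le0; have := BuL a; rewrite aB normr0.
  have : 0 <= `|a| by []; nra.
have [K [q [K0 q1 qsep qnet]]] := separated_net Bu.
have [eta1 eta10 lower] := htop_ge_count cM eF' BuU Lam8 (le_trans ler01 kap1)
  Lk BuL BsL K0 N0 q1 qsep.
pose L := (Num.trunc kap).+2.
have [kL Lk2] : kap + 1 <= L%:R /\ L%:R <= kap + 2.
  have /andP[] := trunc_itv (le_trans ler01 kap1).
  by rewrite /L -[(Num.trunc kap).+2%:R]natr1 -[(Num.trunc kap).+1%:R]natr1; lra.
have [l lsize lP] := image_cover qnet BsL (le_trans ler01 kap1) kL.
have [k k0 kP] := tangent_linear e QP (block_conj_expr N PQ QP PAQ).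
have m0 : 0 < Num.min eta1 1 by rewrite lt_min eta10 ltr01.
have [eta eta0 etaP] := tangent_iter e A N (divr_gt0 m0 k0).
exists eta, (ln K%:R / N%:R); split=> // f cf /etaP tf.
have {}tf := kP _ _ (ltW (divr_gt0 m0 k0)) tf.
rewrite mulrCA mulfV ?gt_eqF// mulr1 in tf.
split.
  by apply: lower => //; apply: tangentS tf; rewrite ge_min lexx.
have tf1 : tangent (fun X => e (X *m P)) (iter N f) (block_mx Bu 0 0 Bs) 1.
  by apply: tangentS tf; rewrite ge_min lexx orbT.
apply: le_trans (htop_le_count cM eF' cf N0 ler01 tf1 lP) _.
rewrite lee_fin lsize.
have NR : 0 < N%:R :> R by rewrite ltr0n.
rewrite ler_pdivrMr// mulrDl divfK ?gt_eqF//.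
rewrite !ln_natM ?ln_natX ?muln_gt0 ?expn_gt0//= lerD2l.
have lnL : ln (16 * L).+1%:R <= ln (49 * D) + N%:R * ln t2 :> R.
  have D0 : 0 < D by rewrite addr_gt0.
  have t20 : 0 < t2 by lra.
  rewrite (mulr_natl (ln t2)) -lnXn// -lnM ?posrE ?exprn_gt0 ?mulr_gt0//.
  rewrite ler_ln ?posrE ?mulr_gt0 ?exprn_gt0// -natr1 natrM -mulrA -/kap; lra.
have := ler_wpM2l (ler0n R s) lnL; move: Nc1; rewrite /c1.
have := ler_wpM2l (ltW NR) lnt2; nra.
Qed.

End Pinching.

(** * Strict differentiability *)

Section StrictDiff.
Context {R : realType}.

(** Strict differentiability at [x0] with derivative [A]. It is a first order
    property, stable under composition, and at all points of an open set it is
    equivalent to being of class C^1. *)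
Definition sdiff m n (f : 'rV[R]_m -> 'rV[R]_n) (x0 : 'rV[R]_m)
    (A : 'M[R]_(m, n)) := forall eps : R, 0 < eps -> exists2 d : R, 0 < d &
  forall x y : 'rV[R]_m, `|x - x0| < d -> `|y - x0| < d ->
    `|f y - f x - (y - x) *m A| <= eps * `|y - x|.

Lemma nbhs_rVP m (x0 : 'rV[R]_m) (P : set 'rV[R]_m) :
  nbhs x0 P <-> exists2 d : R, 0 < d & forall z, `|z - x0| < d -> P z.
Proof.
split=> [/nbhs_ballP[d /= d0 dP]|[d d0 dP]].
  by exists d => // z zd; apply: dP; rewrite -ball_normE /= distrC.
apply/nbhs_ballP; exists d => // z; rewrite -ball_normE /= distrC; exact: dP.
Qed.

Lemma sdiff_lip m n (f : 'rV[R]_m -> 'rV[R]_n) x0 A : sdiff f x0 A ->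
  exists2 D : R, 0 < D & exists2 d : R, 0 < d &
    forall x y : 'rV[R]_m, `|x - x0| < d -> `|y - x0| < d -> `|f y - f x| <= D * `|y - x|.
Proof.
move=> fA; have [D D0 DP] := mulmx_bound A; have [d d0 dP] := fA 1 ltr01.
exists (D + 1); first by rewrite addr_gt0.
exists d => // x y xd yd; have := dP x y xd yd; have := DP (y - x).
have := ler_norm_dist (f y - f x) ((y - x) *m A); lra.
Qed.

Lemma sdiff_comp m n p (f : 'rV[R]_m -> 'rV[R]_n) (g : 'rV[R]_n -> 'rV[R]_p)
    x0 A B : sdiff f x0 A -> sdiff g (f x0) B ->
  sdiff (g \o f) x0 (A *m B).
Proof.
move=> fA gB eps eps0.
have [D D0 [d1 d10 fD]] := sdiff_lip fA.
have [E E0 EP] := mulmx_bound B.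
have [d2 d20 gP] := gB (eps / (2 * D)) (divr_gt0 eps0 (mulr_gt0 (ltr0Sn _ 1) D0)).
have [d3 d30 fP] := fA (eps / (2 * E)) (divr_gt0 eps0 (mulr_gt0 (ltr0Sn _ 1) E0)).
exists (Num.min (Num.min d1 d3) (d2 / D)).
  by rewrite !lt_min d10 d30 divr_gt0.
move=> x y; rewrite !lt_min => /andP[/andP[x1 x3] x2] /andP[/andP[y1 y3] y2].
have near z : `|z - x0| < d1 -> `|z - x0| < d2 / D -> `|f z - f x0| < d2.
  move=> z1 z2; have := fD x0 z _ z1; rewrite subrr normr0 => /(_ d10).
  by move/le_lt_trans; apply; rewrite mulrC -ltr_pdivlMr.
have /= H1 := gP (f x) (f y) (near x x1 x2) (near y y1 y2).
have H2 := fP x y x3 y3.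
have -> : (g \o f) y - (g \o f) x - (y - x) *m (A *m B) =
  (g (f y) - g (f x) - (f y - f x) *m B) +
  (f y - f x - (y - x) *m A) *m B.
  by rewrite (mulmxBl (f y - f x)) mulmxA addrA subrK.
rewrite (le_trans (ler_normD _ _))// [eps]splitr mulrDl lerD//.
  rewrite (le_trans H1)//; apply: le_trans (ler_wpM2l _ (fD x y x1 y1)) _.
    by rewrite divr_ge0 ?mulr_ge0// ltW.
  rewrite (_ : eps / (2 * D) * (D * `|y - x|) = eps / 2 * `|y - x|) ?lexx//.
  by field; rewrite gt_eqF.
rewrite (le_trans (EP _))//; apply: le_trans (ler_wpM2l (ltW E0) H2) _.
rewrite (_ : E * (eps / (2 * E) * `|y - x|) = eps / 2 * `|y - x|) ?lexx//.
by field; rewrite gt_eqF.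
Qed.

Lemma sdiff_affine m n (A : 'M[R]_(m, n)) b x0 :
  sdiff (fun x : 'rV[R]_m => x *m A + b) x0 A.
Proof.
move=> eps eps0; exists 1 => // x y _ _.
rewrite opprD addrACA subrr addr0 -mulmxBl subrr normr0.
by rewrite mulr_ge0// ltW.
Qed.

Lemma sdiff_cst m n (b : 'rV[R]_n) (x0 : 'rV[R]_m) : sdiff (fun=> b) x0 0.
Proof.
move=> eps eps0; exists 1 => // x y _ _.
by rewrite subrr mulmx0 subrr normr0 mulr_ge0// ltW.
Qed.

Lemma sdiff_row_mx m n p (f : 'rV[R]_m -> 'rV[R]_n) (g : 'rV[R]_m -> 'rV[R]_p)
    x0 A B : sdiff f x0 A -> sdiff g x0 B ->
  sdiff (fun x => row_mx (f x) (g x)) x0 (row_mx A B).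
Proof.
move=> fA gB eps eps0.
have [d1 d10 fP] := fA eps eps0; have [d2 d20 gP] := gB eps eps0.
exists (Num.min d1 d2); first by rewrite lt_min d10.
move=> x y; rewrite !lt_min => /andP[x1 x2] /andP[y1 y2].
rewrite mul_mx_row !opp_row_mx !add_row_mx.
by apply: norm_row_mx_le; [exact: fP|exact: gP].
Qed.

Lemma sdiff_near m n (f g : 'rV[R]_m -> 'rV[R]_n) x0 A :
  (exists2 d : R, 0 < d & forall x, `|x - x0| < d -> f x = g x) ->
  sdiff f x0 A -> sdiff g x0 A.
Proof.
move=> [d d0 fg] fA eps eps0; have [d' d'0 fP] := fA eps eps0.
exists (Num.min d d'); first by rewrite lt_min d0.
move=> x y; rewrite !lt_min => /andP[x1 x2] /andP[y1 y2].
by rewrite -!fg//; exact: fP.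
Qed.

(** Compare the two expansions along a short multiple of [v]. *)
Lemma sdiff_close m n (f : 'rV[R]_m -> 'rV[R]_n) z A B (eps : R) : 0 < eps ->
  (exists2 d : R, 0 < d & forall y : 'rV[R]_m, `|y - z| < d ->
    `|f y - f z - (y - z) *m A| <= eps * `|y - z|) ->
  sdiff f z B -> forall v : 'rV[R]_m, `|v *m A - v *m B| <= 2 * eps * `|v|.
Proof.
move=> eps0 [d1 d10 fP] /(_ _ eps0)[d2 d20 fP'] v.
have v0 : 0 < 2 * (`|v| + 1) by rewrite mulr_gt0// ltr_wpDl.
pose t := Num.min d1 d2 / (2 * (`|v| + 1)).
have d0 : 0 < Num.min d1 d2 by rewrite lt_min d10.
have t0 : 0 < t by rewrite divr_gt0.
have tv : `|t *: v| < Num.min d1 d2.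
  have tE : t * (2 * (`|v| + 1)) = Num.min d1 d2 by rewrite divfK// gt_eqF.
  have : 0 <= t * `|v| by rewrite mulr_ge0// ltW.
  by rewrite normrZ gtr0_norm// -tE; lra.
move: tv; rewrite lt_min => /andP[tv1 tv2].
have := fP (z + t *: v); have := fP' z (z + t *: v).
rewrite subrr normr0 (addrC z) addrK => /(_ d20 tv2) H2 /(_ tv1) H1.
set w := f _ - f z in H1 H2.
have := ler_distD w (t *: v *m A) (t *: v *m B).
rewrite -mulmxBr -(scalemxAl t v (A - B)) normrZ gtr0_norm// (distrC _ w).
rewrite normrZ gtr0_norm// in H1 H2; rewrite mulmxBr => H3.
by rewrite -(ler_pM2l t0); lra.
Qed.

Lemma sdiff_unique m n (f : 'rV[R]_m -> 'rV[R]_n) x0 A B :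
  sdiff f x0 A -> sdiff f x0 B -> A = B.
Proof.
move=> fA fB; apply/row_matrixP => i; rewrite !rowE.
set v := delta_mx 0 i; apply/eqP; rewrite -subr_eq0 -normr_le0.
apply/ler_addgt0Pr => e e0; rewrite add0r.
have v0 : 0 < 2 * (`|v| + 1) by rewrite mulr_gt0// ltr_wpDl.
have k0 : 0 < e / (2 * (`|v| + 1)) by rewrite divr_gt0.
have kE : e / (2 * (`|v| + 1)) * (2 * (`|v| + 1)) = e by rewrite divfK// gt_eqF.
apply: le_trans (@sdiff_close _ _ _ _ A _ _ k0 _ fB v) _; last by lra.
have [d d0 dP] := fA _ k0; exists d => // y yd; apply: dP => //.
by rewrite subrr normr0.
Qed.

Lemma is_derive_line m n (f : 'rV[R]_m -> 'rV[R]_n) (x v : 'rV[R]_m) (t : R) j :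
  differentiable f (x + t *: v) ->
  is_derive t (1 : R) (fun s : R => f (x + s *: v) 0 j : R)
    (('D_v f (x + t *: v)) 0 j).
Proof.
move=> df.
have dv : derivable f (x + t *: v) v by exact: diff_derivable.
pose F (h : R) := h^-1 *: ((f \o shift (x + t *: v)) (h *: v) - f (x + t *: v)).
have cvgF : (fun h => F h 0 j) @ 0^' --> ('D_v f (x + t *: v)) 0 j.
  apply: (cvg_comp F (fun N : 'rV[R]_n => N 0 j)); first exact: dv.
  exact: coord_continuous.
have E : (fun h : R => h^-1 *: (((fun s : R => f (x + s *: v) 0 j : R) \o
    shift t) (h *: 1) - f (x + t *: v) 0 j)) = (fun h => F h 0 j).
  apply/funext => h; rewrite /F /= !mxE.
  suff -> : x + (h *: 1 + t) *: v = h *: v + (x + t *: v) by [].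
  by rewrite scalerDl [h *: 1]mulr1 addrCA.
apply: DeriveDef; first by rewrite /derivable E; apply/cvg_ex; eexists; exact: cvgF.
by rewrite /derive E; exact: cvg_lim.
Qed.

(** The mean value theorem is applied to each coordinate along the segment; no
    constant is lost because the norm is the supremum norm. *)
Lemma mvt_ball m n (f : 'rV[R]_m -> 'rV[R]_n) (c : 'rV[R]_m) (r K : R) (A : 'M[R]_(m, n)) :
  0 <= K ->
  (forall z : 'rV[R]_m, `|z - c| < r -> differentiable f z) ->
  (forall z v : 'rV[R]_m, `|z - c| < r -> `|'D_v f z - v *m A| <= K * `|v|) ->
  forall x y : 'rV[R]_m, `|x - c| < r -> `|y - c| < r ->
    `|f y - f x - (y - x) *m A| <= K * `|y - x|.
Proof.
move=> K0 df dK x y xr yr; apply: norm_rV_le => [|j]; first exact: mulr_ge0.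
set v := y - x.
have seg (t : R) : 0 <= t -> t <= 1 -> `|x + t *: v - c| < r.
  move=> t0 t1.
  have -> : x + t *: v - c = (1 - t) *: (x - c) + t *: (y - c).
    by rewrite /v; apply/rowP => i; rewrite !mxE; ring.
  rewrite (le_lt_trans (ler_normD _ _))// !normrZ !ger0_norm ?subr_ge0//.
  have [->|tn0] := eqVneq t 0; first by rewrite mul0r subr0 mul1r addr0.
  have : 0 < t by rewrite lt_neqAle eq_sym tn0.
  nra.
pose phi (s : R) : R := f (x + s *: v) 0 j.
pose dphi (s : R) : R := ('D_v f (x + s *: v)) 0 j.
have der (t : R) : 0 <= t -> t <= 1 -> is_derive t (1 : R) phi (dphi t).
  by move=> t0 t1; apply: is_derive_line; exact/df/seg.
have cphi : {within `[0, 1], continuous phi}.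
  apply: derivable_within_continuous => t; rewrite in_itv /= => /andP[t0 t1].
  by have [] := der t t0 t1.
have der' (t : R) : t \in `]0, 1[%R -> is_derive t (1 : R) phi (dphi t).
  by rewrite in_itv /= => /andP[t0 t1]; apply: der; exact: ltW.
have [t] := MVT ltr01 der' cphi.
rewrite in_itv /= => /andP[t0 t1]; have xv : x + v = y by rewrite /v addrC subrK.
rewrite /phi /dphi scale1r scale0r addr0 subr0 mulr1 xv => fE.
have := dK (x + t *: v) v (seg t (ltW t0) (ltW t1)).
by apply: le_trans; rewrite !mxE fE; have := ler_coord_norm
  ('D_v f (x + t *: v) - v *m A) j; rewrite !mxE.
Qed.

(** Near [x0] the partial derivatives are close to those at [x0], and the mean
    value inequality turns this into strict differentiability. *)
Lemma C1_sdiff m n (f : 'rV[R]_m -> 'rV[R]_n) (U : set 'rV[R]_m)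
    (x0 : 'rV[R]_m) :
  nbhs x0 U -> Ck_on 1 U f -> exists A, sdiff f x0 A.
Proof.
move=> nU [df dc]; have Ux0 := nbhs_singleton nU; exists (jacobian f x0) => eps eps0.
pose k := eps / m.+1%:R.
have k0 : 0 < k by rewrite divr_gt0.
have : \forall z \near x0, U z /\ forall i : 'I_m,
    `|'D_(delta_mx 0 i) f z - 'D_(delta_mx 0 i) f x0| < k.
  apply: filterI => //.
  apply: (@filter_forall _ _ (fun (i : 'I_m) (z : 'rV[R]_m) =>
    `|'D_(delta_mx 0 i) f z - 'D_(delta_mx 0 i) f x0| < k) _
    (nbhs_filter x0)) => i.
  have /cvgrPdist_lt/(_ k k0) := dc (delta_mx 0 i) x0 Ux0.
  by apply: (@filterS _ _ (nbhs_filter x0)) => z; rewrite distrC.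
move=> /nbhs_rVP[d d0 dP].
exists d => //; apply: mvt_ball; [exact: ltW| |].
  by move=> z /dP[Uz _]; exact: df.
move=> z v zd; have [Uz zP] := dP z zd.
rewrite deriveEjacobian; last exact: df.
rewrite -mulmxBr mulmx_sum_row (le_trans (ler_norm_sum _ _ _))//.
apply: le_trans (_ : \sum_(i < m) k * `|v| <= _).
  apply: ler_sum => i _; rewrite normrZ mulrC ler_pM// ?ler_coord_norm//.
  have := ltW (zP i); rewrite !deriveEjacobian; [|exact: df|exact: df].
  by rewrite -mulmxBr -rowE.
rewrite sumr_const card_ord -mulrnAl ler_wpM2r// /k -mulr_natr.
by rewrite -mulrA ler_piMr ?(ltW eps0)// mulrC ler_pdivrMr// mul1r ler_nat.
Qed.

Lemma sdiff_differentiable m n (f : 'rV[R]_m -> 'rV[R]_n) (x0 : 'rV[R]_m) A :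
  sdiff f x0 A -> differentiable f x0 /\ forall v, 'D_v f x0 = v *m A.
Proof.
move=> fA.
have cA : continuous (mulmxr A : 'rV[R]_m -> 'rV[R]_n).
  have [D D0 DP] := mulmx_bound A.
  move=> x; apply/(@cvgrPdist_le _ _ _ (nbhs x) (nbhs_filter x)) => eps eps0.
  apply/nbhs_rVP.
  exists (eps / D) => [|z zx]; first exact: divr_gt0.
  rewrite /= -mulmxBl (le_trans (DP _))// mulrC -ler_pdivlMr//.
  by rewrite distrC ltW.
have exp : f \o shift x0 = cst (f x0) + mulmxr A +o_ (0 : 'rV[R]_m) id.
  apply/eqaddoP => eps eps0; have [d d0 dP] := fA eps eps0.
  apply/nbhs_rVP; exists d => // z; rewrite subr0 => zd.
  have := dP x0 (z + x0); rewrite addrK subrr normr0 => /(_ d0 zd).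
  by rewrite /= opprD addrA.
have dfE := diff_unique cA exp.
have dff : differentiable f x0 by apply/diff_locallyP; rewrite dfE.
by split=> // v; rewrite deriveE// dfE.
Qed.

(** Strict differentiability at [x] compares the derivatives at nearby points
    with the derivative at [x]; this is their continuity. *)
Lemma sdiff_C1 m n (f : 'rV[R]_m -> 'rV[R]_n) (U : set 'rV[R]_m) :
  open U -> (forall x, U x -> exists A, sdiff f x A) -> Ck_on 1 U f.
Proof.
move=> oU sf; split=> [x /sf[A /sdiff_differentiable[]]//|v x Ux].
have [A fA] := sf x Ux; have [_ vA] := sdiff_differentiable fA.
apply/(@cvgrPdist_le _ _ _ (nbhs x) (nbhs_filter x)) => eps eps0.
have v0 : 0 < 2 * (`|v| + 1) by rewrite mulr_gt0// ltr_wpDl.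
have k0 : 0 < eps / (2 * (`|v| + 1)) by rewrite divr_gt0.
have kE : eps / (2 * (`|v| + 1)) * (2 * (`|v| + 1)) = eps.
  by rewrite divfK// gt_eqF.
have [d d0 dP] := fA _ k0.
have /nbhs_rVP[d' d'0 d'U] : nbhs x U by exact: open_nbhs_nbhs.
apply/nbhs_rVP; exists (Num.min d d') => [|z]; first by rewrite lt_min d0.
rewrite /= vA lt_min => /andP[zd /d'U Uz].
have [B fB] := sf z Uz; have [_ ->] := sdiff_differentiable fB.
apply: le_trans (@sdiff_close _ _ _ _ A _ _ k0 _ fB v) _; last by lra.
exists (d - `|z - x|) => [|y yd]; first by rewrite subr_gt0.
by apply: dP => //; have := ler_distD z y x; lra.
Qed.

End StrictDiff.

(** * The projection onto the coset space *)

Section CosetProjection.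
Context {R : realType} {G : lieGroupType R} (Gamma : groupClosed G).
Local Notation M := (coset_space Gamma).
Local Notation pi := (coset_pi Gamma).

Lemma mulg_continuous : continuous (fun p : G * G => (p.1 * p.2)%g).
Proof. exact: (@lie_mul_smooth R G 0%N).1. Qed.

Lemma invg_continuous : continuous (fun x : G => x^-1%g).
Proof. exact: (@lie_inv_smooth R G 0%N).1. Qed.

Lemma near_mulg (a b : G) (P : set G) : nbhs (a * b)%g P ->
  \forall x \near a & y \near b, P (x * y)%g.
Proof. exact: (@mulg_continuous (a, b) P). Qed.

Lemma near_mulg_l (a b : G) (P : set G) : nbhs (a * b)%g P ->
  \forall y \near b, P (a * y)%g.
Proof.
move=> /near_mulg[[A B] /= [nA nB] AB]; apply: filterS nB => y By.
by apply: (AB (a, y)); split => //; exact: nbhs_singleton.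
Qed.

Lemma near_mulg_r (a b : G) (P : set G) : nbhs (a * b)%g P ->
  \forall x \near a, P (x * b)%g.
Proof.
move=> /near_mulg[[A B] /= [nA nB] AB]; apply: filterS nA => x Ax.
by apply: (AB (x, b)); split => //; exact: nbhs_singleton.
Qed.

Lemma pi_continuous : continuous pi.
Proof. exact: quotient_topology.pi_continuous. Qed.

Lemma pi_eqP a b : pi a = pi b <-> (a^-1 * b)%g \in Gamma.
Proof. by split=> [/eqmodP|H]; [|apply/eqmodP]. Qed.

Lemma pi_surj (x : M) : exists a, x = pi a.
Proof. by exists (repr x); rewrite /coset_pi reprK. Qed.

(** The saturation of an open set is a union of right translates of it. *)
Lemma pi_open (W : set G) : open W -> open (pi @` W).
Proof.
move=> oO; change (open (pi @^-1` (pi @` W))).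
rewrite openE => a [b Ob ba].
have abO : nbhs (a * (a^-1 * b))%g W by rewrite mulVKg; exact: open_nbhs_nbhs.
apply: filterS (near_mulg_r abO) => a' /= Oa'.
exists (a' * (a^-1 * b))%g => //; apply/pi_eqP.
by rewrite invgM -mulgA mulVg mulg1 gpredV; apply/pi_eqP.
Qed.

Lemma near_pi (a : G) (P : set M) :
  (\forall b \near a, P (pi b)) -> nbhs (pi a) P.
Proof.
rewrite /prop_near1 !nbhsE /= => -[W [oW Wa] WP]; exists (pi @` W).
  by split; [exact: pi_open|exists a].
by move=> _ [b Ob <-]; exact: WP.
Qed.

(** Two points near [a0] in the same coset differ by an element of the discrete
    subgroup near [1]. *)
Lemma pi_locally_inj (a0 : G) : discrete_subgroup Gamma ->
  exists2 U, open_nbhs a0 U & {in U &, injective pi}.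
Proof.
move=> disc; have [_ [V nV VG]] := disc 1%g gpred1.
have nV1 : nbhs (a0^-1 * a0)%g V by rewrite mulVg.
have [[A B] /= [nA nB] AB] := near_mulg nV1.
have nA' : \forall a \near a0, A (a^-1)%g := @invg_continuous a0 A nA.
have : nbhs a0 ([set a | A a^-1%g] `&` B) by exact: filterI.
rewrite nbhsE /= => -[U oU UP]; exists U => // a b.
rewrite !inE => Ua Ub /pi_eqP abG.
have : (V `&` [set` Gamma]) (a^-1 * b)%g.
  split => //; apply: (AB (_, _)); split => /=.
    by have [] := UP _ Ua.
  by have [] := UP _ Ub.
by rewrite VG /= => abE; rewrite -[b](mulVKg a) abE mulg1.
Qed.

Lemma translationM (a b : G) (x : M) :
  translation (a * b)%g x = translation a (translation b x).
Proof. by have [y ->] := pi_surj x; rewrite !translation_pi mulgA. Qed.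

Lemma translation1 (x : M) : translation 1%g x = x.
Proof. by have [y ->] := pi_surj x; rewrite translation_pi mul1g. Qed.

Lemma translation_continuous (g : G) : continuous (translation g : M -> M).
Proof.
move=> x; have [a ->] := pi_surj x => P.
rewrite translation_pi => nP; apply: near_pi.
have /= := pi_continuous nP => /near_mulg_l; apply: filterS => b /=.
by rewrite translation_pi.
Qed.

(** Local bounds, monotone in the radius, become uniform by compactness. *)
Lemma uniform_radius (P : R -> M -> Prop) : compact [set: M] ->
  (forall (r r' : R) x, 0 < r' -> r' <= r -> P r x -> P r' x) ->
  (forall a : G, exists2 r : R, 0 < r & \forall b \near a, P r (pi b)) ->
  exists2 r : R, 0 < r & forall x, P r x.
Proof.
move=> /compact_near_coveringP cM Pmon Ploc.
have : \forall r \near (0 : R)^'+, [set: M] `<=` P r.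
  apply: cM => x _; have [a ->] := pi_surj x; have [r r0 rP] := Ploc a.
  exists ((P r), [set r' | 0 < r' <= r]) => /=.
    split; first exact: near_pi.
    near=> r'; apply/andP; split; first by near: r'; exact: nbhs_right_gt.
    by near: r'; exact: nbhs_right_le.
  by move=> [y r'] /= [Py /andP[r'0 r'r]]; exact: Pmon Py.
move=> H; near (0 : R)^'+ => r; exists r.
  by near: r; exact: nbhs_right_gt.
by move=> x; have : [set: M] `<=` P r by [near: r]; apply.
Unshelve. all: by end_near. Qed.

End CosetProjection.

(** * Maps from a vector space to a Lie group *)

Section LieMaps.
Context {R : realType} {G : lieGroupType R}.
Local Notation n := (@lie_dim R G).
Implicit Types (c : chart R G n) (a b : G).

Lemma lie_is_chart c : lie_atlas c -> is_chart c.
Proof. by have [+ _ _] := @lie_atlas_smooth R G; apply. Qed.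

Lemma lie_chart_at a : exists2 c, @lie_atlas R G c & chart_dom c a.
Proof. by have [_ + _] := @lie_atlas_smooth R G; apply. Qed.

Lemma chart_invK c a : lie_atlas c -> chart_dom c a -> chart_inv c (c a) = a.
Proof. by move=> /lie_is_chart[_ _ + _ _]; apply. Qed.

Lemma near_chart c a (P : set G) : lie_atlas c -> chart_dom c a -> nbhs a P ->
  \forall X \near c a,
    [/\ chart_dom c (chart_inv c X), c (chart_inv c X) = X & P (chart_inv c X)].
Proof.
move=> cA ca nP; have [oD oC cK _ cinv] := lie_is_chart cA.
have cc : chart_cod c (c a) by exists a.
have nPc : nbhs (chart_inv c (c a)) P by rewrite cK.
have nC : nbhs (c a) (chart_cod c) by exact: open_nbhs_nbhs.
apply: filterS (filterI nC (cinv _ cc _ nPc)) => X [[b cb <-] /= Pb].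
by rewrite cK// in Pb *.
Qed.

(** Strict differentiability read in the charts of [G]; asking for all charts at
    the point rather than for one makes the notion stable under products. *)
Definition lie_sdiff m (phi : 'rV[R]_m -> G) (x0 : 'rV[R]_m) :=
  {for x0, continuous phi} /\
  forall c, lie_atlas c -> chart_dom c (phi x0) ->
    exists A, sdiff (c \o phi) x0 A.

Lemma lie_sdiff_cst m (b : G) (x0 : 'rV[R]_m) : lie_sdiff (fun=> b) x0.
Proof.
split; first exact: cst_continuous.
by move=> c _ _; exists 0; exact: sdiff_cst.
Qed.

Lemma lie_sdiff_chart_inv c a : lie_atlas c -> chart_dom c a ->
  lie_sdiff (chart_inv c) (c a).
Proof.
move=> cA ca; split.
  have [_ _ _ _ cinv] := lie_is_chart cA; apply: cinv; by exists a.
move=> c' c'A; rewrite chart_invK// => c'a.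
have [_ _ trans] := @lie_atlas_smooth R G.
apply: C1_sdiff (trans c c' cA c'A 1%N).
have [oD' _ _ _ _] := lie_is_chart c'A.
have := near_chart cA ca (open_nbhs_nbhs (conj oD' c'a)).
by apply: filterS => X [cX XE c'X]; exists (chart_inv c X).
Qed.

Lemma lie_sdiff_comp m p (f : 'rV[R]_m -> 'rV[R]_p) (phi : 'rV[R]_p -> G) x0 A :
  sdiff f x0 A -> lie_sdiff phi (f x0) -> lie_sdiff (phi \o f) x0.
Proof.
move=> fA [cphi sphi]; split.
  apply: continuous_comp => //.
  by have [/differentiable_continuous] := sdiff_differentiable fA.
move=> c cA /(sphi c cA)[B sB]; exists (A *m B); exact: sdiff_comp sB.
Qed.

Lemma sdiff_eq_near m p (f g : 'rV[R]_m -> 'rV[R]_p) (x0 : 'rV[R]_m) A :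
  (\forall x \near x0, f x = g x) -> sdiff f x0 A -> sdiff g x0 A.
Proof. by move=> /nbhs_rVP; exact: sdiff_near. Qed.

(** The factors are read in two charts, and smoothness of the multiplication in
    the product chart gives that of the product. *)
Lemma lie_sdiff_mul m (phi psi : 'rV[R]_m -> G) x0 : lie_sdiff phi x0 -> lie_sdiff psi x0 ->
  lie_sdiff (fun x => phi x * psi x)%g x0.
Proof.
move=> [cphi sphi] [cpsi spsi].
have cmul : {for x0, continuous (fun x => phi x * psi x)%g}.
  apply: (@continuous_comp _ _ _ (fun x => (phi x, psi x))
    (fun p : G * G => (p.1 * p.2)%g)); last exact: mulg_continuous.
  move=> P [[P1 P2] /= [nP1 nP2] P12].
  apply: (@filterS2 _ _ (nbhs_filter x0) _ _ _ _ (cphi _ nP1) (cpsi _ nP2)).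
  move=> x x1 x2.
  exact: (P12 (_, _)).
split=> // c3 c3A c3ab.
have [c1 c1A c1a] := lie_chart_at (phi x0).
have [c2 c2A c2b] := lie_chart_at (psi x0).
have [A1 sA1] := sphi c1 c1A c1a; have [A2 sA2] := spsi c2 c2A c2b.
have [_ mulC] := @lie_mul_smooth R G 1%N.
have := mulC (prod_chart c1 c2) c3 _ c3A.
have pA : prod_atlas (@lie_atlas R G) lie_atlas (prod_chart c1 c2).
  by exists c1, c2.
move=> /(_ pA) /C1_sdiff sm.
have [oD1 _ _ _ _] := lie_is_chart c1A.
have [oD2 _ _ _ _] := lie_is_chart c2A.
have [oD3 _ _ _ _] := lie_is_chart c3A.
have [|B sB] := sm (row_mx (c1 (phi x0)) (c2 (psi x0))).
  have [[P1 P2] /= [nP1 nP2] P12] :=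
    near_mulg (open_nbhs_nbhs (conj oD3 c3ab)).
  have /nbhs_rVP[d1 d10 d1P] := near_chart c1A c1a nP1.
  have /nbhs_rVP[d2 d20 d2P] := near_chart c2A c2b nP2.
  apply/nbhs_rVP; exists (Num.min d1 d2) => [|v]; first by rewrite lt_min d10.
  rewrite lt_min => /andP[vd1 vd2].
  have [|c1v c1vE P1v] := d1P (lsubmx v).
    rewrite (le_lt_trans _ vd1)// -[in leLHS](row_mxKl (c1 (phi x0)) (c2 (psi x0))).
    by rewrite -linearB norm_lsubmx.
  have [|c2v c2vE P2v] := d2P (rsubmx v).
    rewrite (le_lt_trans _ vd2)// -[in leLHS](row_mxKr (c1 (phi x0)) (c2 (psi x0))).
    by rewrite -linearB norm_rsubmx.
  exists (chart_inv c1 (lsubmx v), chart_inv c2 (rsubmx v)).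
    split; first by split.
    exact: (P12 (_, _)).
  by rewrite /= c1vE c2vE hsubmxK.
have := sdiff_comp (sdiff_row_mx sA1 sA2) sB => scomp.
exists (row_mx A1 A2 *m B); apply: sdiff_eq_near scomp.
have n1 : \forall x \near x0, chart_dom c1 (phi x).
  by apply: cphi; exact: open_nbhs_nbhs.
have n2 : \forall x \near x0, chart_dom c2 (psi x).
  by apply: cpsi; exact: open_nbhs_nbhs.
apply: filterS2 n1 n2 => x x1 x2.
by rewrite /= row_mxKl row_mxKr !chart_invK.
Qed.

Lemma lie_sdiff_inv m (phi : 'rV[R]_m -> G) x0 : lie_sdiff phi x0 ->
  lie_sdiff (fun x => (phi x)^-1)%g x0.
Proof.
move=> [cphi sphi].
have cinv : {for x0, continuous (fun x => (phi x)^-1)%g}.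
  by apply: (@continuous_comp _ _ _ phi (fun x : G => x^-1%g)) => //;
    exact: invg_continuous.
split=> // c2 c2A c2a.
have [c1 c1A c1a] := lie_chart_at (phi x0).
have [A1 sA1] := sphi c1 c1A c1a.
have [_ invC] := @lie_inv_smooth R G 1%N.
have := invC c1 c2 c1A c2A => /C1_sdiff sm.
have [oD1 _ _ _ _] := lie_is_chart c1A.
have [oD2 _ _ _ _] := lie_is_chart c2A.
have [|B sB] := sm (c1 (phi x0)).
  have nV : nbhs (phi x0) [set a | chart_dom c2 a^-1%g].
    by apply: invg_continuous; exact: open_nbhs_nbhs.
  have := near_chart c1A c1a nV.
  by apply: filterS => X [cX XE c'X]; exists (chart_inv c1 X).
exists (A1 *m B); have := sdiff_comp sA1 sB; apply: sdiff_eq_near.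
have n1 : \forall x \near x0, chart_dom c1 (phi x).
  by apply: cphi; exact: open_nbhs_nbhs.
by apply: filterS n1 => x x1; rewrite /= chart_invK.
Qed.

End LieMaps.

(** * Exponential coordinates on the coset space *)

Section PartialDiff.
Context {R : realType} {m p q : nat}.
Implicit Types (F : 'rV[R]_(m + p) -> 'rV[R]_q) (A : 'M[R]_(m + p, q)).

Lemma sdiff_lsubmx (x0 : 'rV[R]_(m + p)) :
  sdiff (fun v => lsubmx v) x0 (col_mx 1%:M 0).
Proof.
move=> eps eps0; exists 1 => // x y _ _.
rewrite -{2}[y]hsubmxK -{2}[x]hsubmxK opp_row_mx add_row_mx mul_row_col.
by rewrite mulmx1 mulmx0 addr0 subrr normr0 mulr_ge0// ltW.
Qed.

Lemma sdiff_rsubmx (x0 : 'rV[R]_(m + p)) :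
  sdiff (fun v => rsubmx v) x0 (col_mx 0 1%:M).
Proof.
move=> eps eps0; exists 1 => // x y _ _.
rewrite -{2}[y]hsubmxK -{2}[x]hsubmxK opp_row_mx add_row_mx mul_row_col.
by rewrite mulmx1 mulmx0 add0r subrr normr0 mulr_ge0// ltW.
Qed.

Lemma sdiff_id (x0 : 'rV[R]_m) : sdiff id x0 1%:M.
Proof.
move=> eps eps0; exists 1 => // x y _ _.
by rewrite mulmx1 subrr normr0 mulr_ge0// ltW.
Qed.

Lemma sdiff_partial1 F x0 y0 A : sdiff F (row_mx x0 y0) A ->
  forall eps : R, 0 < eps -> exists2 d : R, 0 < d &
  forall x x' y, `|x - x0| < d -> `|x' - x0| < d -> `|y - y0| < d ->
    `|F (row_mx x' y) - F (row_mx x y) - (x' - x) *m usubmx A|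
      <= eps * `|x' - x|.
Proof.
move=> FA eps eps0; have [d d0 dP] := FA eps eps0.
exists (d / 2) => [|x x' y xd x'd yd]; first by rewrite divr_gt0.
have near z : `|z - x0| < d / 2 -> `|row_mx z y - row_mx x0 y0| < d.
  move=> zd; rewrite opp_row_mx add_row_mx.
  by apply: le_lt_trans (_ : d / 2 < _); [apply: norm_row_mx_le; exact: ltW|lra].
have := dP (row_mx x y) (row_mx x' y) (near x xd) (near x' x'd).
rewrite opp_row_mx add_row_mx subrr -{1}[A]vsubmxK mul_row_col mul0mx addr0.
move=> /le_trans; apply; rewrite ler_wpM2l ?(ltW eps0)//.
by apply: norm_row_mx_le => //; rewrite normr0.
Qed.

Lemma sdiff_partial2 F x0 y0 A : sdiff F (row_mx x0 y0) A ->
  forall eps : R, 0 < eps -> exists2 d : R, 0 < d &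
  forall x y y', `|x - x0| < d -> `|y - y0| < d -> `|y' - y0| < d ->
    `|F (row_mx x y') - F (row_mx x y) - (y' - y) *m dsubmx A|
      <= eps * `|y' - y|.
Proof.
move=> FA eps eps0; have [d d0 dP] := FA eps eps0.
exists (d / 2) => [|x y y' xd yd y'd]; first by rewrite divr_gt0.
have near z : `|z - y0| < d / 2 -> `|row_mx x z - row_mx x0 y0| < d.
  move=> zd; rewrite opp_row_mx add_row_mx.
  by apply: le_lt_trans (_ : d / 2 < _); [apply: norm_row_mx_le; exact: ltW|lra].
have := dP (row_mx x y) (row_mx x y') (near y yd) (near y' y'd).
rewrite opp_row_mx add_row_mx subrr -{1}[A]vsubmxK mul_row_col mul0mx add0r.
move=> /le_trans; apply; rewrite ler_wpM2l ?(ltW eps0)//.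
by apply: norm_row_mx_le => //; rewrite normr0.
Qed.

Lemma sdiff_slice1 F x0 y0 A : sdiff F (row_mx x0 y0) A ->
  sdiff (fun x => F (row_mx x y0)) x0 (usubmx A).
Proof.
move=> FA eps eps0; have [d d0 dP] := sdiff_partial1 FA eps0.
by exists d => // x y xd yd; apply: dP => //; rewrite subrr normr0.
Qed.

Lemma sdiff_slice2 F x0 y0 A : sdiff F (row_mx x0 y0) A ->
  sdiff (fun y => F (row_mx x0 y)) y0 (dsubmx A).
Proof.
move=> FA eps eps0; have [d d0 dP] := sdiff_partial2 FA eps0.
by exists d => // x y xd yd; apply: dP => //; rewrite subrr normr0.
Qed.

End PartialDiff.

Section LieExp.
Context {R : realType} {G : lieGroupType R}.
Local Notation n := (@lie_dim R G).
Variable c : chart R G n.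
Hypotheses (cA : lie_atlas c) (c1 : chart_dom c 1%g).

(** A chart at the identity, moved to the origin, stands for the exponential
    map; only its first order behaviour matters. *)
Definition lexp (X : 'rV[R]_n) : G := chart_inv c (X + c 1%g).
Definition llog (a : G) : 'rV[R]_n := c a - c 1%g.

Lemma lexp0 : lexp 0 = 1%g.
Proof. by rewrite /lexp add0r chart_invK. Qed.

Lemma llog1 : llog 1%g = 0.
Proof. by rewrite /llog subrr. Qed.

Lemma llogK a : chart_dom c a -> lexp (llog a) = a.
Proof. by move=> ca; rewrite /lexp /llog subrK chart_invK. Qed.

Lemma near_lexp (P : set G) : nbhs 1%g P -> exists2 r : R, 0 < r &
  forall X, `|X| < r ->
    [/\ chart_dom c (lexp X), llog (lexp X) = X & P (lexp X)].
Proof.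
move=> /(near_chart cA c1)/nbhs_rVP[r r0 rP]; exists r => // X Xr.
have [|cX XE PX] := rP (X + c 1%g); first by rewrite addrK.
by split=> //; rewrite /llog /lexp XE addrK.
Qed.

Lemma lie_sdiff_lexp m (f : 'rV[R]_m -> 'rV[R]_n) x0 A :
  sdiff f x0 A -> f x0 = 0 -> lie_sdiff (fun x => lexp (f x)) x0.
Proof.
move=> fA f0.
have := sdiff_comp fA (sdiff_affine 1%:M (c 1%g) (f x0)).
move=> /(@lie_sdiff_comp R G _ _ _ (chart_inv c)).
have -> : chart_inv c \o ((fun x => x *m 1%:M + c 1%g) \o f) =
    fun x => lexp (f x) by apply/funext => x; rewrite /= mulmx1.
by apply; rewrite /= f0 mul0mx add0r; exact: lie_sdiff_chart_inv.
Qed.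

Lemma sdiff_llog m (phi : 'rV[R]_m -> G) x0 : lie_sdiff phi x0 ->
  chart_dom c (phi x0) -> exists A, sdiff (fun x => llog (phi x)) x0 A.
Proof.
move=> [_ /(_ c cA) sphi] /sphi[A sA]; exists A => eps /sA[d d0 dP].
by exists d => // x y xd yd; rewrite /llog opprB addrA subrK; exact: dP.
Qed.

Lemma lie_sdiff_near m (phi : 'rV[R]_m -> G) x0 (P : set G) : lie_sdiff phi x0 ->
  nbhs (phi x0) P -> exists2 d : R, 0 < d & forall x, `|x - x0| < d -> P (phi x).
Proof. by move=> [cphi _] /cphi /nbhs_rVP. Qed.

Lemma nbhs_dom : nbhs 1%g (chart_dom c).
Proof.
by have [oD _ _ _ _] := lie_is_chart cA; exact: open_nbhs_nbhs.
Qed.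

(** The differential of the multiplication at the identity is the addition,
    since it is the identity in each variable. *)
Lemma lexp_mul (eta : R) : 0 < eta -> exists2 r : R, 0 < r & forall X Y,
  `|X| <= r -> `|Y| <= r -> chart_dom c (lexp X * lexp Y)%g /\
    `|llog (lexp X * lexp Y)%g - (X + Y)| <= eta * `|X|.
Proof.
move=> eta0.
pose phi (v : 'rV[R]_(n + n)) := (lexp (lsubmx v) * lexp (rsubmx v))%g.
have gphi : lie_sdiff phi (row_mx 0 0).
  apply: lie_sdiff_mul.
    by apply: lie_sdiff_lexp (sdiff_lsubmx _) _; rewrite row_mxKl.
  by apply: lie_sdiff_lexp (sdiff_rsubmx _) _; rewrite row_mxKr.
have phi0 : phi (row_mx 0 0) = 1%g by rewrite /phi row_mxKl row_mxKr lexp0 mulg1.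
have [A sA] : exists A, sdiff (fun x => llog (phi x)) (row_mx 0 0) A.
  by apply: sdiff_llog => //; rewrite phi0.
have [r1 r10 r1P] := near_lexp nbhs_dom.
have U1 : usubmx A = 1%:M.
  apply: sdiff_unique (sdiff_slice1 sA) _.
  apply: sdiff_near (sdiff_id 0); exists r1 => // X; rewrite subr0 => /r1P[_ XE _].
  by rewrite /phi row_mxKl row_mxKr lexp0 mulg1 XE.
have [d1 d10 d1P] : exists2 d : R, 0 < d &
    forall v, `|v - row_mx 0 0| < d -> chart_dom c (phi v).
  by apply: lie_sdiff_near => //; rewrite phi0; exact: nbhs_dom.
have [d2 d20 d2P] := sdiff_partial1 sA eta0.
pose r := Num.min (Num.min r1 d1) d2 / 2.
have m0 : 0 < Num.min (Num.min r1 d1) d2 by rewrite !lt_min r10 d10.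
have rm : r < Num.min (Num.min r1 d1) d2 by rewrite /r; lra.
exists r => [|X Y Xr Yr]; first by rewrite divr_gt0.
have := le_lt_trans Xr rm; rewrite !lt_min => /andP[/andP[X1 X2] X3].
have := le_lt_trans Yr rm; rewrite !lt_min => /andP[/andP[Y1 Y2] Y3].
have phiE Z : phi (row_mx Z Y) = (lexp Z * lexp Y)%g.
  by rewrite /phi row_mxKl row_mxKr.
split.
  rewrite -phiE; apply: d1P; rewrite opp_row_mx add_row_mx !subr0.
  apply: le_lt_trans (_ : Num.max `|X| `|Y| < _); last by rewrite gt_max X2.
  by apply: norm_row_mx_le; rewrite le_max lexx ?orbT.
have := d2P 0 X Y; rewrite subrr normr0 !subr0 U1 mulmx1 !phiE lexp0 mul1g.
move=> /(_ d20 X3 Y3); have [_ -> _] := r1P Y Y1.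
by rewrite opprD [- X - Y]addrC addrA.
Qed.

(** The quotient vanishes on the diagonal, so its increments are governed by its
    derivative in the second variable. *)
Lemma lexp_div (eta : R) : 0 < eta -> exists2 r : R, 0 < r & forall Y Z,
  `|Y| <= r -> `|Z| <= r -> chart_dom c (lexp Z * (lexp Y)^-1)%g /\
    `|llog (lexp Z * (lexp Y)^-1)%g - (Z - Y)| <= eta * `|Z - Y|.
Proof.
move=> eta0.
pose phi (v : 'rV[R]_(n + n)) := (lexp (rsubmx v) * (lexp (lsubmx v))^-1)%g.
have gphi : lie_sdiff phi (row_mx 0 0).
  apply: lie_sdiff_mul.
    by apply: lie_sdiff_lexp (sdiff_rsubmx _) _; rewrite row_mxKr.
  by apply: lie_sdiff_inv; apply: lie_sdiff_lexp (sdiff_lsubmx _) _; rewrite row_mxKl.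
have phi0 : phi (row_mx 0 0) = 1%g.
  by rewrite /phi row_mxKl row_mxKr lexp0 mulgV.
have [A sA] : exists A, sdiff (fun x => llog (phi x)) (row_mx 0 0) A.
  by apply: sdiff_llog => //; rewrite phi0.
have [r1 r10 r1P] := near_lexp nbhs_dom.
have D1 : dsubmx A = 1%:M.
  apply: sdiff_unique (sdiff_slice2 sA) _.
  apply: sdiff_near (sdiff_id 0); exists r1 => // X; rewrite subr0 => /r1P[_ XE _].
  by rewrite /phi row_mxKl row_mxKr lexp0 invg1 mulg1 XE.
have [d1 d10 d1P] : exists2 d : R, 0 < d &
    forall v, `|v - row_mx 0 0| < d -> chart_dom c (phi v).
  by apply: lie_sdiff_near => //; rewrite phi0; exact: nbhs_dom.
have [d2 d20 d2P] := sdiff_partial2 sA eta0.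
pose r := Num.min d1 d2 / 2.
have m0 : 0 < Num.min d1 d2 by rewrite !lt_min d10.
have rm : r < Num.min d1 d2 by rewrite /r; lra.
exists r => [|Y Z Yr Zr]; first by rewrite divr_gt0.
have := le_lt_trans Yr rm; rewrite !lt_min => /andP[Y1 Y2].
have := le_lt_trans Zr rm; rewrite !lt_min => /andP[Z1 Z2].
have phiE W : phi (row_mx Y W) = (lexp W * (lexp Y)^-1)%g.
  by rewrite /phi row_mxKl row_mxKr.
split.
  rewrite -phiE; apply: d1P; rewrite opp_row_mx add_row_mx !subr0.
  apply: le_lt_trans (_ : Num.max `|Y| `|Z| < _); last by rewrite gt_max Y1.
  by apply: norm_row_mx_le; rewrite le_max lexx ?orbT.
have := d2P Y Y Z; rewrite !subr0 D1 mulmx1 !phiE mulgV llog1 subr0.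
by move=> /(_ Y2 Y2 Z2).
Qed.

(** The matrix is that of the adjoint action of [g]; its inverse is that of
    [g^-1]. *)
Lemma lexp_conj (g : G) : exists2 A, A \in unitmx & forall eta : R, 0 < eta ->
  exists2 r : R, 0 < r & forall X, `|X| <= r ->
    chart_dom c (g * lexp X * g^-1)%g /\
    `|llog (g * lexp X * g^-1)%g - X *m A| <= eta * `|X|.
Proof.
pose phi h X := (h * lexp X * h^-1)%g.
have gphi h : lie_sdiff (phi h) 0.
  apply: lie_sdiff_mul; last exact: lie_sdiff_cst.
  by apply: lie_sdiff_mul; [exact: lie_sdiff_cst|exact: lie_sdiff_lexp (sdiff_id 0) _].
have phi0 h : phi h 0 = 1%g by rewrite /phi lexp0 mulg1 mulgV.
have sphi h : exists A, sdiff (fun x => llog (phi h x)) 0 A.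
  by apply: sdiff_llog => //; rewrite phi0.
have dphi h : exists2 d : R, 0 < d &
    forall X, `|X| < d -> chart_dom c (phi h X).
  have [|d d0 dP] := lie_sdiff_near (gphi h) (P := chart_dom c).
    by rewrite phi0; exact: nbhs_dom.
  by exists d => // X Xd; apply: dP; rewrite subr0.
have [A sA] := sphi g; have [B sB] := sphi g^-1%g.
have [d1 d10 d1P] := dphi g.
exists A.
  have [r1 r10 r1P] := near_lexp nbhs_dom.
  have AB : A *m B = 1%:M.
    have L0 : llog (phi g 0) = 0 by rewrite phi0 llog1.
    rewrite -{1}L0 in sB; apply: sdiff_unique (sdiff_comp sA sB) _.
    apply: sdiff_near (sdiff_id 0).
    exists (Num.min d1 r1) => [|X]; first by rewrite lt_min d10.
    rewrite subr0 lt_min => /andP[/d1P Xd /r1P[_ XE _]].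
    rewrite /= {1}/phi llogK// /phi invgK !mulgA mulVg mul1g mulgVK.
    by rewrite XE.
  by have [] := mulmx1_unit AB.
move=> eta eta0; have [d2 d20 d2P] := sA eta eta0.
have m0 : 0 < Num.min d1 d2 by rewrite !lt_min d10.
exists (Num.min d1 d2 / 2) => [|X Xr]; first by rewrite divr_gt0.
have : `|X| < Num.min d1 d2 by lra.
rewrite lt_min => /andP[X1 X2]; split; first exact: d1P.
by have := d2P 0 X; rewrite subrr normr0 !subr0 phi0 llog1 subr0; apply.
Qed.

End LieExp.

Section CosetFrame.
Context {R : realType} {G : lieGroupType R} (Gamma : groupClosed G).
Local Notation n := (@lie_dim R G).
Local Notation M := (coset_space Gamma).
Local Notation pi := (coset_pi Gamma).
Variable c : chart R G n.
Hypotheses (cA : lie_atlas c) (c1 : chart_dom c 1%g).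
Hypotheses (disc : discrete_subgroup Gamma) (cM : compact [set: M]).

Definition coset_exp (X : 'rV[R]_n) (x : M) : M := translation (lexp c X) x.

Lemma coset_exp_pi X a : coset_exp X (pi a) = pi (lexp c X * a)%g.
Proof. exact: translation_pi. Qed.

Lemma near_lexp_mul (a : G) (P : set G) : nbhs a P ->
  exists2 r : R, 0 < r & \forall b \near a, forall X, `|X| <= r ->
    P (lexp c X * b)%g.
Proof.
rewrite -{1}[a]mul1g => /near_mulg[[P1 P2] /= [nP1 nP2] P12].
have [r r0 rP] := near_lexp cA c1 nP1.
exists (r / 2); first by rewrite divr_gt0.
apply: filterS nP2 => b P2b X Xr; apply: (P12 (_, _)); split=> //=.
by have [|_ _] := rP X; first by lra.
Qed.

(** Near a point, [lexp X * b] stays in an open set on which the projection is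
    injective; compactness gives a uniform radius. *)
Lemma coset_exp_inj : exists2 r : R, 0 < r & forall x X Y,
  `|X| <= r -> `|Y| <= r -> coset_exp X x = coset_exp Y x -> X = Y.
Proof.
have [||r r0 rP] := @uniform_radius R G Gamma (fun r x => forall X Y,
  `|X| <= r -> `|Y| <= r -> coset_exp X x = coset_exp Y x -> X = Y) cM.
- move=> r r' x _ rr' rP X Y Xr Yr; apply: rP; exact: le_trans rr'.
- move=> a; have [U oU Uinj] := pi_locally_inj a disc.
  have [r1 r10 r1P] := near_lexp_mul (open_nbhs_nbhs oU).
  have [r2 r20 r2P] := near_lexp cA c1 (nbhs_dom cA c1).
  exists (Num.min r1 (r2 / 2)); first by rewrite lt_min r10 divr_gt0.
  apply: filterS r1P => b bP X Y.
  rewrite !le_min => /andP[X1 X2] /andP[Y1 Y2]; rewrite !coset_exp_pi.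
  move=> /Uinj; rewrite !inE => /(_ (bP X X1) (bP Y Y1)) /mulIg XY.
  have [|_ <- _] := r2P X; first by lra.
  have [|_ <- _] := r2P Y; first by lra.
  by rewrite XY.
- by exists r.
Qed.

(** Exponential coordinates at different points of [G] are exchanged by right
    translations, so the estimates at the identity hold uniformly. The remaining
    clauses are local and follow from compactness. *)
Lemma coset_exp_frame : exp_frame coset_exp.
Proof.
split.
- by move=> x; rewrite /coset_exp lexp0// translation1.
- exact: coset_exp_inj.
- move=> eta eta0; have [r r0 rP] := lexp_mul cA c1 eta0; exists r => // x X Y Xr Yr.
  have [cXY ZP] := rP X Y Xr Yr; exists (llog c (lexp c X * lexp c Y)%g) => //.
  by rewrite /coset_exp llogK// translationM.
- move=> eta eta0; have [r r0 rP] := lexp_div cA c1 eta0; exists r => // x Y Z Yr Zr.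
  have [cYZ WP] := rP Y Z Yr Zr; exists (llog c (lexp c Z * (lexp c Y)^-1)%g) => //.
  by rewrite /coset_exp llogK// -translationM mulgVK.
- move=> C [Co CT].
  apply: (@uniform_radius R G Gamma (fun r x => exists2 B, C B &
    forall X : 'rV[R]_n, `|X| <= r -> B (coset_exp X x)) cM).
    move=> r r' x _ rr' [B CB BP]; exists B => // X Xr; apply: BP.
    exact: le_trans rr'.
  move=> a; have [B CB Ba] : exists2 B, C B & B (pi a).
    by have : [set: M] (pi a) by []; rewrite -CT => -[B]; exists B.
  have nB : nbhs a (pi @^-1` B).
    by apply: (@pi_continuous R G Gamma a); apply: open_nbhs_nbhs; split=> //;
       exact: Co.
  have [r r0 rP] := near_lexp_mul nB; exists r => //.
  apply: filterS rP => b bP; exists B => // X Xr.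
  by rewrite coset_exp_pi; exact: bP.
- move=> r r0.
  have nV : nbhs (1 * 1^-1)%g [set a | chart_dom c a /\ `|llog c a| < r].
    rewrite mulgV; have [oD _ _ cc _] := lie_is_chart cA.
    apply: filterI; first exact: nbhs_dom.
    have /nbhs_rVP nr : exists2 d : R, 0 < d &
      forall z, `|z - c 1%g| < d -> `|z - c 1%g| < r by exists r.
    exact: (cc _ c1 _ nr).
  have [[V1 V2] /= [nV1 nV2] V12] := near_mulg nV.
  have nV2' : nbhs 1%g [set a : G | V2 a^-1%g].
    exact: (@invg_continuous _ _ 1%g).
  have : nbhs 1%g (V1 `&` [set a | V2 a^-1%g]) by exact: filterI.
  rewrite nbhsE /= => -[V [oV V1'] VP].
  exists [set B | exists a, B = pi @` ((fun b => b * a^-1)%g @^-1` V)].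
    split.
      move=> _ [a ->]; apply: pi_open; apply: open_comp oV => b _ P.
      by move=> /near_mulg_r.
    rewrite -subTset => x _; have [a ->] := pi_surj x.
    exists (pi @` ((fun b => b * a^-1)%g @^-1` V)); first by exists a.
    by exists a => //=; rewrite mulgV.
  move=> _ _ _ [a ->] [b Vb <-] [b' Vb' <-].
  have [cbb nbb] : chart_dom c (b' * a^-1 * (b * a^-1)^-1)%g /\
      `|llog c (b' * a^-1 * (b * a^-1)^-1)%g| < r.
    apply: (V12 (_, _)); split=> /=.
      by have [] := VP _ Vb'.
    by have [] := VP _ Vb.
  exists (llog c (b' * a^-1 * (b * a^-1)^-1)%g); first exact: ltW.
  rewrite coset_exp_pi llogK//; congr pi.
  by rewrite invgM invgK !mulgA mulgVK mulgVK.
Qed.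

(** Since [g * lexp X = (g * lexp X * g^-1) * g], the translation by [g] acts in
    the coordinates at any point as the conjugation by [g] at the identity. *)
Lemma translation_tangent (g : G) : exists2 A, A \in unitmx &
  forall eta, 0 < eta -> tangent coset_exp (translation g) A eta.
Proof.
have [A AU AP] := lexp_conj cA c1 g; exists A => // eta eta0.
have [r r0 rP] := AP eta eta0; exists r => // x X Xr.
have [cX XA] := rP X Xr; exists (llog c (g * lexp c X * g^-1)%g) => //.
by rewrite /coset_exp llogK// -!translationM mulgVK.
Qed.

End CosetFrame.

(** * Charts of the coset space *)

Section CosetCharts.
Context {R : realType} {G : lieGroupType R} (Gamma : groupClosed G).
Local Notation n := (@lie_dim R G).
Local Notation M := (coset_space Gamma).
Local Notation pi := (coset_pi Gamma).

Definition injective_dom (c : chart R G n) (U : set G) :=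
  [/\ lie_atlas c, open U, U `<=` chart_dom c & {in U &, injective pi}].

Lemma injective_dom_at (a : G) : discrete_subgroup Gamma ->
  exists c U, injective_dom c U /\ U a.
Proof.
move=> /(pi_locally_inj a)[U [oU Ua] Uinj].
have [c cA ca] := lie_chart_at a; have [oD _ _ _ _] := lie_is_chart cA.
exists c, (U `&` chart_dom c); split; last by [].
split; first exact: cA.
- exact: openI.
- exact: subIsetr.
- by move=> b b'; rewrite !inE => -[Ub _] [Ub' _]; apply: Uinj; rewrite inE.
Qed.

Lemma coset_chartE c U a : injective_dom c U -> U a ->
  coset_chart Gamma c U (pi a) = c a.
Proof.
move=> [_ _ _ Uinj] Ua /=; congr (c _); set S := [set x | _].
have Sa : S a by [].
have [Ux pix] : U (xget 1%g S) /\ pi (xget 1%g S) = pi a.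
  exact: xgetPex (ex_intro S a Sa).
by apply: Uinj; rewrite ?inE.
Qed.

Lemma coset_chart_invE c U x : injective_dom c U ->
  chart_dom (coset_chart Gamma c U) x ->
  x = pi (chart_inv c (coset_chart Gamma c U x)).
Proof.
move=> iU [a Ua <-]; rewrite (coset_chartE iU)// chart_invK//.
  by have [] := iU.
by have [_ _ + _] := iU; apply.
Qed.

Lemma coset_chart_atlas c U : injective_dom c U ->
  coset_atlas Gamma (coset_chart Gamma c U).
Proof. by move=> [cA oU UD Uinj]; exists c, U. Qed.

(** Locally the translation lifts to [b |-> g * b * gam] for a fixed element
    [gam] of the subgroup. *)
Lemma translation_Ck1 g :
  is_Ck 1 (coset_atlas Gamma) (coset_atlas Gamma) (translation g).
Proof.
split; first exact: translation_continuous.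
move=> _ _ [c [U [cA oU UD Uinj ->]]] [c' [U' [c'A oU' UD' Uinj' ->]]].
have iU : injective_dom c U by [].
have iU' : injective_dom c' U' by [].
set d := coset_chart _ c U; set d' := coset_chart _ c' U'; set S := (X in Ck_on 1 X).
have key X0 : S X0 -> exists a (gam : G), [/\ X0 = c a, chart_dom c a,
    chart_dom c' (g * a * gam)%g &
    \forall X \near X0, S X /\
      c' (g * chart_inv c X * gam)%g = (d' \o translation g \o chart_inv d) X].
  move=> [_ [[a Ua <-] [b U'b bE]] <-].
  rewrite /= translation_pi in bE; have /pi_eqP abG := esym bE.
  have gabE : (g * a * ((g * a)^-1 * b))%g = b by rewrite mulVKg.
  exists a, ((g * a)^-1 * b)%g; rewrite /d (coset_chartE iU)//; split=> //.
  - exact: UD.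
  - by rewrite gabE; exact: UD'.
  have nU' : nbhs (g * a * ((g * a)^-1 * b))%g U'.
    by rewrite gabE; exact: open_nbhs_nbhs.
  have nP := @filterI _ (nbhs a) (nbhs_filter a) _ _
    (open_nbhs_nbhs (conj oU Ua)) (near_mulg_l (near_mulg_r nU')).
  have := near_chart cA (UD _ Ua) nP.
  apply: filterS => X [cX XE [UX U'X]].
  have TX : translation g (pi (chart_inv c X)) =
      pi (g * chart_inv c X * ((g * a)^-1 * b))%g.
    by rewrite translation_pi; apply/pi_eqP; rewrite mulKg.
  split; last exact: esym (etrans (congr1 d' TX) (coset_chartE iU' U'X)).
  exists (pi (chart_inv c X)); last by rewrite /d (coset_chartE iU).
  split; first by exists (chart_inv c X).
  by rewrite /= TX; exists (g * chart_inv c X * ((g * a)^-1 * b))%g.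
apply: sdiff_C1.
  rewrite openE => X0 /key[a [gam [_ _ _]]]; rewrite /interior.
  by apply: filterS => X [].
move=> X0 /key[a [gam [X0E ca c'a near]]].
have : lie_sdiff (fun X => g * chart_inv c X * gam)%g X0.
  apply: lie_sdiff_mul; last exact: lie_sdiff_cst.
  by apply: lie_sdiff_mul; [exact: lie_sdiff_cst|rewrite X0E; exact: lie_sdiff_chart_inv].
move=> [_ /(_ c' c'A)]; rewrite X0E chart_invK// => /(_ c'a)[A sA].
exists A; rewrite -X0E in sA *; apply: sdiff_eq_near sA.
by apply: filterS near => X [].
Qed.

Lemma translation_C1_diffeo (g : G) :
  is_C1_diffeo (coset_atlas Gamma) (translation g).
Proof.
exists (translation g^-1%g); split; [| |exact: translation_Ck1..].
- by move=> x; rewrite -translationM mulVg translation1.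
- by move=> x; rewrite -translationM mulgV translation1.
Qed.

Definition translation_diffeo (g : G) : C1_diffeo (coset_atlas Gamma) :=
  C1Diffeo (translation_C1_diffeo g).

End CosetCharts.

(** * Perturbations *)

Section LocalCoordinates.
Context {R : realType} {G : lieGroupType R} (Gamma : groupClosed G).
Local Notation n := (@lie_dim R G).
Local Notation M := (coset_space Gamma).
Local Notation pi := (coset_pi Gamma).
Variable c : chart R G n.
Hypotheses (cA : lie_atlas c) (c1 : chart_dom c 1%g).

(** How the points [e X x] for small [X] are seen in a fixed chart near [x]. *)
Lemma chart_exp_lip c0 (U : set G) a0 : lie_atlas c0 -> open U -> U a0 ->
  U `<=` chart_dom c0 -> exists2 D : R, 0 < D & exists2 d : R, 0 < d &
  forall xi X, `|xi - c0 a0| < d -> `|X| < d ->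
    [/\ U (chart_inv c0 xi), c0 (chart_inv c0 xi) = xi,
      U (lexp c X * chart_inv c0 xi)%g &
      `|c0 (lexp c X * chart_inv c0 xi)%g - xi| <= D * `|X|].
Proof.
move=> c0A oU Ua0 UD; have c0a := UD _ Ua0.
pose phi (v : 'rV[R]_(n + n)) := (lexp c (lsubmx v) * chart_inv c0 (rsubmx v))%g.
have phi0 : phi (row_mx 0 (c0 a0)) = a0.
  by rewrite /phi row_mxKl row_mxKr lexp0// mul1g chart_invK.
have gphi : lie_sdiff phi (row_mx 0 (c0 a0)).
  apply: lie_sdiff_mul.
    by apply: (lie_sdiff_lexp cA c1 (sdiff_lsubmx _)); rewrite row_mxKl.
  apply: (lie_sdiff_comp (sdiff_rsubmx _)).
  by rewrite row_mxKr; exact: lie_sdiff_chart_inv.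
have [A sA] : exists A, sdiff (c0 \o phi) (row_mx 0 (c0 a0)) A.
  by apply: gphi.2 => //; rewrite phi0.
have [d1 d10 d1P] : exists2 d : R, 0 < d &
    forall v, `|v - row_mx 0 (c0 a0)| < d -> U (phi v).
  by apply: lie_sdiff_near => //; rewrite phi0; exact: open_nbhs_nbhs.
have [D D0 [d2 d20 d2P]] := sdiff_lip sA.
have nU : nbhs a0 U by exact: open_nbhs_nbhs.
have /nbhs_rVP[d3 d30 d3P] := near_chart c0A c0a nU.
pose d := Num.min (Num.min d1 d2) d3.
have d0 : 0 < d by rewrite !lt_min d10 d20.
exists D => //; exists (d / 2) => [|xi X xid Xd]; first by rewrite divr_gt0.
have nv (Z : 'rV[R]_n) : `|Z| < d / 2 -> `|row_mx Z xi - row_mx 0 (c0 a0)| < d.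
  move=> Zd; rewrite opp_row_mx add_row_mx subr0.
  by apply: le_lt_trans (_ : d / 2 < _); [apply: norm_row_mx_le; exact: ltW|lra].
have := nv X Xd; rewrite !lt_min => /andP[/andP[X1 X2] _].
have := nv 0; rewrite normr0 divr_gt0// => /(_ isT).
rewrite !lt_min => /andP[/andP[_ O2] _].
have [|cxi xiE Uxi] := d3P xi.
  have : `|xi - c0 a0| < d by lra.
  by rewrite !lt_min => /andP[].
have phiE Z : phi (row_mx Z xi) = (lexp c Z * chart_inv c0 xi)%g.
  by rewrite /phi row_mxKl row_mxKr.
split=> //; first by rewrite -phiE; exact: d1P.
have := d2P _ _ O2 X2; rewrite /= !phiE lexp0// mul1g xiE.
move=> /le_trans; apply; rewrite opp_row_mx add_row_mx subrr subr0.
by rewrite ler_wpM2l ?(ltW D0)//; apply: norm_row_mx_le => //; rewrite normr0.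
Qed.

(** Conversely, the coordinate of [z] centred at [u] is almost linear in the
    difference of their coordinates in a fixed chart, with the same matrix [w]
    for all points near [b0]. *)
Lemma chart_div_diff c0 b0 : lie_atlas c0 -> chart_dom c0 b0 ->
  exists w : 'M[R]_n, forall eta : R, 0 < eta -> exists2 d : R, 0 < d &
  forall u z, `|u - c0 b0| < d -> `|z - c0 b0| < d ->
    exists2 Y, chart_inv c0 z = (lexp c Y * chart_inv c0 u)%g &
      `|Y - (z - u) *m w| <= eta * `|z - u|.
Proof.
move=> c0A c0b.
pose phi (v : 'rV[R]_(n + n)) :=
  (chart_inv c0 (rsubmx v) * (chart_inv c0 (lsubmx v))^-1)%g.
have phi0 : phi (row_mx (c0 b0) (c0 b0)) = 1%g.
  by rewrite /phi row_mxKl row_mxKr mulgV.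
have gphi : lie_sdiff phi (row_mx (c0 b0) (c0 b0)).
  apply: lie_sdiff_mul.
    by apply: (lie_sdiff_comp (sdiff_rsubmx _)); rewrite row_mxKr; exact: lie_sdiff_chart_inv.
  apply: lie_sdiff_inv; apply: (lie_sdiff_comp (sdiff_lsubmx _)).
  by rewrite row_mxKl; exact: lie_sdiff_chart_inv.
have [A sA] : exists A, sdiff (fun v => llog c (phi v)) (row_mx (c0 b0) (c0 b0)) A.
  by apply: sdiff_llog => //; rewrite phi0.
have [d1 d10 d1P] : exists2 d : R, 0 < d &
    forall v, `|v - row_mx (c0 b0) (c0 b0)| < d -> chart_dom c (phi v).
  by apply: lie_sdiff_near => //; rewrite phi0; exact: nbhs_dom.
exists (dsubmx A) => eta eta0; have [d2 d20 d2P] := sdiff_partial2 sA eta0.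
have m0 : 0 < Num.min d1 d2 by rewrite lt_min d10.
exists (Num.min d1 d2 / 2) => [|u z ud zd]; first by rewrite divr_gt0.
have phiE v w : phi (row_mx v w) = (chart_inv c0 w * (chart_inv c0 v)^-1)%g.
  by rewrite /phi row_mxKl row_mxKr.
have := lt_min (Num.min d1 d2 / 2) d1 d2.
have h1 : Num.min d1 d2 / 2 < Num.min d1 d2 by lra.
move: (h1); rewrite lt_min => /andP[h1' h2'] _.
exists (llog c (phi (row_mx u z))).
  rewrite llogK//; first by rewrite phiE mulgVK.
  apply: d1P; rewrite opp_row_mx add_row_mx; apply: le_lt_trans h1'.
  by apply: norm_row_mx_le; exact: ltW.
have := d2P u u z (lt_trans ud h2') (lt_trans ud h2') (lt_trans zd h2').
by rewrite (phiE u u) mulgV llog1 subr0.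
Qed.

End LocalCoordinates.

Section Perturbation.
Context {R : realType} {G : lieGroupType R} (Gamma : groupClosed G).
Local Notation n := (@lie_dim R G).
Local Notation M := (coset_space Gamma).
Local Notation pi := (coset_pi Gamma).
Local Notation diffeo := (C1_diffeo (coset_atlas Gamma)).
Variable c : chart R G n.
Hypotheses (cA : lie_atlas c) (c1 : chart_dom c 1%g).
Hypotheses (disc : discrete_subgroup Gamma) (cM : compact [set: M]).
Local Notation e := (coset_exp (Gamma := Gamma) c).

Lemma diffeo_continuous (f : diffeo) : continuous f.
Proof. by have [f' [_ _ [cf _] _]] := C1_funP f. Qed.

Lemma diffeo_Ck1 (f : diffeo) (d d' : chart R M n) :
  coset_atlas Gamma d -> coset_atlas Gamma d' ->
  Ck_on 1 (d @` (chart_dom d `&` f @^-1` chart_dom d')) (d' \o f \o chart_inv d).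
Proof. by move=> dA d'A; have [f' [_ _ [_ Cf] _]] := C1_funP f; exact: Cf. Qed.

Lemma diffeo_sdiff (f : diffeo) c0 U c0' U' a0 b0 :
  injective_dom Gamma c0 U -> injective_dom Gamma c0' U' -> U a0 -> U' b0 ->
  f (pi a0) = pi b0 ->
  (\forall xi \near c0 a0, [/\ U (chart_inv c0 xi), c0 (chart_inv c0 xi) = xi &
     chart_dom (coset_chart Gamma c0' U') (f (pi (chart_inv c0 xi)))]) /\
  exists A, sdiff (coset_chart Gamma c0' U' \o f \o
    chart_inv (coset_chart Gamma c0 U)) (c0 a0) A.
Proof.
move=> iU iU' Ua0 U'b0 fa0.
have [c0A oU UD Uinj] := iU; have [c0A' oU' UD' Uinj'] := iU'.
have nU' : nbhs a0 [set a | chart_dom (coset_chart Gamma c0' U') (f (pi a))].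
  apply: (continuous_comp (@pi_continuous R G Gamma a0)
    (@diffeo_continuous f (pi a0))).
  rewrite /= fa0; apply: open_nbhs_nbhs; split; first exact: pi_open.
  by exists b0.
have nP := @filterI _ (nbhs a0) (nbhs_filter a0) _ _
  (open_nbhs_nbhs (conj oU Ua0)) nU'.
have nX := near_chart c0A (UD _ Ua0) nP.
split; first by apply: filterS nX => xi [_ xiE []].
apply: C1_sdiff (diffeo_Ck1 f (coset_chart_atlas iU) (coset_chart_atlas iU')).
apply: filterS nX => xi [_ xiE [Uxi U'xi]].
exists (pi (chart_inv c0 xi)); last by rewrite (coset_chartE iU).
by split=> //; exists (chart_inv c0 xi).
Qed.

(** The quotient of two lifts of [f (e X x)] and [f x] to [G], read off in a
    chart around [f x], is a coordinate of the first centred at the second. *)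
Lemma coords_transfer (f : M -> M) c0 U c0' U' a X Y u :
  injective_dom Gamma c0 U -> injective_dom Gamma c0' U' ->
  U a -> U (lexp c X * a)%g ->
  chart_dom (coset_chart Gamma c0' U') (f (pi a)) ->
  chart_dom (coset_chart Gamma c0' U') (f (pi (lexp c X * a)%g)) ->
  u = coset_chart Gamma c0' U' (f (pi a)) ->
  chart_inv c0' (coset_chart Gamma c0' U' (f (pi (lexp c X * a)%g))) =
    (lexp c Y * chart_inv c0' u)%g ->
  f (e X (pi a)) = e Y (f (pi a)).
Proof.
move=> iU iU' Ua UXa fa fXa uE YE.
rewrite coset_exp_pi (coset_chart_invE iU' fXa) YE.
by rewrite (coset_chart_invE iU' fa) coset_exp_pi -uE.
Qed.

(** The local bounds come from a chart on each side. Using [r^-1] as Lipschitz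
    constant at scale [r] leaves a single monotone parameter for the compactness
    argument. *)
Lemma diffeo_lipschitz (f : diffeo) : exists2 L : R, 0 < L & tangent e f 0 L.
Proof.
have [||r r0 rP] := @uniform_radius R G Gamma (fun r x =>
  forall X : 'rV[R]_n, `|X| <= r -> exists2 Y, f (e X x) = e Y (f x) &
    `|Y| <= r^-1 * `|X|) cM.
- move=> r r' x r'0 rr' rP X Xr'; have [Y fY YP] := rP X (le_trans Xr' rr').
  exists Y => //; rewrite (le_trans YP)// ler_wpM2r// lef_pV2// posrE//.
  exact: lt_le_trans rr'.
- move=> a0; have [b0 fa0] := pi_surj (f (pi a0)).
  have [c0 [U [iU Ua0]]] := injective_dom_at a0 disc.
  have [c0' [U' [iU' U'b0]]] := injective_dom_at b0 disc.
  have [c0A oU UD Uinj] := iU; have [c0A' oU' UD' Uinj'] := iU'.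
  have [/nbhs_rVP[d1 d10 d1P] [A sA]] := diffeo_sdiff iU iU' Ua0 U'b0 fa0.
  set F := _ \o _ \o _ in sA.
  have [D D0 [d2 d20 d2P]] := chart_exp_lip cA c1 c0A oU Ua0 UD.
  have [E E0 [d3 d30 d3P]] := sdiff_lip sA.
  have [w wP] := chart_div_diff cA c1 c0A' (UD' _ U'b0).
  have [d4 d40 d4P] := wP 1 ltr01; have [W W0 WP] := mulmx_bound w.
  have F0 : F (c0 a0) = c0' b0.
    by rewrite /F /comp /= (chart_invK c0A (UD _ Ua0)) fa0; exact: coset_chartE.
  pose d := Num.min (Num.min d1 d2) (Num.min d3 (d4 / E)).
  have d0 : 0 < d by rewrite !lt_min d10 d20 d30 divr_gt0.
  pose L := (W + 1) * (E * D).
  have L0 : 0 < L by rewrite !mulr_gt0// addr_gt0.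
  pose r := Num.min (Num.min (d / 2 / D) (d / 2)) (Num.min (d / 2) L^-1 ).
  have r0 : 0 < r by rewrite !lt_min !divr_gt0// invr_gt0 L0.
  exists r => //.
  have nc : nbhs a0 [set b | `|c0 b - c0 a0| < d / 2].
    have [_ _ _ cc _] := lie_is_chart c0A.
    have /nbhs_rVP nr : exists2 r' : R, 0 < r' & forall z,
      `|z - c0 a0| < r' -> `|z - c0 a0| < d / 2 by exists (d / 2); rewrite ?divr_gt0.
    exact: (cc _ (UD _ Ua0) _ nr).
  have nb := @filterI _ (nbhs a0) (nbhs_filter a0) _ _
    (open_nbhs_nbhs (conj oU Ua0)) nc.
  apply: filterS nb => b [Ub /= bd] X Xr.
  have cb := chart_invK c0A (UD _ Ub).
  have [rD rd rL] : [/\ r <= d / 2 / D, r <= d / 2 & r <= L^-1].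
    by split; rewrite !ge_min lexx ?orbT.
  have dd : d / 2 < d by lra.
  have bigd z : `|z - c0 a0| < d -> [/\ `|z - c0 a0| < d1,
      `|z - c0 a0| < d2, `|z - c0 a0| < d3 & `|F z - c0' b0| < d4].
    rewrite !lt_min => /andP[/andP[z1 z2] /andP[z3 z4]]; split=> //.
    rewrite -F0; have := d3P (c0 a0) z; rewrite subrr normr0 => /(_ d30 z3).
    by move=> /le_lt_trans; apply; rewrite mulrC -ltr_pdivlMr.
  have [bd1 bd2 bd3 Fb4] := bigd _ (lt_trans bd dd).
  have Xd2 : `|X| < d2.
    have : d <= d2 by rewrite !ge_min lexx orbT.
    by move: (le_trans Xr rd); lra.
  have [_ _ UX XD] := d2P (c0 b) X bd2 Xd2; rewrite cb in UX XD.
  have [_ _ fbd] := d1P _ bd1; rewrite cb in fbd.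
  have X'd : `|c0 (lexp c X * b)%g - c0 a0| < d.
    have := ler_distD (c0 b) (c0 (lexp c X * b)%g) (c0 a0).
    have : D * `|X| <= d / 2 by rewrite mulrC -ler_pdivlMr// (le_trans Xr).
    lra.
  have [X1 X2 X3 X4] := bigd _ X'd.
  have cXb := chart_invK c0A (UD _ UX).
  have [_ _ fXd] := d1P _ X1; rewrite cXb in fXd.
  have [Y YE YP] := d4P _ _ Fb4 X4.
  exists Y.
    apply: (coords_transfer iU iU' Ub UX fbd fXd (u := F (c0 b))).
      by rewrite /F /= cb.
    by rewrite -YE /F /= cXb.
  have Fd := d3P _ _ bd3 X3.
  have YL : `|Y| <= L * `|X|.
    have := ler_norm_dist Y ((F (c0 (lexp c X * b)%g) - F (c0 b)) *m w).
    have := WP (F (c0 (lexp c X * b)%g) - F (c0 b)).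
    have := ler_wpM2l (ltW E0) XD; rewrite /L.
    move: Fd YP; set FF := F _ - F _ => Fd YP H1 H2 H3.
    have H4 : `|FF| <= E * D * `|X| by lra.
    have W1 : 0 <= W + 1 by lra.
    by have := ler_wpM2l W1 H4; lra.
  rewrite (le_trans YL)// ler_wpM2r// -[L]invrK lef_pV2// posrE ?invr_gt0//.
- exists r^-1; first by rewrite invr_gt0.
  exists r => // x X Xr; have [Y fY YP] := rP x X Xr; exists Y => //.
  by rewrite mulmx0 subr0.
Qed.

(** Finiteness only needs a Lipschitz constant, hence a count of boxes. *)
Lemma diffeo_htop_fin (f : diffeo) :
  exists2 h : R, 0 <= h & h%:E = htop f.
Proof.
have [L L0 tf] := diffeo_lipschitz f.
have eF := coset_exp_frame cA c1 disc cM.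
have [s _ sP] := box_cover (R := R) n (Num.bound `|L|).
have cf := @diffeo_continuous f.
have := @htop_le_count R M cM n e f 1 0 L s eF cf isT (ltW L0) tf.
have sP' (X Y : 'rV[R]_n) : `|X| <= 1 -> `|Y - X *m 0| <= L ->
    exists2 k, k \in s & `|Y - k| <= 1 / 2.
  move=> _; rewrite mulmx0 subr0 => YL.
  have [|k ks kP] := sP Y; first by rewrite (le_trans YL)// ltW ?lt_archi_bound.
  by exists k => //; lra.
move=> /(_ sP'); have := htop_ge0 (R := R) cM cf.
by case: (htop f) => // h; rewrite lee_fin => h0 _; exists h.
Qed.

End Perturbation.

Section Stability.
Context {R : realType} {G : lieGroupType R} (Gamma : groupClosed G).
Local Notation n := (@lie_dim R G).
Local Notation M := (coset_space Gamma).
Local Notation pi := (coset_pi Gamma).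
Local Notation diffeo := (C1_diffeo (coset_atlas Gamma)).
Variable c : chart R G n.
Hypotheses (cA : lie_atlas c) (c1 : chart_dom c 1%g).
Hypotheses (disc : discrete_subgroup Gamma) (cM : compact [set: M]).
Local Notation e := (coset_exp (Gamma := Gamma) c).

Lemma C1_subbasic_nbhs (f : diffeo) d d' (K : set M) (eps : R) :
  coset_atlas Gamma d -> coset_atlas Gamma d' -> compact K ->
  K `<=` chart_dom d -> f @` K `<=` chart_dom d' -> 0 < eps ->
  nbhs f (C1_subbasic (A := coset_atlas Gamma) f d d' K eps).
Proof.
move=> dA d'A cK Kd fK eps0.
apply: open_nbhs_nbhs; split.
  set N := C1_subbasic _ _ _ _ _.
  exists [set N]; last by rewrite bigcup_set1.
  by move=> _ ->; apply: finI_from1; exists f, d, d', K, eps.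
move=> x Kx; split.
- by apply: fK; exists x.
- by rewrite subrr normr0.
- by move=> v _; rewrite subrr normr0.
Qed.

Lemma chart_ball_compact c0 (k : 'rV[R]_n) (r : R) : lie_atlas c0 ->
  [set xi | `|xi - k| <= r] `<=` chart_cod c0 ->
  compact ((pi \o chart_inv c0) @` [set xi | `|xi - k| <= r]).
Proof.
move=> c0A ballc; apply: continuous_compact.
  apply: continuous_in_subspaceT => xi; rewrite inE => xir.
  have [_ _ _ _ cinv] := lie_is_chart c0A.
  exact: continuous_comp (cinv _ (ballc _ xir)) (@pi_continuous _ _ _ _).
apply: bounded_closed_compact.
  exists (r + `|k|); split=> [|x xr z /= zr]; first exact: num_real.
  by have := ler_norm_dist z k; lra.
rewrite (_ : [set xi | _] = (fun xi => xi - k) @^-1` [set x | `|x| <= r])//.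
apply: closed_comp; last exact: closed_norm_le.
move=> xi _ P /nbhs_rVP[d d0 dP]; apply/nbhs_rVP; exists d => // z zd.
by apply: dP; rewrite opprB addrA subrK.
Qed.

Lemma unit_ball_bound m p (J : 'M[R]_(m, p)) (eps : R) : 0 < eps ->
  (forall u : 'rV[R]_m, `|u| <= 1 -> `|u *m J| < eps) ->
  forall v : 'rV[R]_m, `|v *m J| <= eps * `|v|.
Proof.
move=> eps0 JP v; have [v0|v0] := eqVneq `|v| 0.
  by rewrite (normr0_eq0 v0) mul0mx !normr0 mulr0.
have nv : 0 < `|v| by rewrite lt_neqAle eq_sym v0 normr_ge0.
have /JP : `|(`|v|^-1 *: v)| <= 1.
  by rewrite normrZ gtr0_norm ?invr_gt0// mulVf.
rewrite -scalemxAl normrZ gtr0_norm ?invr_gt0// mulrC ltr_pdivrMr//.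
exact: ltW.
Qed.

(** The mean value inequality applied to [f - g]. *)
Lemma C1_close_lip m p (f g : 'rV[R]_m -> 'rV[R]_p) (x0 : 'rV[R]_m) (r eps : R) :
  0 < eps ->
  (forall z, `|z - x0| < r -> differentiable f z /\ differentiable g z) ->
  (forall z, `|z - x0| < r -> forall v : 'rV[R]_m, `|v| <= 1 ->
     `|'D_v f z - 'D_v g z| < eps) ->
  forall x y, `|x - x0| < r -> `|y - x0| < r ->
    `|(f y - g y) - (f x - g x)| <= eps * `|y - x|.
Proof.
move=> eps0 df De x y xr yr.
have := @mvt_ball R m p (f - g) x0 r eps 0 (ltW eps0).
have dfg z : `|z - x0| < r -> differentiable (f - g) z.
  by move=> /df[fz gz]; exact: differentiableB.
move=> /(_ dfg) /(_ _ x y xr yr); rewrite mulmx0 subr0; apply.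
move=> z v /[dup] zr /df[fz gz]; rewrite mulmx0 subr0.
rewrite deriveB; [|exact: diff_derivable|exact: diff_derivable].
have Df (h : 'rV[R]_m -> 'rV[R]_p) u : differentiable h z ->
    'D_u h z = u *m jacobian h z by exact: deriveEjacobian.
rewrite (Df f v fz) (Df g v gz) -mulmxBr; apply: unit_ball_bound => // u u1.
by have := De z zr u u1; rewrite (Df f u fz) (Df g u gz) -mulmxBr.
Qed.

(** [F1] and [F2] are the increments, in a fixed chart, of the unperturbed and
    the perturbed map, and [Z] and [Y] the same increments in exponential
    coordinates; [w] relates the two. The constants add up to [eta]. *)
Lemma perturb_estimate (X Y Z F1 F2 : 'rV[R]_n) (w B : 'M[R]_n)
    (W D E eta eta1 eps : R) :
  0 < eta1 -> 0 < W -> 0 < D -> 0 < E -> eps <= 1 ->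
  eps * (W * D) <= eta / 2 -> eta1 * ((2 * E + 1) * D + 1) = eta / 2 ->
  `|(F2 - F1) *m w| <= W * `|F2 - F1| ->
  `|F1| <= E * D * `|X| -> `|F2 - F1| <= eps * D * `|X| ->
  `|Y - F2 *m w| <= eta1 * `|F2| -> `|Z - F1 *m w| <= eta1 * `|F1| ->
  `|Z - X *m B| <= eta1 * `|X| -> `|Y - X *m B| <= eta * `|X|.
Proof.
move=> eta10 W0 D0 E0 eps1 epsW eta1E wW F1X F12 YF ZF ZX.
have X0 : 0 <= `|X| by [].
have H1 := ler_distD (F2 *m w) Y (X *m B).
have H2 := ler_distD (F1 *m w) (F2 *m w) (X *m B).
have H3 := ler_distD Z (F1 *m w) (X *m B).
rewrite (distrC (F1 *m w) Z) in H3.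
rewrite mulmxBl in wW.
have H5 := ler_wpM2l (ltW W0) F12.
have H6 := ler_wpM2r X0 epsW.
have H7 : `|F2| <= (E + 1) * D * `|X|.
  have := ler_norm_dist F2 F1.
  by have := ler_wpM2r (mulr_ge0 (ltW D0) X0) eps1; lra.
have H8 := ler_wpM2l (ltW eta10) H7.
have H9 := ler_wpM2l (ltW eta10) F1X.
have : eta1 * ((2 * E + 1) * D + 1) * `|X| = eta / 2 * `|X| by rewrite eta1E.
lra.
Qed.

Variables (T : diffeo) (A : 'M[R]_n).
Hypothesis tT : forall eta, 0 < eta -> tangent e T A eta.

(** In fixed charts around [pi a0] and its image, maps [f] close to [T] in the
    C^1 topology have increments close to those of [T], by the mean value
    inequality. Passing from a fixed chart to the exponential coordinates at the
    moving points is almost linear with a fixed matrix [w], and for [T] itself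
    the outcome is known to be [X *m A]. The radius does not depend on [f]. *)
Lemma perturb_local (eta : R) (a0 : G) : 0 < eta ->
  exists2 N, nbhs T N & exists2 r : R, 0 < r & \forall b \near a0,
    forall f, N f -> forall X : 'rV[R]_n, `|X| <= r ->
      exists2 Y, f (e X (pi b)) = e Y (f (pi b)) &
        `|Y - X *m A| <= eta * `|X|.
Proof.
move=> eta0; have [b0 Ta0] := pi_surj (T (pi a0)).
have [c0 [U [iU Ua0]]] := injective_dom_at a0 disc.
have [c0' [U' [iU' U'b0]]] := injective_dom_at b0 disc.
have [c0A oU UD Uinj] := iU; have [c0A' oU' UD' Uinj'] := iU'.
have [/nbhs_rVP[d1 d10 d1P] [B sB]] := diffeo_sdiff iU iU' Ua0 U'b0 Ta0.
set dc := coset_chart Gamma c0 U in sB; set dc' := coset_chart Gamma c0' U' in sB d1P.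
pose F (f : M -> M) := dc' \o f \o chart_inv dc.
have [D D0 [d2 d20 d2P]] := chart_exp_lip cA c1 c0A oU Ua0 UD.
have [E E0 [d3 d30 d3P]] := sdiff_lip sB; rewrite -/(F T) in d3P.
have [w wP] := chart_div_diff cA c1 c0A' (UD' _ U'b0).
have [W W0 WP] := mulmx_bound w; have [a a_0 aP] := mulmx_bound A.
have [ri ri0 riP] := coset_exp_inj cA c1 disc cM.
pose K0 := (2 * E + 1) * D + 1.
have ED0 : 0 < E * D by rewrite mulr_gt0.
have K00 : 0 < K0 by rewrite /K0; lra.
pose eta1 := eta / (2 * K0).
have eta10 : 0 < eta1 by rewrite divr_gt0// mulr_gt0.
have eta1E : eta1 * K0 = eta / 2 by rewrite /eta1; field; rewrite gt_eqF.
have [d4 d40 d4P] := wP eta1 eta10.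
have [rt rt0 rtP] := tT eta10.
have WD0 : 0 < W * D by rewrite mulr_gt0.
pose eps := Num.min (Num.min 1 (d4 / 2)) (eta / (2 * (W * D))).
have eps0 : 0 < eps.
  by rewrite !lt_min ltr01 !divr_gt0// mulr_gt0.
have [eps1 eps2 eps3] : [/\ eps <= 1, eps <= d4 / 2 & eps * (W * D) <= eta / 2].
  split; rewrite ?ge_min ?lexx ?orbT//.
  apply: le_trans (_ : eta / (2 * (W * D)) * (W * D) <= _).
    by rewrite ler_wpM2r ?(ltW WD0)// ge_min lexx orbT.
  rewrite (_ : eta / (2 * (W * D)) * (W * D) = eta / 2) ?lexx//.
  by field; rewrite !gt_eqF.
have F0 : F T (c0 a0) = c0' b0.
  by rewrite /F /comp /= (chart_invK c0A (UD _ Ua0)) Ta0; exact: coset_chartE.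
pose d := Num.min (Num.min d1 d2) (Num.min d3 (d4 / 2 / E)).
have d0 : 0 < d by rewrite !lt_min d10 d20 d30 !divr_gt0.
have bigd z : `|z - c0 a0| < d -> [/\ `|z - c0 a0| < d1,
    `|z - c0 a0| < d2, `|z - c0 a0| < d3 & `|F T z - c0' b0| < d4 / 2].
  rewrite !lt_min => /andP[/andP[z1 z2] /andP[z3 z4]]; split=> //.
  rewrite -F0; have := d3P (c0 a0) z; rewrite subrr normr0 => /(_ d30 z3).
  by move=> /le_lt_trans; apply; rewrite mulrC -ltr_pdivlMr.
pose Bd := [set xi : 'rV[R]_n | `|xi - c0 a0| <= d / 2].
pose K := (pi \o chart_inv c0) @` Bd.
have dd : d / 2 < d by lra.
have BdP xi : Bd xi -> `|xi - c0 a0| < d by move=> /le_lt_trans; apply.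
have dcA := coset_chart_atlas iU; have dcA' := coset_chart_atlas iU'.
have Kdom : K `<=` chart_dom dc.
  move=> _ [xi /BdP/bigd[xi1 _ _ _] <-]; have [Uxi _ _] := d1P _ xi1.
  by exists (chart_inv c0 xi).
have KT : T @` K `<=` chart_dom dc'.
  by move=> _ [_ [xi /BdP/bigd[xi1 _ _ _] <-] <-]; have [_ _] := d1P _ xi1.
have cK : compact K.
  apply: chart_ball_compact => // xi /BdP/bigd[xi1 _ _ _].
  have [Uxi xiE _] := d1P _ xi1; exists (chart_inv c0 xi) => //.
  exact: UD.
exists (C1_subbasic (A := coset_atlas Gamma) T dc dc' K eps).
  exact: C1_subbasic_nbhs.
pose rr := Num.min (d / 2 / (2 * D)) (d / 2).
pose r := Num.min (Num.min rr rt) (Num.min (ri / ((W + eta1) * (E * D)))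
  (ri / (a + eta1))).
have We : 0 < (W + eta1) * (E * D) by rewrite mulr_gt0// addr_gt0.
have r0 : 0 < r by rewrite !lt_min !divr_gt0// ?rt0 ?mulr_gt0// addr_gt0.
exists r => //.
have nc : nbhs a0 [set b | `|c0 b - c0 a0| < d / 4].
  have [_ _ _ cc _] := lie_is_chart c0A.
  have /nbhs_rVP nr : exists2 r' : R, 0 < r' & forall z,
    `|z - c0 a0| < r' -> `|z - c0 a0| < d / 4 by exists (d / 4); rewrite ?divr_gt0.
  exact: (cc _ (UD _ Ua0) _ nr).
have nb := @filterI _ (nbhs a0) (nbhs_filter a0) _ _
  (open_nbhs_nbhs (conj oU Ua0)) nc.
apply: filterS nb => b [Ub /= bd] f Nf X Xr.
have cb := chart_invK c0A (UD _ Ub).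
have [rD rd rt' ri1 ri2] : [/\ r <= d / 2 / (2 * D), r <= d / 2, r <= rt,
    r <= ri / ((W + eta1) * (E * D)) & r <= ri / (a + eta1)].
  by split; rewrite !ge_min lexx ?orbT.
set x' := c0 (lexp c X * b)%g.
have bd' : `|c0 b - c0 a0| < d / 2 by clear - cA c1 disc cM tT bd d0; lra.
have [bd1 bd2 bd3 Fb4] := bigd _ (lt_trans bd' dd).
have Xd2 : `|X| < d2.
  have : d <= d2 by rewrite !ge_min lexx orbT.
  by move: (le_trans Xr rd); clear - cA c1 disc cM tT d0; lra.
have [_ _ UX] := d2P (c0 b) X bd2 Xd2; rewrite cb in UX * => XD.
have X'd : `|x' - c0 a0| < d / 2.
  have := ler_distD (c0 b) x' (c0 a0).
  have : `|X| * (2 * D) <= d / 2.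
    by rewrite -ler_pdivlMr ?mulr_gt0// (le_trans Xr).
  by rewrite -/x' in XD; clear - cA c1 disc cM tT XD bd; lra.
have [X1 X2 X3 X4] := bigd _ (lt_trans X'd dd).
have cXb := chart_invK c0A (UD _ UX).
have inK z : `|z - c0 a0| < d / 2 -> K (pi (chart_inv c0 z)).
  by move=> zd; exists z => //; exact: ltW.
have dcz z : `|z - c0 a0| < d / 2 -> dc (pi (chart_inv c0 z)) = z.
  move=> zd; have [z1 _ _ _] := bigd _ (lt_trans zd dd).
  by have [Uz zE _] := d1P _ z1; rewrite /dc (coset_chartE iU).
have Fclose z : `|z - c0 a0| < d / 2 -> [/\ chart_dom dc' (f (pi (chart_inv c0 z))),
    `|F f z - F T z| < eps & forall v : 'rV[R]_n, `|v| <= 1 ->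
      `|'D_v (F f) z - 'D_v (F T) z| < eps].
  by move=> zd; have := Nf _ (inK z zd); rewrite (dcz z zd).
have Fdiff (h : diffeo) z : `|z - c0 a0| < d / 2 ->
    chart_dom dc' (h (pi (chart_inv c0 z))) -> differentiable (F h) z.
  move=> zd hz; have [+ _] := diffeo_Ck1 h dcA dcA'; apply.
  exists (pi (chart_inv c0 z)); last exact: dcz.
  by split=> //; apply: Kdom; exact: inK.
have Tdom z : `|z - c0 a0| < d / 2 -> chart_dom dc' (T (pi (chart_inv c0 z))).
  by move=> zd; apply: KT; exists (pi (chart_inv c0 z)) => //; exact: inK.
have [fbd Fbe _] := Fclose _ bd'; have [fXd FXe _] := Fclose _ X'd.
have hlip := @C1_close_lip _ _ (F f) (F T) (c0 a0) (d / 2) eps eps0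
  (fun z zd => conj (Fdiff f z zd (let: And3 h _ _ := Fclose z zd in h))
     (Fdiff T z zd (Tdom z zd)))
  (fun z zd => let: And3 _ _ h := Fclose z zd in h) _ _ bd' X'd.
have Tlip := d3P _ _ bd3 X3.
have d42 : d4 / 2 < d4 by clear - cA c1 disc cM tT d40; lra.
have fb4 : `|F f (c0 b) - c0' b0| < d4.
  by have := ler_distD (F T (c0 b)) (F f (c0 b)) (c0' b0); clear - cA c1 disc cM tT Fbe Fb4 eps2; lra.
have fX4 : `|F f x' - c0' b0| < d4.
  by have := ler_distD (F T x') (F f x') (c0' b0); clear - cA c1 disc cM tT FXe X4 eps2; lra.
have [Y YE YP] := d4P _ _ fb4 fX4.
have [Z ZE ZP] := d4P _ _ (lt_trans Fb4 d42) (lt_trans X4 d42).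
have Tbd := Tdom _ bd'; have TXd := Tdom _ X'd.
rewrite cb in fbd Tbd; rewrite /x' cXb in fXd TXd.
have FE (h : M -> M) : F h (c0 b) = dc' (h (pi b)) by rewrite /F /= cb.
have FXE (h : M -> M) : F h x' = dc' (h (pi (lexp c X * b)%g)).
  by rewrite /F /= cXb.
have fE : f (e X (pi b)) = e Y (f (pi b)).
  apply: (coords_transfer iU iU' Ub UX fbd fXd (u := F f (c0 b))).
    exact: FE.
  by rewrite -YE FXE.
have TE : T (e X (pi b)) = e Z (T (pi b)).
  apply: (coords_transfer iU iU' Ub UX Tbd TXd (u := F T (c0 b))).
    exact: FE.
  by rewrite -ZE FXE.
exists Y => //.
have X0 : 0 <= `|X| by [].
set FT := F T x' - F T (c0 b) in Tlip ZP.
set Ff := F f x' - F f (c0 b) in YP.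
have FTX : `|FT| <= E * D * `|X|.
  by have := ler_wpM2l (ltW E0) XD; rewrite -/x'; clear - cA c1 disc cM tT Tlip; lra.
have dF : `|Ff - FT| <= eps * D * `|X|.
  have := ler_wpM2l (ltW eps0) XD; rewrite -/x' mulrA; apply: le_trans.
  apply: le_trans hlip; rewrite (_ : Ff - FT =
    F f x' - F T x' - (F f (c0 b) - F T (c0 b))) ?lexx//.
  by rewrite /Ff /FT; apply/rowP => i; rewrite !mxE; ring.
have [Z' TE' Z'P] := rtP (pi b) X (le_trans Xr rt').
have ZZ' : Z = Z'.
  apply: (riP (T (pi b))); last by rewrite -TE -TE'.
    have : `|X| * ((W + eta1) * (E * D)) <= ri.
      by rewrite -ler_pdivlMr// (le_trans Xr).
    have := ler_norm_dist Z (FT *m w); have := WP FT.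
    have W1 : 0 <= W + eta1 by rewrite addr_ge0// ltW.
    by have := ler_wpM2l W1 FTX; clear - cA c1 disc cM tT ZP; lra.
  have : `|X| * (a + eta1) <= ri.
    by rewrite -ler_pdivlMr ?addr_gt0// (le_trans Xr).
  by have := ler_norm_dist Z' (X *m A); have := aP X; clear - cA c1 disc cM tT Z'P; lra.
rewrite -ZZ' in Z'P.
exact: (perturb_estimate eta10 W0 D0 E0 eps1 eps3 eta1E (WP _) FTX dF YP ZP Z'P).
Qed.

(** Compactness makes both the neighbourhood of [T] and the radius uniform. *)
Lemma perturb_tangent (eta : R) : 0 < eta ->
  exists2 N, nbhs T N & forall f, N f -> tangent e f A eta.
Proof.
move=> eta0.
pose P (fr : diffeo * R) x := forall X : 'rV[R]_n, `|X| <= fr.2 ->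
  exists2 Y, fr.1 (e X x) = e Y (fr.1 x) & `|Y - X *m A| <= eta * `|X|.
have /compact_near_coveringP cover := cM.
have [|[N V] /= [nN nV] NV] :=
    cover _ (filter_prod (nbhs T) (nbhs (0 : R)^'+)) P _.
  move=> x _; have [a0 ->] := pi_surj x.
  have [N nN [r r0 rP]] := perturb_local a0 eta0.
  exists ([set y | forall f, N f -> P (f, r) y],
          (N `*` [set r' | r' <= r])) => /=.
    split; first exact: near_pi.
    exists (N, [set r' | r' <= r]) => //=; split=> //.
    exact: nbhs_right_le.
  move=> [y [f r']] /= [Py [Nf r'r]] X Xr'.
  by apply: Py => //=; exact: le_trans r'r.
have [r [r0 Vr]] : exists r : R, 0 < r /\ V r.
  have nV' : (0 : R)^'+ ([set y | 0 < y] `&` V).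
    by apply: filterI => //; exact: nbhs_right_gt.
  by have [r [r0 Vr]] := filter_ex nV'; exists r.
exists N => // f Nf; exists r => // x X Xr.
by apply: (NV (f, r)).
Qed.

End Stability.

Theorem theoremD (R : realType) (G : lieGroupType R) (Gamma : groupClosed G)
    (g : G) :
  connected [set: G] -> semisimple G ->
  is_lattice Gamma R -> compact [set: coset_space Gamma] ->
  exists (h : C1_diffeo (coset_atlas Gamma) -> R)
         (T : C1_diffeo (coset_atlas Gamma)),
    [/\ forall f, 0 <= h f /\ (h f)%:E = htop f,
        forall x, T x = translation g x &
        {for T, continuous h}].
Proof.
move=> _ _ [disc _] cM.
have [c cA c1] := lie_chart_at (1%g : G).
have /choice[h hP] (f : C1_diffeo (coset_atlas Gamma)) :
    exists h : R, 0 <= h /\ h%:E = htop f.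
  by have [h h0 hE] := diffeo_htop_fin cA c1 disc cM f; exists h.
pose T := translation_diffeo Gamma g; exists h, T; split=> //.
have [A AU tA] := translation_tangent Gamma cA c1 g.
have tT eta : 0 < eta -> tangent (coset_exp (Gamma := Gamma) c) T A eta.
  exact: tA.
apply/(@cvgrPdist_le _ _ _ (nbhs T) (nbhs_filter T)) => eps eps0.
have [eta [L [eta0 pinch]]] :=
  htop_pinched cM (coset_exp_frame cA c1 disc cM) AU eps0.
have [N nN NP] := perturb_tangent cA c1 disc cM tT eta0.
apply: filterS nN => f /NP tf.
have [Lf Uf] := pinch f (@diffeo_continuous _ _ _ f) tf.
have [LT UT] := pinch T (@diffeo_continuous _ _ _ T) (tT _ eta0).
rewrite -(hP f).2 !lee_fin in Lf Uf; rewrite -(hP T).2 !lee_fin in LT UT.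
by rewrite ler_norml; apply/andP; split; lra.
Qed.
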